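(* There exists a constant $c>0$ such that for all sufficiently large $n$, every positive integer $b\le\frac{cn}{\log n}$ and every graph $G$ on $n$ vertices of minimum degree at least $\frac{n}{2}$, Maker has a winning strategy for the $(1:b)$ Maker-Breaker Hamiltonicity game on $G$.
   Context: All graphs are finite and simple; $\log$ is the natural logarithm. The $(1:b)$ Maker-Breaker Hamiltonicity game on $G$ is played on the board $E(G)$: Maker and Breaker alternately claim previously unclaimed edges of $G$, Maker claiming $1$ edge per turn and Breaker claiming $b$ edges per turn (or all remaining ones, if fewer remain), until all edges are claimed. Maker wins if at the end the edges claimed by Maker contain a Hamilton cycle of $G$ (a cycle passing through every vertex exactly once); otherwise Breaker wins. No assumption is made on which player moves first (Maker may be the second player). *)

(* Defs.v *)
From mathcomp Require Import all_boot.

Set Implicit Arguments.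
Unset Strict Implicit.
Unset Printing Implicit Defensive.

(** * Biased Maker-Breaker games *)

Section Game.
Variables (E : finType) (board : {set E}) (b : nat) (maker_first : bool).

(* A history lists the sets of elements claimed in the successive turns,
   oldest first; the owner of a turn is determined by its rank. *)
Definition history := seq {set E}.

Definition maker_turn (k : nat) : bool := odd k (+) maker_first.

Definition unclaimed (h : history) : {set E} := board :\: \bigcup_(A <- h) A.

Definition maker_claimed (h : history) : {set E} :=
  \bigcup_(k < size h | maker_turn k) nth set0 h k.

(* The [minn] accounts for a last turn in which fewer elements remain than the
   player is supposed to claim. *)
Definition legal_move (h : history) (A : {set E}) : bool :=
  let bias := if maker_turn (size h) then 1 else b in
  (A \subset unclaimed h) && (#|A| == minn bias #|unclaimed h|).

Definition play (h : history) : Prop :=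
  forall k, k < size h ->
    unclaimed (take k h) != set0 /\ legal_move (take k h) (nth set0 h k).

Definition complete_play (h : history) : Prop :=
  play h /\ unclaimed h = set0.

Definition maker_strategy (sigma : history -> E) : Prop :=
  forall h, play h -> maker_turn (size h) -> unclaimed h != set0 ->
    sigma h \in unclaimed h.

Definition follows (sigma : history -> E) (h : history) : Prop :=
  forall k, k < size h -> maker_turn k -> nth set0 h k = [set sigma (take k h)].

Definition maker_has_winning_strategy (wins : {set E} -> Prop) : Prop :=
  exists sigma : history -> E, maker_strategy sigma /\
    forall h, complete_play h -> follows sigma h -> wins (maker_claimed h).

End Game.

(** * Graphs *)

(* A simple graph on [V] is a symmetric irreflexive relation [e : rel V]; its
   edges are unordered pairs of vertices. *)

Definition edges (V : finType) (e : rel V) : {set {set V}} :=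
  [set [set p.1; p.2] | p : V * V & e p.1 p.2].

Definition degree (V : finType) (e : rel V) (v : V) : nat := #|[set w | e v w]|.

(* [2 < size p] excludes the degenerate closed walks of length at most two,
   which [ucycle] allows. *)
Definition contains_hamilton_cycle (V : finType) (F : {set {set V}}) : Prop :=
  exists p : seq V,
    [/\ 2 < size p, ucycle (fun x y => [set x; y] \in F) p
      & forall v : V, v \in p].

Definition maker_wins_hamiltonicity (V : finType) (e : rel V) (b : nat)
    (maker_first : bool) : Prop :=
  maker_has_winning_strategy (edges e) b maker_first
    (@contains_hamilton_cycle V).

(* Main.v *)
(* Consider edge sets [w s] indexed by words [s] of length O(n) over vertices and
   pairs of vertices, with [|w s|] at least a small multiple of [n |s|].  As
   there are [n^(O(|s|))] words of each length and [b <= c n / log n], the sum of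
   [(1 + 1/(2b))^(-|w s|)] is small, so Beck's potential strategy lets Maker's
   graph [m] meet all of them.  It remains to find five families of such sets for
   which every graph [m] meeting them is Hamiltonian.

   Two families put an expander with O(n) edges, hence itself a word of length
   O(n), into [m].  Take a cyclic order of the vertices with fewest steps outside
   [m] and cut it at such a step: no sequence of Posa rotations along edges of
   [m] can make the two ends adjacent in [m], while the expander rotates the path
   to quadratically many end pairs.  If G is neither close to two disjoint
   cliques nor close to a balanced complete bipartite graph, then from every path
   linearly many rotations by edges of G, or linearly many pairs of successive
   rotations, lead to a path closed by an edge of G; the remaining families
   make [m] contain rotations of this kind for a constant fraction of the end
   pairs, and finally a closing edge.

   In the two extremal cases almost all pairs within the sides, respectively
   across, are edges of G, so that the closing edge exists without further
   rotations, provided the cyclic order only has steps of this sort and a few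
   prescribed steps of [m] that rotations never remove: two disjoint crossing
   edges, respectively a matching inside the larger side balancing the sizes. *)

Require Import Defs.
From mathcomp Require Import all_boot all_order all_algebra.
From mathcomp Require Import reals sequences exp.
From mathcomp Require Import boolp zify ring lra.

Set Implicit Arguments.
Unset Strict Implicit.
Unset Printing Implicit Defensive.

(** * Edge families indexed by words *)

Section Codes.
Variable V : finType.

(** What shapes the proof is the length of words: besides G, a set that Maker has to meet may depend
    only on data spelled in O(n) letters, never on the whole of [m]. A path is a permutation of the
    vertices and hence such a word, but [m] is not. Rotations therefore run along a list of O(n)
    edges extracted from [m], which grows by one edge whenever a family is met; a counter (uncovered
    pairs, end pairs, matching edges) bounds the number of rounds.

    The prescribed steps of the extremal cases have a price in Posa's lemma: a vertex on such a step
    may fail to be a pivot, so expansion is measured outside a set [Z] of these vertices. Four of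
    them cost only a constant, but the balancing matching may have linearly many. It is therefore
    sought inside a pool fixed in advance, found by a random choice within the larger side, such
    that each vertex keeps linearly many usable neighbours outside the pool. *)

Definition code := seq V -> seq (V * V) -> seq (V * V) -> {set V * V}.

(* The number of words grows exponentially with their length, so Maker can only
   be asked to meet sets whose size is proportional to it. *)
Definition hits (m : rel V) (d L : nat) (w : code) : Prop :=
  forall l1 l2 l3, 0 < size l1 + size l2 + size l3 <= L ->
    #|V| * (size l1 + size l2 + size l3) <= d * #|w l1 l2 l3| ->
    exists2 p, p \in w l1 l2 l3 & m p.1 p.2.

Definition hamiltonian (m : rel V) : Prop :=
  exists p : seq V, [/\ 2 < size p, ucycle m p & forall v, v \in p].

Lemma hits_le m d d' L L' w : d <= d' -> L <= L' ->
  hits m d' L' w -> hits m d L w.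
Proof.
move=> led leL h l1 l2 l3 /andP[s0 sL] card; apply: h.
  by rewrite s0 (leq_trans sL).
by apply: leq_trans card _; rewrite leq_mul2r led orbT.
Qed.

End Codes.

(** * Rotations of paths *)

Section Steps.
Variable T : eqType.
Implicit Types (p : seq T) (a : pred (T * T)).

Definition steps p : seq (T * T) := if p is x :: q then pairmap pair x q else [::].

Lemma steps_cat p1 y z p2 :
  steps (rcons p1 y ++ z :: p2) = steps (rcons p1 y) ++ (y, z) :: steps (z :: p2).
Proof. by case: p1 => [|x p1] //=; rewrite pairmap_cat last_rcons. Qed.

Lemma steps_rcons2 p y x : steps (rcons (rcons p y) x) = rcons (steps (rcons p y)) (y, x).
Proof. by rewrite -cats1 steps_cat cats1. Qed.

Lemma count_steps_rev a p : (forall x y, a (x, y) = a (y, x)) ->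
  count a (steps (rev p)) = count a (steps p).
Proof.
move=> a_sym; elim: p => [|x [|y p] IHp] //.
rewrite !rev_cons steps_rcons2 -cats1 count_cat -rev_cons IHp /= a_sym; lia.
Qed.

Lemma mem_steps p x y : (x, y) \in steps p ->
  exists p1 p2, p = rcons p1 x ++ y :: p2.
Proof.
elim: p => [|u [|v p] IHp] //; rewrite inE => /orP[/eqP[-> ->]|/IHp[p1 [p2 ->]]].
  by exists [::], p.
by exists (u :: p1), p2.
Qed.

(** On a duplicate-free path the neighbour missing at an end defaults to [z] itself. *)
Definition prd p z : T := nth z p (index z p).-1.
Definition nxt p z : T := nth z p (index z p).+1.
(** Posa's rotation, indexed by the new end [z] instead of the pivot [prd p z]: the step into [z] is
    exchanged for the step from the pivot to the old end. *)
Definition rotz p z : seq T := take (index z p) p ++ rev (drop (index z p) p).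

Lemma index_split p1 y z p2 : uniq (rcons p1 y ++ z :: p2) ->
  index z (rcons p1 y ++ z :: p2) = size (rcons p1 y).
Proof.
rewrite cat_uniq => /and3P[_ /hasPn /(_ z) nz _].
rewrite index_cat ifN /= ?eqxx ?addn0 //.
by apply: nz; rewrite inE eqxx.
Qed.

Lemma prd_split p1 y z p2 : uniq (rcons p1 y ++ z :: p2) ->
  prd (rcons p1 y ++ z :: p2) z = y.
Proof.
move=> up; rewrite /prd index_split // size_rcons nth_cat size_rcons ltnS leqnn.
by rewrite nth_rcons ltnn eqxx.
Qed.

Lemma nxt_split p1 y z p2 : uniq (rcons p1 y ++ z :: p2) ->
  nxt (rcons p1 y ++ z :: p2) y = z.
Proof.
move=> up; have -> : rcons p1 y ++ z :: p2 = p1 ++ y :: z :: p2 by rewrite cat_rcons.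
move: up; rewrite cat_rcons cat_uniq => /and3P[_ /hasPn /(_ y) ny _].
have yp1 : y \notin p1 by apply: ny; rewrite inE eqxx.
rewrite /nxt index_cat (negbTE yp1) /= eqxx addn0 nth_cat ltnNge leqnSn /=.
by rewrite subSn // subnn.
Qed.

Lemma rotz_split p1 y z p2 : uniq (rcons p1 y ++ z :: p2) ->
  rotz (rcons p1 y ++ z :: p2) z = rcons p1 y ++ rev (z :: p2).
Proof.
by move=> up; rewrite /rotz index_split // take_size_cat // drop_size_cat.
Qed.

Lemma split_at p z : z \in p -> 0 < index z p ->
  exists p1 y p2, p = rcons p1 y ++ z :: p2.
Proof.
case/splitPr => p1 p2; case/lastP: p1 => [|p1 y] ; first by rewrite /= eqxx.
by exists p1, y, p2.
Qed.

Lemma perm_rotz p z : perm_eq (rotz p z) p.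
Proof.
by rewrite -[X in perm_eq _ X](cat_take_drop (index z p)) perm_cat2l perm_rev.
Qed.

Lemma last_rev_cons z x p : last x (rev (z :: p)) = z.
Proof. by rewrite rev_cons last_rcons. Qed.

(** Reversing the tail is invisible to a symmetric predicate, so only the exchanged step matters;
    the additive form avoids truncated subtraction. *)
Lemma count_steps_rotz a p1 y z p2 : (forall x y, a (x, y) = a (y, x)) ->
  uniq (rcons p1 y ++ z :: p2) ->
  count a (steps (rotz (rcons p1 y ++ z :: p2) z)) + a (y, z) =
  count a (steps (rcons p1 y ++ z :: p2)) + a (y, last z p2).
Proof.
move=> a_sym up; rewrite rotz_split //.
have -> : rev (z :: p2) = last z p2 :: rev (belast z p2).
  by rewrite lastI rev_rcons.
rewrite !steps_cat !count_cat /= -[pairmap _ _ _]/(steps (last z p2 :: _)).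
rewrite -rev_rcons -lastI count_steps_rev //=; lia.
Qed.

End Steps.

Section Reach.
Variables (V : finType).
Implicit Types (g f : rel V) (p : seq V).

(** Rotations add steps of [g] and never remove a step of [f], so prescribed steps survive. Reversal
    lets both ends move. *)
Inductive reach g f p0 : seq V -> Prop :=
| reach_refl : reach g f p0 p0
| reach_rotz p z : reach g f p0 p -> z \in p -> 0 < index z p ->
    g (prd p z) (last z p) -> ~~ f (prd p z) z -> reach g f p0 (rotz p z)
| reach_rev p : reach g f p0 p -> reach g f p0 (rev p).

(** Without reversal the first vertex stays fixed, which is the setting of Posa's lemma. *)
Inductive reach_end g f p0 : seq V -> Prop :=
| reach_end_refl : reach_end g f p0 p0
| reach_end_rotz p z : reach_end g f p0 p -> z \in p -> 0 < index z p ->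
    g (prd p z) (last z p) -> ~~ f (prd p z) z -> reach_end g f p0 (rotz p z).

Lemma reach_trans g f p0 p1 p2 :
  reach g f p0 p1 -> reach g f p1 p2 -> reach g f p0 p2.
Proof.
move=> r01; elim=> // [p z _ IH|p _ IH]; first exact: reach_rotz.
exact: reach_rev.
Qed.

Lemma reach_end_reach g f p0 p : reach_end g f p0 p -> reach g f p0 p.
Proof. by elim=> [|q z _]; [exact: reach_refl|exact: reach_rotz]. Qed.

Lemma reach_sub g g' f p0 p : (forall x y, g x y -> g' x y) ->
  reach g f p0 p -> reach g' f p0 p.
Proof.
move=> sub; elim=> [|q z _ IH zq iz gz nf|q _ IH]; first exact: reach_refl.
  by apply: reach_rotz => //; apply: sub.
exact: reach_rev.
Qed.

Lemma reach_perm g f p0 p : reach g f p0 p -> perm_eq p p0.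
Proof.
elim=> [|q z _ IH _ _ _ _|q _ IH]; first exact: perm_refl.
  exact: perm_trans (perm_rotz _ _) IH.
by rewrite perm_rev.
Qed.

Lemma count_reach g f p0 p (a : pred (V * V)) : uniq p0 ->
  (forall x y, a (x, y) = a (y, x)) -> (forall x y, g x y -> ~~ a (x, y)) ->
  reach g f p0 p -> count a (steps p) <= count a (steps p0).
Proof.
move=> up0 a_sym ga; elim=> // [q z rq IH zq iz gz _|q _ IH]; last first.
  by rewrite count_steps_rev.
have uq : uniq q by rewrite (perm_uniq (reach_perm rq)).
have [p1 [y [p2 eq]]] := split_at zq iz; move: gz IH; rewrite eq in uq *.
rewrite prd_split // last_cat /= => /ga /negbTE nay; apply: leq_trans.
by have := count_steps_rotz a_sym uq; rewrite nay addn0 => <-; exact: leq_addr.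
Qed.

Lemma all_reach g f p0 p (a : pred (V * V)) : uniq p0 ->
  (forall x y, a (x, y) = a (y, x)) -> (forall x y, g x y -> a (x, y)) ->
  reach g f p0 p -> all a (steps p0) -> all a (steps p).
Proof.
move=> up0 a_sym ga rp; have all0 s : all a s = (count (predC a) s == 0).
  by rewrite -[RHS]negbK -lt0n -has_count has_predC negbK.
rewrite !all0 -!leqn0; apply: leq_trans; apply: count_reach rp => // x y /=.
  by rewrite a_sym.
by rewrite negbK; exact: ga.
Qed.

Variables (x0 : V).

(** A rotation replaces the last vertex by [z], and both are [K]-neighbours of the pivot: the old
    end through [g], the vertex [z] because the removed step is not in [f]. Hence the class of each
    end is invariant, up to the swap caused by reversal. *)
Lemma reach_classes g f (K : rel V) (kappa : V -> bool) p0 p : uniq p0 ->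
  symmetric K -> symmetric f -> (forall x y, g x y -> K x y) ->
  (forall x y z, K y x -> K y z -> kappa x = kappa z) ->
  all (fun xy => K xy.1 xy.2 || f xy.1 xy.2) (steps p0) ->
  reach g f p0 p ->
  (kappa (head x0 p) = kappa (head x0 p0) /\ kappa (last x0 p) = kappa (last x0 p0)) \/
  (kappa (head x0 p) = kappa (last x0 p0) /\ kappa (last x0 p) = kappa (head x0 p0)).
Proof.
move=> up0 Ks fs gK Kk Kp0; elim=> [|q z rq IH zq iz gz nf|q _ IH]; first by left.
- have uq : uniq q by rewrite (perm_uniq (reach_perm rq)).
  have Kq : all (fun xy => K xy.1 xy.2 || f xy.1 xy.2) (steps q).
    by apply: all_reach rq Kp0 => // x y; [rewrite /= Ks fs|move/gK => /= ->].
  have [p1 [y [p2 eq]]] := split_at zq iz; rewrite eq in uq Kq gz nf IH *.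
  move: gz nf; rewrite prd_split // => gz nf.
  have Kyz : K y z.
    move: Kq; rewrite steps_cat all_cat /= => /and3P[_ /orP[]// fyz _].
    by rewrite fyz in nf.
  rewrite last_cat /= in gz; rewrite last_cat /= in IH.
  have -> : head x0 (rotz (rcons p1 y ++ z :: p2) z) = head x0 (rcons p1 y ++ z :: p2).
    by rewrite rotz_split //; case: (p1).
  by rewrite rotz_split // last_cat last_rev_cons (Kk z y (last z p2)) // gK.
- have hr (s : seq V) : head x0 (rev s) = last x0 s /\ last x0 (rev s) = head x0 s.
    case: s => //= x s; rewrite last_rev_cons lastI rev_rcons; split=> //.
  by case: (hr q) => -> ->; case: IH => -[-> ->]; [right|left].
Qed.

End Reach.

(** * Posa's lemma relative to a set of excluded vertices *)

Section Posa.
Variables (V : finType).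

Definition nbr (g : rel V) (X : {set V}) : {set V} :=
  [set y | [exists x in X, g x y]].

Definition ends (g f : rel V) (p0 : seq V) : {set V} :=
  [set t | `[< exists2 p, reach_end g f p0 p & last t p = t >]].

Variables (g f : rel V) (p0 : seq V) (Z : {set V}).
Hypotheses (g_sym : symmetric g) (up0 : uniq p0) (p0V : forall v, v \in p0).
Hypothesis fZ : forall x y, f x y -> x \in Z.

Let adj (p : seq V) (y u : V) := 0 < count (fun c => (c == (y, u)) || (c == (u, y))) (steps p).

Let adj_split p1 y z p2 : adj (rcons p1 y ++ z :: p2) y z.
Proof. by rewrite /adj steps_cat count_cat /= eqxx; lia. Qed.

Let adj_near p y u : uniq p -> adj p y u -> y = nxt p u \/ y = prd p u.
Proof.
move=> up; rewrite /adj -has_count => /hasP[c hc /orP[]/eqP e]; rewrite {c}e in hc.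
  by case: (mem_steps hc) up => p1 [p2 ->] up; rewrite prd_split; auto.
by case: (mem_steps hc) up => p1 [p2 ->] up; rewrite nxt_split; auto.
Qed.

Lemma reach_end_facts p : reach_end g f p0 p -> uniq p /\ forall v, v \in p.
Proof.
move/reach_end_reach/reach_perm => pp; split; first by rewrite (perm_uniq pp).
by move=> v; rewrite (perm_mem pp).
Qed.

(* A vertex [y] that is neither an end nor next to an end on [p0] keeps its two
   neighbours under every rotation; rotating towards [y] would turn one of these
   into an end. *)
Lemma posa_sub : nbr g (ends g f p0) :\: Z \subset
  ends g f p0 :|: [set nxt p0 u | u in ends g f p0] :|:
  [set prd p0 u | u in ends g f p0].
Proof.
apply/subsetP => y; rewrite in_setD [y \in nbr _ _]inE => /andP[yZ /existsP[t /andP[tS gty]]].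
apply: contraT; rewrite !in_setU !negb_or -andbA => /and3P[yS ynxt yprd].
have far u : u \in ends g f p0 -> ~~ adj p0 y u.
  move=> uS; apply/negP => /(adj_near up0)[] e.
    by case/imsetP: ynxt; exists u.
  by case/imsetP: yprd; exists u.
have keep p : reach_end g f p0 p -> forall u, adj p y u = adj p0 y u.
  elim=> // q z rq IH zq iz gz nf u.
  have [uq qV] := reach_end_facts rq.
  have zS : z \in ends g f p0.
    rewrite inE; apply/asboolP; exists (rotz q z); first exact: reach_end_rotz.
    have [p1 [v [p2 eq]]] := split_at zq iz; rewrite eq in uq *.
    by rewrite rotz_split // last_cat last_rev_cons.
  have lS : last z q \in ends g f p0.
    by rewrite inE; apply/asboolP; exists q => //; case: (q) zq.
  have nyz : y != z by apply: contraNneq yS => ->.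
  have nyl : y != last z q by apply: contraNneq yS => ->.
  rewrite -IH; have [p1 [v [p2 eq]]] := split_at zq iz.
  have nyv : y != v.
    by apply/eqP => e; have := far _ zS; rewrite -IH eq -e adj_split.
  rewrite /adj; set a := fun c => _.
  have a_sym c d : a (c, d) = a (d, c).
    by rewrite /a /= !xpair_eqE orbC; congr (_ || _); rewrite andbC.
  have anot c d : y != c -> y != d -> a (c, d) = false.
    move=> yc yd; rewrite /a !xpair_eqE [c == y]eq_sym [d == y]eq_sym.
    by rewrite (negbTE yc) (negbTE yd) andbF.
  rewrite eq in uq nyl *; have := count_steps_rotz a_sym uq.
  by rewrite last_cat /= in nyl; rewrite !anot // !addn0 => ->.
move: tS; rewrite inE => /asboolP[p rp lt]; have [up pV] := reach_end_facts rp.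
have yt : y != t.
  by apply: contraNneq yS => ->; rewrite inE; apply/asboolP; exists p.
have [p1 [z [p2 ep]]] : exists p1 z p2, p = rcons p1 y ++ z :: p2.
  case/splitPr: (pV y) lt => p1 [|z p2]; first by rewrite last_cat /= => /eqP; rewrite (negbTE yt).
  by move=> _; exists p1, z, p2; rewrite cat_rcons.
have zS : z \in ends g f p0.
  rewrite inE; apply/asboolP; exists (rotz p z); last first.
    by rewrite ep in up *; rewrite rotz_split // last_cat last_rev_cons.
  apply: reach_end_rotz => //; rewrite ep in up *.
  - by rewrite index_split // size_rcons.
  - by rewrite prd_split // g_sym last_cat /=; move: lt; rewrite ep last_cat /= => ->.
  - by rewrite prd_split //; apply: contraNN yZ; apply: fZ.
by have := far _ zS; rewrite -(keep p rp) ep adj_split.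
Qed.

(** The factor is three and not the usual two because neighbours that are themselves ends are
    counted as well. *)
Lemma posa_card : #|nbr g (ends g f p0) :\: Z| <= 3 * #|ends g f p0|.
Proof.
apply: leq_trans (subset_leq_card posa_sub) _.
apply: leq_trans (leq_card_setU _ _) _.
rewrite !mulSn mul0n addn0 addnA leq_add ?leq_imset_card //.
by apply: leq_trans (leq_card_setU _ _) _; rewrite leq_add ?leq_imset_card.
Qed.

End Posa.

Lemma card_pairs (V W : finType) (Q : {set V * W}) :
  #|Q| = \sum_x #|[set y | (x, y) \in Q]|.
Proof.
transitivity (\sum_x \sum_(y | (x, y) \in Q) 1).
  by rewrite pair_big_dep -sum1_card; apply: eq_bigl => -[x y].
by apply: eq_bigr => x _; rewrite sum1dep_card.
Qed.

Section EndPairs.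
Variable V : finType.
Local Notation n := #|V|.

Definition end_pairs (Q : pred (seq V)) (g f : rel V) (p0 : seq V) : {set V * V} :=
  [set st | `[< exists q, [/\ reach g f p0 (st.1 :: q), Q (st.1 :: q) &
                             last st.1 q = st.2] >]].

Variables (g f : rel V) (p0 : seq V) (Z : {set V}) (B : nat).
Hypotheses (g_sym : symmetric g) (fZ : forall x y, f x y -> x \in Z).
Hypothesis expand : forall X : {set V}, X != set0 -> B * #|X| <= n ->
  4 * #|X| <= #|nbr g X :\: Z|.

Lemma ends_large p : uniq p -> (forall v, v \in p) -> 0 < n ->
  n < B * #|ends g f p|.
Proof.
move=> up pV n0; rewrite ltnNge; apply/negP => small.
have S0 : ends g f p != set0.
  have [v _] : exists v : V, v \in V by apply/card_gt0P.
  apply/set0Pn; exists (last v p); rewrite inE; apply/asboolP.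
  by exists p; [exact: reach_end_refl | case: (p) (pV v)].
have := expand S0 small; have := posa_card g_sym up pV fZ.
by rewrite -card_gt0 in S0; lia.
Qed.

(** Posa's lemma is used twice: it gives [n / B] last vertices [t], and, after reversing a path
    ending in [t] so that [t] stays first, again [n / B] ends for each of them. *)
Lemma end_pairs_large : uniq p0 -> (forall v, v \in p0) -> 0 < n ->
  n * n <= B * B * #|end_pairs predT g f p0|.
Proof.
move=> up0 p0V n0.
rewrite card_pairs.
have key t : t \in ends g f p0 ->
    n <= B * #|[set s | (t, s) \in end_pairs predT g f p0]|.
  rewrite in_set => /asboolP[p rp lt]; have [up pV] := reach_end_facts up0 p0V rp.
  have ur : uniq (rev p) by rewrite rev_uniq.
  have rV v : v \in rev p by rewrite mem_rev.
  apply: leq_trans (ltnW (ends_large ur rV n0)) _; rewrite leq_mul2l; apply/orP; right.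
  apply/subset_leq_card/subsetP => s; rewrite [s \in ends _ _ _]in_set => /asboolP[q rq ls].
  rewrite inE in_set; apply/asboolP; rewrite /=.
  have hq : head t q = t.
    have : head t (rev p) = t.
      by rewrite -lt; case: (p) => //= a l; rewrite lastI rev_rcons.
    move=> ht; elim: rq {ls} => // q' z rq' IH zq iz _ _.
    have uq' : uniq q'.
      by rewrite (perm_uniq (reach_perm (reach_end_reach rq'))).
    have [p1 [y [p2 e]]] := split_at zq iz; rewrite e in uq' IH *.
    by rewrite rotz_split //; case: (p1) IH.
  have qt : t \in q.
    by rewrite (perm_mem (reach_perm (reach_end_reach rq))).
  case: q hq rq ls qt => //= a q -> rq ls _; exists q; split=> //.
  apply: reach_trans (reach_end_reach rq); apply: reach_rev.
  exact: reach_end_reach rp.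
apply: leq_trans (_ : n * (B * #|ends g f p0|) <= _).
  by rewrite leq_mul2l ltnW ?orbT // ends_large.
rewrite mulnC -mulnA -mulnA leq_mul2l; apply/orP; right.
rewrite big_distrr /= (bigID (fun t => t \in ends g f p0)) /=.
apply: leq_trans (leq_addr _ _).
by rewrite -sum_nat_const; apply: leq_sum => t /key.
Qed.

End EndPairs.

(** * Sparse expanders *)

Section Hall.
Variable V : finType.
Implicit Types (D : {set V * V}) (X U : {set V}).

Definition im D X : {set V} := [set y | [exists x in X, (x, y) \in D]].

Lemma imP D X y : reflect (exists2 x, x \in X & (x, y) \in D) (y \in im D X).
Proof.
by rewrite inE; apply: (iffP existsP) => [[x /andP[]]|[x xX xy]];
  exists x => //; rewrite xX.
Qed.

Lemma im_submod D X Y : #|im D (X :|: Y)| + #|im D (X :&: Y)| <= #|im D X| + #|im D Y|.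
Proof.
have -> : im D (X :|: Y) = im D X :|: im D Y.
  apply/setP => y; rewrite in_setU; apply/imP/orP => [[x]|[]/imP[x xX xy]].
  - by rewrite inE => /orP[] xX xy; [left|right]; apply/imP; exists x.
  - by exists x => //; rewrite inE xX.
  - by exists x => //; rewrite inE xX orbT.
rewrite -[X in _ <= X]cardsUI leq_add2l; apply/subset_leq_card/subsetP => y /imP[x].
by rewrite !in_setI => /andP[xX xY] xy; apply/andP; split; apply/imP; exists x.
Qed.

(* The edge set [D] is taken minimal; if [u] had more than [r] edges, the
   smallest tight set through [u] would lose too many neighbours when [u] is
   removed from it. *)
Lemma hall_stars (m : rel V) (U Z : {set V}) (r : nat) :
  (forall X, X \subset U -> r * #|X| <= #|nbr m X :\: Z|) ->
  exists D, [/\ (forall p, p \in D -> [/\ p.1 \in U, p.2 \notin Z & m p.1 p.2]),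
    #|D| <= r * #|U| & forall X, X \subset U -> r * #|X| <= #|im D X|].
Proof.
move=> hallm.
pose D0 := [set p | [&& p.1 \in U, p.2 \notin Z & m p.1 p.2]].
pose Pr D := [forall X : {set V}, (X \subset U) ==> (r * #|X| <= #|im D X|)].
have Pr0 : Pr D0.
  apply/forallP => X; apply/implyP => XU; apply: leq_trans (hallm X XU) _.
  apply/subset_leq_card/subsetP => y; rewrite !inE => /andP[yZ /existsP[x /andP[xX mxy]]].
  by apply/existsP; exists x; rewrite xX inE /= (subsetP XU) // yZ.
have [D /minsetP[/forallP PrD minD] subD] := minset_exists Pr0.
have {}PrD X : X \subset U -> r * #|X| <= #|im D X| by apply/implyP.
have inD p : p \in D -> [/\ p.1 \in U, p.2 \notin Z & m p.1 p.2].
  by move/(subsetP subD); rewrite inE => /and3P.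
exists D; split=> //.
have deg u : #|[set y | (u, y) \in D]| <= r * (u \in U).
  have [/eqP->|] := boolP ([set y | (u, y) \in D] == set0); first by rewrite cards0.
  case/set0Pn => y0; rewrite inE => uy0.
  have uU : u \in U by have [] := inD _ uy0.
  rewrite uU muln1.
  pose tight X := [&& X \subset U, u \in X & #|im D X| == r * #|X|].
  (* Submodularity of the neighbourhood size makes tight sets closed under intersection, so a
     minimal one through [u] is contained in every other. *)
  have tightI X Y : tight X -> tight Y -> tight (X :&: Y).
    move=> /and3P[XU uX /eqP tX] /and3P[YU uY /eqP tY]; apply/and3P; split.
    - by apply: subset_trans XU; apply: subsetIl.
    - by rewrite inE uX.
    have := im_submod D X Y; rewrite tX tY -mulnDr -[#|X| + #|Y|]cardsUI mulnDr.
    have := PrD (X :|: Y); rewrite subUset XU YU => /(_ isT).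
    have := PrD (X :&: Y); rewrite (subset_trans (subsetIl _ _) XU) => /(_ isT).
    by move=> *; apply/eqP; lia.
  (* By minimality of [D], deleting [(u, y)] violates the condition at some [X]; this [X] is tight,
     and within it [y] is reached from [u] only. *)
  have critical y : (u, y) \in D -> exists X, tight X /\ y \notin im D (X :\ u).
    move=> uy; have : ~~ Pr (D :\ (u, y)).
      apply/negP => /minD /(_ (subsetDl _ _)) e.
      by move: uy; rewrite -e !inE eqxx.
    rewrite negb_forall => /existsP[X]; rewrite negb_imply -ltnNge => /andP[XU lt].
    have imD : im D X \subset y |: im (D :\ (u, y)) X.
      apply/subsetP => z /imP[x xX xz]; rewrite in_setU1; case: eqP => //= /eqP zy.
      apply/imP; exists x => //; rewrite !inE xz andbT.
      by apply: contraNneq zy => -[_ ->].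
    have uX : u \in X.
      apply: contraLR lt => uX; rewrite -leqNgt; apply: leq_trans (PrD X XU) _.
      apply/subset_leq_card/subsetP => z /imP[x xX xz]; apply/imP; exists x => //.
      rewrite !inE xz andbT; apply: contraNneq uX => -[<- _]; exact: xX.
    have yn : y \notin im (D :\ (u, y)) X.
      apply/negP => yim; have := leq_trans (PrD X XU) (subset_leq_card imD).
      by rewrite (setUidPr _) ?sub1set // leqNgt lt.
    exists X; split.
      rewrite /tight XU uX eqn_leq PrD // andbT.
      by apply: leq_trans (subset_leq_card imD) _; rewrite cardsU1 yn.
    apply: contraNN yn => /imP[x]; rewrite in_setD1 => /andP[xu xX] xy.
    apply/imP; exists x => //; rewrite !inE xy andbT.
    by apply: contraNneq xu => -[->].
  have [X1 [tX1 _]] := critical _ uy0.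
  have [X /minsetP[tX minX] _] := minset_exists tX1.
  have := tX; case/and3P => XU uX /eqP cX.
  (* In the minimal tight set every neighbour of [u] is private to [u]. Removing [u] loses all of
     them, yet must leave [r * (#|X| - 1)] neighbours. *)
  have dis : [disjoint im D (X :\ u) & [set y | (u, y) \in D]].
    apply/pred0P => y; apply/negbTE/negP => /andP[/= yim]; rewrite inE.
    case/critical => Y [tY /negP]; apply; move: yim => /imP[x].
    rewrite in_setD1 => /andP[xu xX] xy; apply/imP; exists x => //; rewrite in_setD1 xu /=.
    by have := minX _ (tightI _ _ tX tY) (subsetIl _ _) => /setIidPl/subsetP ->.
  have sub : im D (X :\ u) :|: [set y | (u, y) \in D] \subset im D X.
    rewrite subUset; apply/andP; split; apply/subsetP => y.
      by case/imP => x; rewrite in_setD1 => /andP[_ xX] xy; apply/imP; exists x.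
    by rewrite inE => uy; apply/imP; exists u.
  have := subset_leq_card sub; rewrite cardsU disjoint_setI0 // cards0 subn0 cX.
  have := PrD (X :\ u) (subset_trans (subsetDl _ _) XU).
  by rewrite (cardsD1 u X) uX mulnDr muln1; lia.
rewrite card_pairs; apply: leq_trans (_ : \sum_u r * (u \in U) <= _).
  by apply: leq_sum => u _.
by rewrite -big_distrr /= leq_mul2l -big_mkcond sum1_card leqnn orbT.
Qed.

End Hall.

(** Bernoulli's inequality for [(1 + 1/a)^(a+1)]. With [a = 2D - 1] it says that [2D] successive
    factors [1 - 1/(2D)] amount to a halving. *)
Lemma double_expn_pred (a : nat) : 0 < a -> 2 * a ^ a.+1 <= a.+1 ^ a.+1.
Proof.
move=> a0; have bern j : a ^ j * (a + j) <= a * a.+1 ^ j.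
  elim: j => [|j IHj]; first by rewrite !expn0 addn0 mul1n muln1.
  rewrite [a.+1 ^ j.+1]expnSr mulnA; apply: leq_trans (leq_mul IHj (leqnn _)).
  by rewrite expnSr -!mulnA leq_mul2l; apply/orP; right; nia.
rewrite -(leq_pmul2l a0); apply: leq_trans (bern a.+1).
by rewrite mulnA mulnC leq_mul2l; apply/orP; right; lia.
Qed.

Section Expander.
Variable V : finType.
Definition list_rel (l : seq (V * V)) : rel V :=
  fun x y => ((x, y) \in l) || ((y, x) \in l).

(** Here [l1] lists a set [X] and [l2] a set [Y] as diagonal pairs. A graph that misses all these
    edges sends the [g]-edges it has from [X] into [Y] and [Z] only. *)
Definition code_expand (g : rel V) (Z : {set V}) : code V := fun l1 l2 _ =>
  [set p | [&& p.1 \in l1, p.2 \notin unzip1 l2, p.2 \notin Z & g p.1 p.2]].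

Definition box (g : rel V) (X Y : {set V}) : {set V * V} :=
  [set p | [&& p.1 \in X, p.2 \in Y & g p.1 p.2]].

Definition uncovered (g : rel V) (n D : nat) (l : seq (V * V)) :
    {set {set V} * {set V}} :=
  [set XY | (n * n <= D * #|box g XY.1 XY.2|) &&
            all (fun p => ~~ ((p.1 \in XY.1) && (p.2 \in XY.2))) l].

(* Adding such an edge to [l] shrinks the set of uncovered pairs by a constant
   factor; linearly many of them exhaust the at most [4 ^ n] pairs. *)
Definition code_cover (g : rel V) (n D : nat) : code V := fun _ l _ =>
  [set p | g p.1 p.2 && (2 * D * #|uncovered g n D (p :: l)| <=
                         (2 * D).-1 * #|uncovered g n D l|)].

Variables (g : rel V) (Z : {set V}) (k0 n : nat).
Hypotheses (cV : #|V| = n) (k0_gt0 : 0 < k0) (n_gt0 : 0 < n).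
Hypothesis deg_g : forall v, n <= k0 * #|[set y | g v y] :\: Z|.

Lemma box_large (X Y : {set V}) : 2 * k0 * #|Y| <= n ->
  #|X| * n <= 2 * k0 * #|box g X (~: (Y :|: Z))|.
Proof.
move=> Ysmall; rewrite card_pairs big_distrr /= -sum_nat_const big_mkcond /=.
apply: leq_sum => x _; case: ifP => // xX.
apply: leq_trans (_ : 2 * k0 * #|([set y | g x y] :\: Z) :\: Y| <= _); last first.
  rewrite leq_mul2l; apply/orP; right.
  apply/subset_leq_card/subsetP => y; rewrite !inE /= xX negb_or.
  by case/and3P => -> -> ->.
rewrite cardsD; have := subset_leq_card (subsetIr ([set y | g x y] :\: Z) Y).
have := deg_g x; move: (#|_ :&: Y|) (#|_ :\: Z|) (#|Y|) Ysmall => i a y.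
move=> yn na iy; have := leq_mul (leqnn k0) iy.
by rewrite -!mulnA !mulnBr in yn *; lia.
Qed.

(** The boxes of the [u] uncovered pairs contain at least [n^2 u / D] edges in total. An edge
    outside the family lies in fewer than [u / (2D)] of these boxes, so the family carries at least
    half of the total. *)
Lemma code_cover_large D l : 0 < D -> uncovered g n D l != set0 ->
  n * n <= 2 * D * #|code_cover g n D [::] l [::]|.
Proof.
move=> D0; rewrite -card_gt0.
have [u eu] : exists u, u = #|uncovered g n D l| by exists #|uncovered g n D l|.
rewrite -eu => u0.
set Q := code_cover _ _ _ _ _ _.
pose c (p : V * V) := #|[set XY in uncovered g n D l | p \in box g XY.1 XY.2]|.
have cons p : g p.1 p.2 -> #|uncovered g n D (p :: l)| + c p = u.
  move=> gp; rewrite eu -(cardsID [set XY | p \in box g XY.1 XY.2] (uncovered g n D l)).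
  rewrite addnC; congr (_ + _); first by apply: eq_card => XY; rewrite !inE.
  apply: eq_card => XY; rewrite !inE gp andbT /=.
  by case: (_ <= _) => //=; rewrite andbC.
have count : n * n * u <= D * \sum_(p | g p.1 p.2) c p.
  have -> : \sum_(p | g p.1 p.2) c p = \sum_(XY in uncovered g n D l) #|box g XY.1 XY.2|.
    rewrite (eq_bigr (fun p => \sum_(XY in uncovered g n D l | p \in box g XY.1 XY.2) 1)); last first.
      by move=> p _; rewrite sum1dep_card; apply: eq_card => XY; rewrite !inE.
    rewrite (exchange_big_dep (mem (uncovered g n D l))) /=; last by move=> ? ? _ /andP[].
    apply: eq_bigr => XY XYu; rewrite -sum1_card; apply: eq_bigl => p.
    by rewrite XYu !inE /= andbC andbA andbAC -!andbA; case: (g _ _); rewrite ?andbF ?andbT.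
  rewrite eu mulnC -sum_nat_const big_distrr /=; apply: leq_sum => XY.
  by rewrite inE => /andP[].
have bound : \sum_(p | g p.1 p.2) 2 * D * c p <= #|Q| * (2 * D * u) + n * n * u.
  rewrite -sum_nat_const (_ : n * n * u = \sum_(p : V * V) u); last first.
    by rewrite sum_nat_const card_prod cV.
  rewrite big_mkcond [X in _ <= X + _]big_mkcond -big_split /=.
  apply: leq_sum => p _; rewrite [p \in Q]inE; case: ifP => gp //=.
  have e3 : (2 * D).-1 * u + u = 2 * D * u by rewrite addnC -mulSn prednK // muln_gt0.
  have := congr1 (muln (2 * D)) (cons p gp); rewrite -eu mulnDr.
  move: (c p) (#|uncovered g n D (p :: l)|) => w v; case: ifP => [_|/negbT]; rewrite -?ltnNge; lia.
rewrite -big_distrr /= in bound.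
have : 2 * (n * n) * u <= (2 * D * #|Q| + n * n) * u.
  by move: (\sum_(_ | _) _) (#|Q|) bound count => S q; nia.
by rewrite leq_pmul2r // ; lia.
Qed.

Variables (m : rel V) (d L : nat).
Local Notation m' := (fun x y => m x y && g x y).

(** A violating [X] and its neighbourhood [Y] spell a word of length below [17 * #|X|], while at
    least [#|X| * n / (2 * k0)] edges lead from [X] out of [Y] and [Z], so one of them is in [m].
    The constant [34 * k0] is [17 * 2 * k0]. *)
Lemma hits_expand (X : {set V}) : hits m d L (code_expand g Z) ->
  34 * k0 <= d -> 17 * n <= L -> X != set0 -> 32 * k0 * #|X| <= n ->
  16 * #|X| <= #|nbr m' X :\: Z|.
Proof.
move=> hit dk Ln X0 Xsmall; rewrite leqNgt; apply/negP.
set Y := _ :\: Z => Ysmall.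
have Xn : #|X| <= n by rewrite -cV max_card.
have := @hit (enum X) [seq (y, y) | y <- enum Y] [::].
rewrite size_map -!cardE addn0 cV; rewrite -card_gt0 in X0.
have -> : 0 < #|X| + #|Y| <= L by move: (#|X|) (#|Y|) X0 Xn Ysmall; lia.
have -> : code_expand g Z (enum X) [seq (y, y) | y <- enum Y] [::] =
          box g X (~: (Y :|: Z)).
  apply/setP => -[x y]; rewrite 2!inE /= mem_enum /unzip1 -map_comp map_id_in //.
  by rewrite mem_enum in_setC in_setU negb_or -andbA.
have Y2 : 2 * k0 * #|Y| <= n.
  by move: (#|X|) (#|Y|) Xsmall Ysmall => x y *; nia.
have := box_large X Y2; move=> big; case=> //.
  move: (#|X|) (#|Y|) (#|box _ _ _|) Ysmall big => x y q yx big.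
  apply: leq_trans (_ : 17 * (x * n) <= _); first by nia.
  by apply: leq_trans (leq_mul (leqnn 17) big) _; nia.
case=> x y; rewrite inE /= => /and3P[xX]; rewrite in_setC in_setU negb_or => /andP[yY yZ] gxy mxy.
case/negP: yY; rewrite in_setD yZ inE; apply/existsP; exists x.
by rewrite xX mxy.
Qed.

Lemma hits_cover (D : nat) : 0 < D -> hits m d L (code_cover g n D) ->
  2 * D * (6 * D + 1) <= d -> (6 * D + 1) * n <= L ->
  exists l, [/\ size l <= 6 * D * n, forall p, p \in l -> m' p.1 p.2 &
    uncovered g n D l = set0].
Proof.
move=> D0 hit dD LD.
have [v0 _] : exists v, v \in V by apply/card_gt0P; rewrite cV.
have iter i : i <= 6 * D * n -> exists l, [/\ size l <= i,
    forall p, p \in l -> m' p.1 p.2 &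
    #|uncovered g n D l| * (2 * D) ^ i <= (2 * D).-1 ^ i * 4 ^ n].
  elim: i => [_|i IHi lei].
    exists [::]; split=> //; rewrite !expn0 muln1 mul1n.
    apply: leq_trans (max_card _) _; rewrite card_prod.
    rewrite -[4]/(2 * 2) expnMn leq_mul // -cV -cardsT -[X in _ <= 2 ^ X]cardsT.
      by rewrite -card_powerset subset_leq_card // powersetT.
    by rewrite -card_powerset subset_leq_card // powersetT.
  have [l [sl ml ul]] := IHi (ltnW lei).
  have [u0|u0] := eqVneq (uncovered g n D l) set0.
    by exists l; rewrite u0 cards0 mul0n; split=> //; rewrite leqW.
  have big := code_cover_large D0 u0.
  (* The letter [v0] is a dummy that keeps the word nonempty while [l] is empty. *)
  have := @hit [:: v0] l [::]; rewrite /= addn0 cV => hitl.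
  have {hitl} [] := hitl.
  - by apply: leq_trans LD; move: (size l) sl => s; lia.
  - move: (#|_|) (size l) big sl => q s big sl; apply: leq_trans (_ : (6 * D + 1) * (n * n) <= _).
      by nia.
    by apply: leq_trans (leq_mul (leqnn _) big) _; nia.
  move=> p; rewrite inE => /andP[gp up] mp; exists (p :: l); split=> //.
    by move=> p'; rewrite inE => /orP[/eqP ->|/ml //]; rewrite mp.
  rewrite ![_ ^ i.+1]expnS mulnCA mulnA.
  apply: leq_trans (leq_mul up (leqnn _)) _.
  by rewrite -!mulnA leq_mul2l ul orbT.
(* Every [2 * D] rounds halve the number of uncovered pairs, and [2 * n + 1] halvings exhaust the at
   most [4 ^ n] pairs. *)
have [l [sl ml ul]] := iter (2 * D * (2 * n + 1)) ltac:(nia).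
exists l; split=> //; first by nia.
apply/eqP; rewrite -cards_eq0 -leqn0 leqNgt; apply/negP => u0.
have D2 : 0 < (2 * D).-1 by lia.
have := double_expn_pred D2; rewrite prednK ?muln_gt0 // => dbl.
have : (2 * (2 * D).-1 ^ (2 * D)) ^ (2 * n + 1) <= ((2 * D) ^ (2 * D)) ^ (2 * n + 1).
  by rewrite leq_exp2r ?addn1.
rewrite expnMn -!expnM; move: ul; rewrite expnD expn1 [2 ^ (2 * n)]expnM -[2 ^ 2]/4.
have : 0 < 4 ^ n by rewrite expn_gt0.
have : 0 < (2 * D).-1 ^ (2 * D * (2 * n + 1)) by rewrite expn_gt0 D2.
move: (_ ^ (2 * D * _)) ((2 * D) ^ _) (4 ^ n) (#|_|) u0 => a b c u u0 a0 c0 h1 h2.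
have : b <= u * b by rewrite leq_pmull.
have : 0 < a * c by rewrite muln_gt0 a0.
lia.
Qed.

(** Sets of size at least [n / (64 * k0)] expand along [l0], since the box from them to the outside
    of a small neighbourhood holds [n^2 / D] edges; this fixes [D]. A maximal badly expanding set
    [U] of smaller size absorbs all failures and is repaired by at most [16 * n] star edges from
    [hall_stars]. Any [X] expands through the larger of [X :\: U] and [X :&: U], which turns 16 into
    8. *)
Lemma sparse_expander : let D := 128 * k0 * k0 in
  hits m d L (code_expand g Z) -> hits m d L (code_cover g n D) ->
  34 * k0 + 2 * D * (6 * D + 1) <= d -> (6 * D + 17) * n <= L ->
  exists l, [/\ size l <= (6 * D + 16) * n, forall p, p \in l -> m' p.1 p.2 &
    forall X : {set V}, 32 * k0 * #|X| <= n ->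
      8 * #|X| <= #|nbr (list_rel l) X :\: Z|].
Proof.
move=> D hit1 hit2 dD LD; have D0 : 0 < D by rewrite !muln_gt0 k0_gt0.
have [l0 [sl0 ml0 cov]] := hits_cover D0 hit2 ltac:(lia) ltac:(nia).
have exp1 (X : {set V}) : 32 * k0 * #|X| <= n -> 16 * #|X| <= #|nbr m' X :\: Z|.
  have [->|X0] := eqVneq X set0; first by rewrite cards0.
  by apply: hits_expand => //; [lia|nia].
pose g0 := list_rel l0.
have mid (X : {set V}) : n <= 64 * k0 * #|X| -> 32 * k0 * #|X| <= n ->
    16 * #|X| <= #|nbr g0 X :\: Z|.
  move=> Xbig Xsmall; rewrite leqNgt; apply/negP; set Y := _ :\: Z => Ysmall.
  have Y2 : 2 * k0 * #|Y| <= n.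
    by move: (#|X|) (#|Y|) Xsmall Ysmall => x y *; nia.
  have := box_large X Y2 => big.
  have : (X, ~: (Y :|: Z)) \notin uncovered g n D l0 by rewrite cov inE.
  rewrite inE /= negb_and; case/orP.
    case/negP; move: (#|X|) (#|box _ _ _|) Xbig big => x q xb qb.
    apply: leq_trans (_ : 64 * k0 * (x * n) <= _); first by nia.
    by apply: leq_trans (leq_mul (leqnn _) qb) _; rewrite /D; nia.
  case/allPn => -[x y] xy /= /negPn/andP[xX].
  rewrite in_setC in_setU negb_or => /andP[/negP yY yZ]; apply: yY.
  rewrite in_setD yZ inE; apply/existsP; exists x.
  by rewrite xX /g0 /list_rel xy.
have nbrU (h : rel V) (X Y : {set V}) : nbr h (X :|: Y) = nbr h X :|: nbr h Y.
  apply/setP => y; rewrite !inE; apply/existsP/orP => [[x]|[]/existsP[x /andP[xX xy]]].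
  - by rewrite in_setU => /andP[/orP[] xX xy]; [left|right]; apply/existsP; exists x; rewrite xX.
  - by exists x; rewrite in_setU xX.
  - by exists x; rewrite in_setU xX orbT.
pose P (X : {set V}) := (64 * k0 * #|X| < n) && (#|nbr g0 X :\: Z| <= 16 * #|X|).
have P0 : P set0.
  rewrite /P cards0 muln0 n_gt0 /= leqn0 cards_eq0; apply/eqP/setP => y.
  by rewrite !inE; apply/negbTE/negP => /andP[_ /existsP[x]]; rewrite inE.
have [U /maxsetP[PU maxU] _] := maxset_exists P0.
have /andP[Usmall Ubad] := PU.
(* A bad set disjoint from [U] could be joined to it: the union is bad again and either contradicts
   maximality or is large enough for [mid]. *)
have away (X : {set V}) : [disjoint X & U] -> 64 * k0 * #|X| < n ->
    16 * #|X| <= #|nbr g0 X :\: Z|.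
  move=> dis Xsmall; rewrite leqNgt; apply/negP => bad.
  have X0 : X != set0 by apply: contraTneq bad => ->; rewrite cards0.
  have cUX : #|U :|: X| = #|U| + #|X|.
    by rewrite cardsU disjoint_setI0 1?disjoint_sym // cards0 subn0.
  have badU : #|nbr g0 (U :|: X) :\: Z| < 16 * #|U :|: X|.
    rewrite nbrU setDUl cUX; apply: leq_ltn_trans (leq_card_setU _ _) _; lia.
  have [lt|ge] := ltnP (64 * k0 * #|U :|: X|) n; last first.
    by have := mid _ ge ltac:(nia); rewrite leqNgt badU.
  have := maxU (U :|: X); rewrite /P lt (ltnW badU) subsetUl => /(_ isT isT) e.
  by move: cUX; rewrite e; rewrite -card_gt0 in X0; lia.
have hallU (X : {set V}) : X \subset U -> 16 * #|X| <= #|nbr m' X :\: Z|.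
  by move=> /subset_leq_card XU; apply: exp1; nia.
have [S [mS cS expS]] := hall_stars hallU.
exists (l0 ++ enum S); split.
- rewrite size_cat -cardE; apply: leq_trans (leq_add sl0 cS) _.
  have : #|U| <= n by rewrite -cV max_card.
  nia.
- move=> p; rewrite mem_cat => /orP[/ml0 //|].
  by rewrite mem_enum => /mS[].
move=> X Xsmall; set h := list_rel _.
have h1 : 16 * #|X :\: U| <= #|nbr h X :\: Z|.
  apply: leq_trans (_ : #|nbr g0 (X :\: U) :\: Z| <= _); last first.
    apply/subset_leq_card/setSD/subsetP => y; rewrite !inE => /existsP[x].
    rewrite in_setD => /andP[/andP[_ xX] xy]; apply/existsP; exists x; rewrite xX /=.
    by move: xy; rewrite /h /g0 /list_rel !mem_cat => /orP[] ->; rewrite ?orbT.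
  have le : #|X :\: U| <= #|X| by rewrite subset_leq_card // subsetDl.
  have [lt|ge] := ltnP (64 * k0 * #|X :\: U|) n; last by apply: mid => //; nia.
  apply: away => //; rewrite disjoint_sym disjoints_subset.
  by apply/subsetP => y yU; rewrite !inE yU.
have h2 : 16 * #|X :&: U| <= #|nbr h X :\: Z|.
  apply: leq_trans (expS _ (subsetIr _ _)) _; apply/subset_leq_card/subsetP => y.
  case/imP => x; rewrite inE => /andP[xX xU] xy.
  have [/= _ yZ _] := mS _ xy.
  rewrite in_setD yZ inE; apply/existsP; exists x; rewrite xX /h /list_rel.
  by rewrite mem_cat mem_enum xy orbT.
by have := cardsID U X; lia.
Qed.

End Expander.

(** * Cyclic orders with fewest missing edges *)

Section CyclicSteps.
Variable T : eqType.

Definition csteps (c : seq T) : seq (T * T) :=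
  if c is x :: q then rcons (steps c) (last x q, x) else [::].

Lemma path_steps (e : rel T) x q :
  path e x q = all (fun c => e c.1 c.2) (steps (x :: q)).
Proof. by elim: q x => //= y q IHq x; rewrite IHq. Qed.

Lemma cycle_csteps (e : rel T) c : cycle e c = all (fun c => e c.1 c.2) (csteps c).
Proof.
case: c => // x q; rewrite [cycle _ _]path_steps -rcons_cons lastI steps_rcons2.
by rewrite -lastI.
Qed.

Lemma perm_csteps (s1 s2 : seq T) : perm_eq (csteps (s1 ++ s2)) (csteps (s2 ++ s1)).
Proof.
case: s1 => [|x p1]; first by rewrite cats0.
case: s2 => [|y p2]; first by rewrite cats0.
have csE u v (q1 q2 : seq T) : csteps ((u :: q1) ++ v :: q2) =
    steps (u :: q1) ++ (last u q1, v) :: rcons (steps (v :: q2)) (last v q2, u).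
  rewrite {1}/csteps /= last_cat /= -[pairmap _ _ (_ ++ _)]/(steps ((u :: q1) ++ v :: q2)).
  by rewrite lastI steps_cat -lastI -cats1 -catA cat_cons cats1.
rewrite !csE -!cats1 -cat1s perm_sym -cat1s; apply/permP => a.
by rewrite !count_cat /= !count_cat /=; lia.
Qed.

End CyclicSteps.

Section Core.
Variables (V : finType) (n : nat) (kappa : V -> bool) (beta : bool).

(** One relation for three cases: a constant [kappa] with [beta = false] allows every step, sides
    with [beta = false] allow the steps inside a side, sides with [beta = true] those across. *)
Definition compatible : rel V := fun x y => (x != y) && (kappa x (+) kappa y == beta).
Local Notation K := compatible.

Lemma compatible_sym : symmetric K.
Proof. by move=> x y; rewrite /K eq_sym addbC. Qed.

Lemma compatible_class x y z : K y x -> K y z -> kappa x = kappa z.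
Proof.
rewrite /K => /andP[_ /eqP <-] /andP[_ /eqP].
by case: (kappa x); case: (kappa y); case: (kappa z).
Qed.

Definition admissible (f : rel V) (c : seq V) : Prop :=
  [/\ uniq c, forall v, v \in c &
      all (fun xy => K xy.1 xy.2 || f xy.1 xy.2) (csteps c)].

Variables (m f : rel V).
Hypotheses (cV : #|V| = n) (n_gt2 : 2 < n).
Hypotheses (m_sym : symmetric m) (m_irr : irreflexive m).
Hypotheses (f_sym : symmetric f) (f_m : forall x y, f x y -> m x y).

Definition closable (p : seq V) : bool := if p is x :: q then m x (last x q) else false.

Record minimal_cut (p0 : seq V) : Prop := MinimalCut {
  cut_uniq : uniq p0;
  cut_full : forall v, v \in p0;
  cut_steps : all (fun xy => K xy.1 xy.2 || f xy.1 xy.2) (steps p0);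
  cut_ends : forall x0, kappa (head x0 p0) (+) kappa (last x0 p0) == beta;
  cut_open : forall g : rel V, (forall x y, g x y -> m x y && K x y) ->
    forall p, reach g f p0 p -> ~~ closable p }.

(* A cyclic order with the fewest steps outside [m] is cut at such a step: a
   rotation along edges of [m] does not create further missing steps, so no
   rotated order can be closed up by an edge of [m]. *)
Lemma hamiltonian_or_cut c0 : admissible f c0 ->
  hamiltonian m \/ exists p0, minimal_cut p0.
Proof.
move=> adm0; pose missing := fun xy : V * V => ~~ m xy.1 xy.2.
have exk : exists k, `[< exists2 c, admissible f c & count missing (csteps c) = k >].
  by exists (count missing (csteps c0)); apply/asboolP; exists c0.
case: (ex_minnP exk) => k /asboolP[c [uc cfull Kc] ck] kmin.
have missing_sym x y : missing (x, y) = missing (y, x) by rewrite /missing /= m_sym.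
have [k0|k0] := posnP k.
  left; exists c; split=> //.
    rewrite -[size c](card_uniqP uc) (leq_trans n_gt2) // -cV subset_leq_card //.
    by apply/subsetP => v _; apply: cfull.
  rewrite /ucycle uc andbT cycle_csteps -[all _ _]negbK -has_predC has_count.
  by rewrite -leqNgt leqn0; apply/eqP; rewrite -k0 -ck.
(* The cyclic order is turned so that a missing step becomes the closing one. *)
right; have [p0 [up0 p0full Kp0 virt kp0]] : exists p0, [/\ uniq p0, forall v, v \in p0,
    all (fun xy => K xy.1 xy.2 || f xy.1 xy.2) (csteps p0),
    (forall x0, missing (last x0 p0, head x0 p0)) & count missing (csteps p0) = k].
  have : has missing (csteps c) by rewrite has_count ck.
  case: c uc cfull Kc ck => // x q uc cfull Kc ck; rewrite {1}/csteps has_rcons.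
  case/orP => [virt|/hasP[[u v] uv virt]]; first by exists (x :: q).
  have [p1 [p2 e]] := mem_steps uv; rewrite e in uc cfull Kc ck.
  exists ((v :: p2) ++ rcons p1 u); split.
  - by rewrite uniq_catC.
  - by move=> w; rewrite mem_cat orbC -mem_cat.
  - by rewrite (perm_all _ (perm_csteps _ _)).
  - by move=> x0; rewrite last_cat last_rcons /=.
  - by rewrite (permP (perm_csteps _ _)).
case: p0 up0 p0full Kp0 virt kp0 => [|x q] up0 p0full Kp0 virt kp0.
  by have := kp0; rewrite /= => e; rewrite -e in k0.
move: Kp0; rewrite /csteps all_rcons /= => /andP[Kclose Kp0].
have {}Kclose : K (last x q) x.
  case/orP: Kclose => // fx; have := virt x.
  by rewrite /missing /= f_m.
exists (x :: q); split=> //.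
  move=> x0 /=; rewrite addbC; by case/andP: Kclose.
move=> g gmK p rp; apply/negP => closed.
have gm x1 y1 : g x1 y1 -> ~~ missing (x1, y1).
  by move/gmK => /andP[mxy _]; rewrite /missing /= mxy.
have gK x1 y1 : g x1 y1 -> K x1 y1 by move/gmK => /andP[].
have cost := count_reach up0 missing_sym gm rp.
have Kp : all (fun xy => K xy.1 xy.2 || f xy.1 xy.2) (steps p).
  apply: all_reach rp _ => //; first by move=> x1 y1; rewrite /= compatible_sym f_sym.
  by move=> x1 y1 /gK ->.
(* The ends keep their classes up to a swap, so a closing edge is automatically compatible and the
   closed order is admissible; it would have fewer missing steps. *)
have cls := reach_classes x up0 compatible_sym f_sym gK compatible_class Kp0 rp.
have pp := reach_perm rp.
case: p closed rp cost Kp cls pp => // y r closed rp cost Kp cls pp.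
have Ky : K (last y r) y.
  rewrite /K; apply/andP; split.
    by apply/eqP => e; move: closed; rewrite /closable e m_irr.
  move: cls Kclose => /=; rewrite /K => cls /andP[_].
  by case: cls => -[-> ->] //; rewrite addbC.
have adm : admissible f (y :: r).
  split; first by rewrite (perm_uniq pp).
    by move=> v; rewrite (perm_mem pp).
  by rewrite /csteps all_rcons Kp /= Ky.
have := kmin (count missing (csteps (y :: r))).
have -> : `[< exists2 c, admissible f c & count missing (csteps c) =
                       count missing (csteps (y :: r)) >].
  by apply/asboolP; exists (y :: r).
move=> /(_ isT); rewrite -kp0 /csteps -!cats1 !count_cat /=.
have -> : missing (last x q, x) by apply: virt.
have -> : missing (last y r, y) = false.
  by rewrite /missing /= m_sym; move: closed; rewrite /closable => ->.
by rewrite /= in cost; lia.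
Qed.

Variables (g : rel V) (Z Zs : {set V}) (k0 d L : nat).
Hypothesis k0_gt0 : 0 < k0.
Hypothesis deg_g : forall v, n <= k0 * #|[set y | g v y] :\: Zs|.
Hypotheses (fZ : forall x y, f x y -> x \in Z) (Z4 : #|Z :\: Zs| <= 4).

(** The expander avoids [Zs] only, but Posa's lemma needs all of [Z] excluded. The at most four
    further vertices lower [8 * #|X|] to [4 * #|X|], as [X] is nonempty. *)
Lemma hamiltonian_or_end_pairs c0 : let D := 128 * k0 * k0 in
  hits m d L (code_expand g Zs) -> hits m d L (code_cover g n D) ->
  34 * k0 + 2 * D * (6 * D + 1) <= d -> (6 * D + 17) * n <= L ->
  admissible f c0 ->
  hamiltonian m \/ exists p0 l, [/\ minimal_cut p0, size l <= (6 * D + 16) * n,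
    forall p, p \in l -> m p.1 p.2 && g p.1 p.2 &
    n * n <= (32 * k0) * (32 * k0) * #|end_pairs predT (list_rel l) f p0| ].
Proof.
move=> D hit1 hit2 dD LD adm0.
have [|[p0 cut]] := hamiltonian_or_cut adm0; [by left|right].
have n0 : 0 < n by apply: leq_trans n_gt2.
have [l [sl ml expl]] := sparse_expander cV k0_gt0 n0 deg_g hit1 hit2 dD LD.
exists p0, l; split=> //; rewrite -cV.
apply: end_pairs_large fZ _ (cut_uniq cut) (cut_full cut) _; last by rewrite cV.
  by move=> x y; rewrite /list_rel orbC.
move=> X X0; rewrite cV => Xsmall; have := expl X Xsmall.
rewrite -card_gt0 in X0.
suff : #|nbr (list_rel l) X :\: Zs| <= #|nbr (list_rel l) X :\: Z| + #|Z :\: Zs| by lia.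
apply: leq_trans (leq_card_setU _ _); apply/subset_leq_card/subsetP => y.
rewrite !in_setU !in_setD => /andP[-> ->].
by case: (y \in Z).
Qed.

End Core.

(** The word carries the path, the list of rotation edges and the prescribed steps: all that the set
    of end pairs depends on. *)
Definition code_close (V : finType) (g : rel V) : code V := fun l1 l2 l3 =>
  [set st | g st.1 st.2 && (st \in end_pairs predT (list_rel l2) (list_rel l3) l1)].

(** * Closing up when almost all compatible pairs are edges *)

Section NearComplete.
Variables (V : finType) (n : nat) (kappa : V -> bool) (beta : bool).
Local Notation K := (compatible kappa beta).
Variables (m g : rel V) (lf : seq (V * V)) (Z Zs : {set V}) (k0 d L : nat).
Local Notation f := (list_rel lf).
Hypotheses (cV : #|V| = n) (n_gt2 : 2 < n) (m_sym : symmetric m) (m_irr : irreflexive m).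
Hypotheses (f_m : forall x y, f x y -> m x y) (g_K : forall x y, g x y -> K x y).
Hypotheses (k0_gt0 : 0 < k0) (deg_g : forall v, n <= k0 * #|[set y | g v y] :\: Zs|).
Hypotheses (fZ : forall x y, f x y -> x \in Z) (Z4 : #|Z :\: Zs| <= 4).

Lemma list_rel_sym (l : seq (V * V)) : symmetric (list_rel l).
Proof. by move=> x y; rewrite /list_rel orbC. Qed.

Lemma code_close_open p0 l : minimal_cut kappa beta m f p0 ->
  (forall p, p \in l -> m p.1 p.2 && K p.1 p.2) ->
  forall st, st \in end_pairs predT (list_rel l) f p0 -> ~~ m st.1 st.2.
Proof.
move=> cut ml [s t]; rewrite inE => /asboolP[q /= [rq _ lt]].
have /(_ (list_rel l)) open := cut_open cut; apply: contraT => /negPn mst.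
have := open _ _ rq; rewrite /= lt mst; apply=> x y.
by case/orP => /ml //=; rewrite m_sym compatible_sym.
Qed.

Lemma end_pairs_compatible p0 (h : rel V) s t : minimal_cut kappa beta m f p0 ->
  (forall x y, h x y -> K x y) ->
  (s, t) \in end_pairs predT h f p0 -> (s == t) || K s t.
Proof.
move=> cut hK; rewrite inE => /asboolP[q /= [rq _ lt]].
have cls := reach_classes s (cut_uniq cut) (@compatible_sym V kappa beta) (list_rel_sym lf) hK
  (@compatible_class V kappa beta) (cut_steps cut) rq.
have ce := cut_ends cut s.
rewrite /K; case: eqVneq => //= _; move: cls; rewrite /= lt.
by case=> -[-> ->]; rewrite // addbC.
Qed.

(** Of the [n^2 / B] end pairs at most [n^2 / (4B)] are compatible pairs outside [g], and at most
    [n <= n^2 / (4B)] have equal ends. The remaining [n^2 / (2B)] closing edges suffice for a word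
    of length [(6D + 18) n], made of the expander, the path and [lf]; meeting one contradicts the
    cut. *)
Lemma near_complete_hamiltonian c0 :
  let D := 128 * k0 * k0 in let B := 32 * k0 * (32 * k0) in
  hits m d L (code_expand g Zs) -> hits m d L (code_cover g n D) ->
  hits m d L (code_close g) ->
  34 * k0 + 2 * D * (6 * D + 1) + 2 * B * (6 * D + 18) <= d ->
  (6 * D + 18) * n <= L -> size lf <= n ->
  4 * B <= n -> 4 * B * #|[set p | K p.1 p.2 && ~~ g p.1 p.2]| <= n * n ->
  admissible kappa beta f c0 -> hamiltonian m.
Proof.
move=> D B hit1 hit2 hit3 dD LD slf nB missing adm.
have f_sym := list_rel_sym lf.
have [//|[p0 [l [cut sl ml big]]]] := hamiltonian_or_end_pairs cV n_gt2 m_sym m_irr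
  f_sym f_m k0_gt0 deg_g fZ Z4 hit1 hit2 ltac:(lia) ltac:(nia) adm.
exfalso; set E := end_pairs _ _ _ _ in big; set M := [set p | _] in missing.
have mKl p : p \in l -> m p.1 p.2 && K p.1 p.2.
  by move/ml => /andP[-> /g_K].
have lK x y : list_rel l x y -> K x y.
  by case/orP => /mKl /andP[_] //=; rewrite compatible_sym.
have cover : #|E| <= #|code_close g p0 l lf| + (#|M| + n).
  rewrite -cV -(card_codom (f := fun v : V => (v, v))); last by move=> x y [].
  apply: leq_trans (_ : #|code_close g p0 l lf :|: (M :|: [set p in codom (fun v : V => (v, v))])| <= _).
    apply/subset_leq_card/subsetP => -[s t] stE.
    rewrite !in_setU inE /= stE andbT !inE /=.
    case/orP: (end_pairs_compatible cut lK stE) => [/eqP ->|->].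
      by apply/orP; right; apply/orP; right; apply/codomP; exists t.
    by case: (g s t).
  apply: leq_trans (leq_card_setU _ _) _; rewrite leq_add2l.
  apply: leq_trans (leq_card_setU _ _) _; rewrite leq_add2l.
  by rewrite cardsE.
have sp0 : size p0 = n.
  rewrite -cV -(card_uniqP (cut_uniq cut)); apply: eq_card => v.
  by rewrite (cut_full cut).
have := hit3 p0 l lf; rewrite sp0 cV; case.
- move: (size l) sl => s sl; apply/andP; split; first by lia.
  by apply: leq_trans LD; nia.
- move: (#|E|) (#|M|) (#|code_close _ _ _ _|) (size l) cover big missing sl => e u q s.
  rewrite -/B => cover big missing sl.
  have h1 : n * n <= 2 * B * q by nia.
  apply: leq_trans (_ : (6 * D + 18) * (n * n) <= _); first by nia.
  by apply: leq_trans (leq_mul (leqnn _) h1) _; nia.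
by move=> st; rewrite inE => /andP[_ /(code_close_open cut mKl) /negP].
Qed.

End NearComplete.

(** * Graphs far from the extremal ones *)

Section Stage.
Variables (V : finType) (n : nat) (g : rel V).

Definition rotations (Q : pred (seq V)) (p : seq V) : {set V} :=
  [set z | [&& 0 < index z p, g (prd p z) (last z p) & Q (rotz p z)]].

Definition often (k : nat) (Q : pred (seq V)) : pred (seq V) :=
  fun p => n <= k * #|rotations Q p|.

(* Adding such an edge to [l2] creates at least [n / k3] new end pairs, which can
   happen at most [k3 * n] times. *)
Definition code_stage (k3 : nat) (Q : pred (seq V)) : code V := fun l1 l2 _ =>
  let E l := end_pairs Q (list_rel l) (list_rel [::]) l1 in
  [set xy | g xy.1 xy.2 && (k3 * #|E l2| + n <= k3 * #|E (xy :: l2)|)].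

Variables (m : rel V) (d L : nat) (p0 : seq V) (Q : pred (seq V)) (k k1 S : nat).
Hypotheses (cV : #|V| = n) (up0 : uniq p0) (p0V : forall v, v \in p0).
Hypotheses (k_gt0 : 0 < k) (k1_gt0 : 0 < k1).
Local Notation E Q l := (end_pairs Q (list_rel l) (list_rel [::]) p0).

Lemma end_pairs_sub (Q' : pred (seq V)) l l' : {subset l <= l'} -> E Q' l \subset E Q' l'.
Proof.
move=> sub; apply/subsetP => st; rewrite !inE => /asboolP[q [rq Qq lt]].
apply/asboolP; exists q; split=> //; apply: reach_sub rq => x y.
by rewrite /list_rel => /orP[] /sub ->; rewrite ?orbT.
Qed.

(** Count triples of an end pair [(s, t)], whose path has [n / k] rotations into [Q], and a new end
    [z]. At least [n^3 / (k1 * k)] triples exist, and for fewer than half as many is [(s, z)] an old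
    end pair. A triple needs the edge from the predecessor of [z] to [t]; an edge serves at most [n]
    of the new triples, and fewer than [n / k3] with [k3 = 4 * k1 * k] if it is outside the
    family. *)
Lemma code_stage_large l l' : {subset l <= l'} ->
  n * n <= k1 * #|E (often k Q) l| -> 2 * k1 * k * #|E Q l'| < n * n ->
  n * n <= 4 * k1 * k * #|code_stage (4 * k1 * k) Q p0 l' [::]|.
Proof.
move=> sub E1big Esmall; set A := code_stage _ _ _ _ _.
set E1 := E (often k Q) l in E1big; set E0 := E Q l' in Esmall.
have n0 : 0 < n by rewrite lt0n; apply: contraTneq Esmall => ->; lia.
have /choice[pth pthP] : forall st : V * V, exists q : seq V, st \in E1 ->
    [/\ reach (list_rel l) (list_rel [::]) p0 (st.1 :: q),
        often k Q (st.1 :: q) & last st.1 q = st.2].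
  move=> st; case: (boolP (st \in E1)) => [|_]; last by exists [::].
  by rewrite inE => /asboolP[q ?]; exists q.
pose p (st : V * V) := st.1 :: pth st.
have up st : st \in E1 -> uniq (p st).
  by move/pthP => [/reach_perm/perm_uniq ->].
have pV st : st \in E1 -> forall v, v \in p st.
  by move/pthP => [/reach_perm/perm_mem pm _ _] v; rewrite pm p0V.
pose good := [set t : V * V * V | (t.1 \in E1) && (t.2 \in rotations Q (p t.1))].
pose old := [set t : V * V * V | (t.1.1, t.2) \in E0].
have cold : #|old| <= #|E0| * n.
  rewrite -cV -cardsT -cardsX -(card_imset _ (f := fun t : V * V * V => ((t.1.1, t.2), t.1.2))).
    by apply/subset_leq_card/subsetP => _ /imsetP[t tin ->]; rewrite in_setX in_setT andbT; rewrite in_set in tin.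
  by move=> [[s t] z] [[s' t'] z'] /= [-> -> ->].
have cgood : #|E1| * n <= k * #|good|.
  rewrite [#|good|]card_pairs big_distrr /= -sum_nat_const big_mkcond /=.
  apply: leq_sum => st _; case: ifP => // stE.
  have [_ + _] := pthP _ stE; rewrite /often => /leq_trans; apply.
  rewrite leq_mul2l; apply/orP; right; apply/subset_leq_card/subsetP => z zr.
  by rewrite inE /good inE /= stE.
pose phi (t : V * V * V) := (prd (p t.1) t.2, t.1.2).
have fibre xy : #|[set t in good :\: old | phi t == xy]| <=
    (if xy \in A then n else if g xy.1 xy.2 then #|E Q (xy :: l') :\: E0| else 0).
  set F := [set t in _ | _].
  have Fin t : t \in F -> [/\ t.1 \in E1, t.2 \in rotations Q (p t.1),
      (t.1.1, t.2) \notin E0 & phi t = xy].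
    rewrite inE in_setD /good /old !in_set => /andP[/andP[-> /andP[-> ->]] /eqP ->].
    by split.
  (* Here [s] determines the triple: the edge gives [t], hence the chosen path, and then [z] is the
     successor of the pivot. *)
  have F1 : #|F| <= n.
    rewrite -cV -(card_in_imset (f := fun t : V * V * V => t.1.1)).
      exact: max_card.
    move=> [[s t] z] [[s' t'] z'] /Fin[/= e1 r1 _ x1] /Fin[/= e2 r2 _ x2] /= ss.
    subst s'; move: x1; rewrite -x2 /phi => -[/= ep et]; subst t'.
    congr (_, _, _); move: r1 r2; rewrite !inE => /andP[i1 _] /andP[i2 _].
    have uq := up _ e1; have qV := pV _ e1.
    move: (p (s, t)) ep i1 i2 uq qV => q ep i1 i2 uq qV.
    have zq y : 0 < index y q -> y = nxt q (prd q y).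
      move=> iy; have [q1 [x [q2 e]]] := split_at (qV y) iy; rewrite e in uq *.
      by rewrite prd_split // nxt_split.
    by rewrite (zq z) // (zq z') // ep.
  have F2 : (#|F| <= if g xy.1 xy.2 then #|E Q (xy :: l') :\: E0| else 0).
    case: ifP => gxy; last first.
      rewrite leqn0 cards_eq0; apply/eqP/setP => -[[s t] z]; rewrite in_set0.
      apply/negbTE/negP => /Fin[/= e1]; rewrite inE => /and3P[_ gz _] _ x1.
      have [_ _ /= lt] := pthP _ e1; move: gz gxy; rewrite -x1 /phi /p /=.
      by rewrite lt => ->.
    rewrite -(card_in_imset (f := fun t : V * V * V => (t.1.1, t.2))); last first.
      move=> [[s t] z] [[s' t'] z'] /Fin[_ _ _ x1] /Fin[_ _ _ x2] /= [-> ->].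
      by move: x1; rewrite -x2 => -[_ ->].
    apply/subset_leq_card/subsetP => _ /imsetP[[[s t] z] /Fin[/= e1 r1 nE0 x1] ->].
    rewrite in_setD nE0 /= inE; apply/asboolP.
    have [/= rp _ /= lt] := pthP _ e1; move: r1; rewrite inE => /and3P[].
    move: rp lt (pV _ e1 z) x1; rewrite /phi [(s, t, z).1]/= [(s, t, z).2]/= /p [(s, t).1]/=.
    move: (pth _) => q rq lq zq x1 iz gz Qz.
    have rotE : rotz (s :: q) z = s :: (take (index z (s :: q)).-1 q ++
        rev (drop (index z (s :: q)) (s :: q))).
      by rewrite /rotz; case: (index z (s :: q)) iz.
    exists (take (index z (s :: q)).-1 q ++ rev (drop (index z (s :: q)) (s :: q))).
    rewrite -rotE; split=> //; last first.
      have uq : uniq (s :: q) by rewrite (perm_uniq (reach_perm rq)).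
      rewrite -[LHS]/(last s (s :: _)) -rotE; have [q1 [y [q2 e]]] := split_at zq iz.
      by rewrite e in uq *; rewrite rotz_split // last_cat last_rev_cons.
    apply: reach_rotz => //.
      apply: reach_sub rq => x y; rewrite /list_rel => /orP[] /sub xyl;
        by rewrite !inE xyl ?orbT.
    by rewrite /list_rel -x1 /= lq inE eqxx.
  by case: ifP.
have [k3 ek3] : exists k3, k3 = 4 * k1 * k by exists (4 * k1 * k).
have total : k3 * #|good :\: old| <= k3 * (#|A| * n) + n * n * n.
  rewrite -[#|good :\: old|]sum1_card (partition_big phi predT) //= !big_distrr /=.
  rewrite -sum_nat_const big_distrr /= [X in _ <= X + _]big_mkcond /=.
  have -> : n * n * n = \sum_(xy : V * V) n by rewrite sum_nat_const card_prod cV.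
  rewrite -big_split; apply: leq_sum => xy _ /=.
  rewrite sum1dep_card; apply: leq_trans (_ : k3 * _ <= _).
    by rewrite leq_mul2l; apply/orP; right; apply: fibre.
  have [xyA|xyA] := boolP (xy \in A); first exact: leq_addr.
  case: ifP => gxy; last by rewrite muln0.
  move: xyA; rewrite inE gxy /= -ek3 -/E0 -ltnNge.
  have sub' : E0 \subset E Q (xy :: l').
    by apply: end_pairs_sub => x xl; rewrite inE xl orbT.
  by rewrite cardsDS // mulnBr; move: (#|E0|) (#|E Q _|) => a b; lia.
have split_good : #|good| <= #|good :\: old| + #|old|.
  by rewrite -(cardsID old good) addnC leq_add2l subset_leq_card // subsetIr.
rewrite -ek3 -(leq_pmul2r n0).
move: (#|good|) (#|good :\: old|) (#|old|) (#|E0|) (#|E1|) (#|A|) cgood total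
  split_good Esmall E1big cold => a b c e0 e1 q cgood total split_good Esmall E1big cold.
have h1 : n * n * n <= k1 * k * a.
  apply: leq_trans (leq_mul E1big (leqnn n)) _.
  by rewrite -!mulnA leq_mul2l cgood orbT.
have h2 : 2 * (k1 * k) * c <= n * n * n.
  apply: leq_trans (leq_mul (leqnn _) cold) _.
  by rewrite mulnA leq_mul2r; apply/orP; right; lia.
have h3 : 4 * (k1 * k) * a <= 4 * (k1 * k) * b + 4 * (k1 * k) * c.
  by rewrite -mulnDr leq_mul2l split_good orbT.
rewrite mulnA in total; rewrite ek3 in total *; lia.
Qed.

Lemma stage l : (forall x, x \in l -> m x.1 x.2 && g x.1 x.2) ->
  size l <= S * n -> n * n <= k1 * #|E (often k Q) l| ->
  hits m d L (code_stage (4 * k1 * k) Q) ->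
  4 * k1 * k * (S + 1 + 4 * k1 * k) <= d -> (S + 1 + 4 * k1 * k) * n <= L ->
  exists l', [/\ size l' <= (S + 4 * k1 * k) * n,
    forall x, x \in l' -> m x.1 x.2 && g x.1 x.2 &
    n * n <= 2 * k1 * k * #|E Q l'| ].
Proof.
move=> lm sl E1big hit dS LS.
set k3 := 4 * k1 * k in hit dS LS *.
have [|n0] := posnP n.
  by move=> ->; exists [::]; rewrite !muln0; split.
have grow j : j <= k3 * n -> exists l', [/\ size l' <= S * n + j, {subset l <= l'},
    forall x, x \in l' -> m x.1 x.2 && g x.1 x.2 &
    n * n <= 2 * k1 * k * #|E Q l'| \/ j * n <= k3 * #|E Q l'| ].
  elim: j => [_|j IHj lej].
    by exists l; rewrite addn0; split=> //; right.
  have [l' [sl' sub l'm [done|more]]] := IHj (ltnW lej).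
    by exists l'; split=> //; [rewrite addnS leqW|left].
  have [done|small] := leqP (n * n) (2 * k1 * k * #|E Q l'|).
    by exists l'; split=> //; [rewrite addnS leqW|left].
  have big := code_stage_large sub E1big small.
  have := hit p0 l' [::]; rewrite addn0 cV.
  have -> : size p0 = n.
    by rewrite -cV -(card_uniqP up0); apply: eq_card => v; rewrite p0V.
  case.
  - by move: (size l') sl' => s sl'; apply/andP; split; [lia|apply: leq_trans LS; nia].
  - move: (size l') (#|code_stage _ _ _ _ _|) sl' big => s q sl' big.
    apply: leq_trans (_ : (S + 1 + k3) * (n * n) <= _); first by nia.
    by apply: leq_trans (leq_mul (leqnn _) big) _; rewrite -/k3; nia.
  move=> xy; rewrite inE => /andP[gxy gain] mxy; exists (xy :: l'); split.
  - by rewrite /= addnS ltnS.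
  - by move=> x /sub xl; rewrite inE xl orbT.
  - by move=> x; rewrite inE => /orP[/eqP ->|/l'm //]; rewrite mxy.
  - by right; rewrite mulSn addnC; apply: leq_trans gain; rewrite leq_add2r.
have [l' [sl' _ l'm alt]] := grow _ (leqnn _).
exists l'; split=> //; first by rewrite mulnDl.
case: alt => //; rewrite -mulnA leq_pmul2l ?muln_gt0 ?k_gt0 ?k1_gt0 // => h.
apply: leq_trans h _; rewrite leq_pmull //.
by rewrite !muln_gt0 k_gt0 k1_gt0.
Qed.

End Stage.

(** * Counting positions below [n] *)

Definition tally (n : nat) (P : nat -> bool) : nat := \sum_(i < n) P i.

Section Tally.
Variable n : nat.
Implicit Types P Q : nat -> bool.

Lemma tally_le P Q : (forall i, i < n -> P i -> Q i) -> tally n P <= tally n Q.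
Proof.
move=> PQ; apply: leq_sum => i _; have := PQ i (ltn_ord i).
by case: (P i); case: (Q i) => // /(_ isT).
Qed.

Lemma tally_sub P Q R : (forall i, i < n -> P i -> Q i || R i) ->
  tally n P <= tally n Q + tally n R.
Proof.
move=> PQR; rewrite -big_split; apply: leq_sum => i _; have := PQR i (ltn_ord i).
by case: (P i); case: (Q i); case: (R i) => // /(_ isT).
Qed.

Lemma tally_split P Q :
  tally n P = tally n (fun i => P i && Q i) + tally n (fun i => P i && ~~ Q i).
Proof. by rewrite -big_split; apply: eq_bigr => i _; case: (P i); case: (Q i). Qed.

Lemma tally_true : tally n xpredT = n.
Proof. by rewrite /tally sum_nat_const card_ord muln1. Qed.

Lemma tally_shift P :
  tally n (fun i => (i.+1 < n) && P i.+1) = tally n (fun i => (0 < i) && P i).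
Proof.
rewrite /tally; case: n => [|k]; first by rewrite !big_ord0.
rewrite big_ord_recr [RHS]big_ord_recl /= ltnn addn0 add0n.
by apply: eq_bigr => i _; rewrite /bump /= add1n !ltnS ltn_ord.
Qed.

Lemma tally_shift_le P : tally n (fun i => (i.+1 < n) && P i.+1) <= tally n P.
Proof. by rewrite tally_shift; apply: tally_le => i _ /andP[]. Qed.

Lemma tally_shiftV_le P : tally n (fun i => (0 < i) && P i.-1) <= tally n P.
Proof.
rewrite -(tally_shift (fun i => P i.-1)) /=.
by apply: tally_le => i _ /andP[].
Qed.

Lemma tally_sub_up P Q R :
  (forall i, i < n -> P i -> Q i || ((i.+1 < n) && R i.+1)) ->
  tally n P <= tally n Q + tally n R.
Proof.
by move=> PQR; apply: leq_trans (tally_sub PQR) _; rewrite leq_add2l tally_shift_le.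
Qed.

Lemma tally_sub_down P Q R :
  (forall i, i < n -> P i -> Q i || ((0 < i) && R i.-1)) ->
  tally n P <= tally n Q + tally n R.
Proof.
by move=> PQR; apply: leq_trans (tally_sub PQR) _; rewrite leq_add2l tally_shiftV_le.
Qed.

End Tally.

(** * Paths with few closing rotations: the structure of their positions *)

Section Dichotomy.
Variables (n kap r : nat) (H : nat -> nat -> bool).
Hypotheses (H_sym : forall i j, H i j = H j i) (H_irr : forall i, H i i = false).
Hypothesis H_deg : forall i, i < n -> n <= 2 * tally n (H i).

(* [H i j] stands for the adjacency of the vertices at positions [i] and [j] of a
   path.  Rotating at a position in [after] makes the vertex there the new last
   one, and [hits_after k] counts the second rotations which, after the one at
   [k], make the two ends adjacent. *)
Definition after (i : nat) : bool := [&& 0 < i, i < n & H i.-1 n.-1].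
Definition hits_after (k : nat) : nat :=
  tally n (fun j => [&& j.+1 < k, H j k & H 0 j.+1]) +
  tally n (fun j => [&& k < j, H j k & H 0 j.-1]).

Hypotheses (r_gt0 : 0 < r) (kap_r : 80 * (r * r) <= kap) (n_kap : kap <= n).
Hypothesis few_close : kap * tally n (fun i => after i && H 0 i) < n.
Hypothesis few_hits : kap * tally n (fun k => after k && (n <= kap * hits_after k)) < n.

Local Notation T := after.
Let up i := T i.+1.
Let down i := (0 < i) && T i.-1.
Let typical k := T k && (kap * hits_after k < n).

Let kap_gt0 : 0 < kap. Proof. by apply: leq_trans kap_r; rewrite !muln_gt0 r_gt0. Qed.
Let n_gt1 : 1 < n.
Proof. by apply: leq_trans n_kap; apply: leq_trans kap_r; have := r_gt0; nia. Qed.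

Lemma after_ge : n <= 2 * tally n T.
Proof.
have n0 : n.-1 < n by have := n_gt1; lia.
apply: leq_trans (H_deg n0) _; rewrite leq_mul2l /=.
have -> : tally n T = tally n (fun i => (0 < i) && ((i < n) && H i.-1 n.-1)) by [].
rewrite -(tally_shift n (fun i => (i < n) && H i.-1 n.-1)).
apply: tally_le => i lt Hi; rewrite /= andbA andbb H_sym Hi andbT.
suff : i != n.-1 by lia.
by apply: contraTneq Hi => ->; rewrite H_irr.
Qed.

Let W i := (i < n) && ~~ T i && ~~ H 0 i.

(** [T] hardly meets the neighbours of position 0, which fill at least half of all positions. *)
Lemma after_le : kap * (2 * tally n T) <= (kap + 2) * n.
Proof.
have e1 := tally_split n T (H 0); have e2 := tally_split n (H 0) T.
have e3 := tally_split n xpredT T; rewrite tally_true in e3.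
have d0 := H_deg (ltnW n_gt1).
have : tally n (fun i => H 0 i && ~~ T i) <= tally n (fun i => xpredT i && ~~ T i).
  by apply: tally_le => i _ /andP[].
have : tally n (fun i => H 0 i && T i) = tally n (fun i => T i && H 0 i).
  by apply: eq_bigr => i _; rewrite andbC.
have : tally n (fun i => xpredT i && T i) = tally n T by apply: eq_bigr.
move: (tally n (fun i => T i && H 0 i)) few_close e1 e2 e3 d0.
move: (tally n T) (tally n (H 0)); nia.
Qed.

(** Two sets of at least [n/2] elements each leave out no more positions than they share. *)
Lemma W_le : kap * tally n W <= n.
Proof.
suff : tally n W <= tally n (fun i => T i && H 0 i) by move: few_close; nia.
have e1 := tally_split n xpredT T; rewrite tally_true in e1.
have e2 := tally_split n (fun i => ~~ T i) (H 0).
have e3 := tally_split n (H 0) T.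
have -> : tally n W = tally n (fun i => ~~ T i && ~~ H 0 i).
  by apply: eq_bigr => i _; rewrite /W ltn_ord.
have : tally n (fun i => ~~ T i && H 0 i) = tally n (fun i => H 0 i && ~~ T i).
  by apply: eq_bigr => i _; rewrite andbC.
have : tally n (fun i => H 0 i && T i) = tally n (fun i => T i && H 0 i).
  by apply: eq_bigr => i _; rewrite andbC.
have : tally n (fun i => xpredT i && T i) = tally n T by apply: eq_bigr.
have : tally n (fun i => xpredT i && ~~ T i) = tally n (fun i => ~~ T i) by apply: eq_bigr.
have := after_ge; have := H_deg (ltnW n_gt1); lia.
Qed.

Let stray k := tally n (fun j => [&& j.+1 < k, H j k & ~~ up j]) +
               tally n (fun j => [&& k < j, H j k & ~~ down j]).

(** A second rotation along a neighbour [j] of [k] makes [j + 1] or [j - 1] the new end, and a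
    position outside [T] and [W] is a neighbour of 0. So a stray neighbour either closes the path,
    which is rare for a typical [k], or is charged to [W]. *)
Lemma stray_le k : k < n -> typical k -> kap * stray k <= 3 * n.
Proof.
move=> kn /andP[_ hk].
have h1 : tally n (fun j => [&& j.+1 < k, H j k & ~~ up j]) <=
    tally n (fun j => [&& j.+1 < k, H j k & H 0 j.+1]) + tally n W.
  apply: tally_sub_up => j _ /and3P[jk -> nup]; rewrite jk /= /W (leq_trans jk) ?(ltnW kn) //=.
  by rewrite -/(up j) nup /=; case: (H 0 _).
have h2 : tally n (fun j => [&& k < j, H j k & ~~ down j]) <=
    tally n (fun j => [&& k < j, H j k & H 0 j.-1]) + tally n W.
  apply: tally_sub_down => j jn /and3P[jk -> nd]; have j0 : 0 < j by lia.
  rewrite jk j0 /= /W; have -> : j.-1 < n by lia.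
  by move: nd; rewrite /down j0 /= => -> /=; case: (H 0 _).
have := W_le; move: hk; rewrite /hits_after /stray.
move: h1 h2; move: (tally n W) (tally n (fun j => [&& j.+1 < k, H j k & ~~ up j])).
move: (tally n (fun j => [&& k < j, H j k & ~~ down j])) => x w y.
move: (tally n (fun j => [&& j.+1 < k, H j k & H 0 j.+1])).
move: (tally n (fun j => [&& k < j, H j k & H 0 j.-1])); nia.
Qed.

Let U k j := ((j < k) && up j) || ((k < j) && down j).
Let wrong k j := (j != k) && (H j k != U k j).

(** Up to strays the neighbours of [k] lie in [U k], which is hardly larger than [T] and hence than
    [n/2]; the degree condition then forces near equality. *)
Lemma wrong_le k : k < n -> typical k -> kap * tally n (wrong k) <= 8 * n.
Proof.
move=> kn tk; have Tk : T k by case/andP: tk.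
have sk := stray_le kn tk.
have off : tally n (fun j => H k j && ~~ U k j && (j != k)) <= stray k.
  apply: tally_sub => j _ /andP[/andP[Hkj nU] jk].
  rewrite [H j k]H_sym Hkj; move: nU; rewrite /U negb_or /=.
  case: (ltngtP j k) jk => //= jk _; last by move=> nd; rewrite nd orbT.
  rewrite !andbT => nup; rewrite nup; have [//|jk'] := ltnP j.+1 k.
  have e : j.+1 = k by lia.
  by move: nup; rewrite /up e Tk.
have cov : tally n (wrong k) <= stray k + tally n (fun j => U k j && ~~ H k j).
  apply: leq_trans (leq_add off (leqnn _)); apply: tally_sub => j _.
  by rewrite /wrong [H j k]H_sym => /andP[->]; case: (H k j); case: (U k j).
have eqU := tally_split n (U k) (H k).
have cU : tally n (U k) <= (tally n T).+1.
  have h1 : tally n (fun j => (j < k) && up j) <= tally n (fun j => T j && (j <= k)).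
    apply: leq_trans (tally_shift_le n (fun j => T j && (j <= k))).
    apply: tally_le => j _ /andP[jk uj]; rewrite (leq_ltn_trans jk kn) /=.
    by rewrite jk andbT.
  have h2 : tally n (fun j => (k < j) && down j) <= tally n (fun j => T j && (k <= j)).
    apply: leq_trans (tally_shiftV_le n (fun j => T j && (k <= j))).
    apply: tally_le => j _ /andP[kj /andP[j0 Tj]]; rewrite j0 Tj /=; lia.
  have h3 := @tally_sub n (U k) (fun j => (j < k) && up j) (fun j => (k < j) && down j).
  have {}h3 := h3 (fun i _ h => h).
  have h4 : tally n (fun j => T j && (j <= k)) + tally n (fun j => T j && (k <= j)) <=
      tally n T + tally n (fun j => j == k).
    rewrite -!big_split; apply: leq_sum => j _ /=.
    by case: (T j) => /=; lia.
  have h5 : tally n (fun j => j == k) <= 1.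
    rewrite /tally (bigD1 (Ordinal kn)) //= eqxx big1 // => i.
    by rewrite -val_eqE /= => /negbTE ->.
  lia.
have dk := H_deg kn.
have degk : tally n (H k) <= tally n (fun j => U k j && H k j) + stray k.
  apply: leq_trans (leq_add (leqnn _) off); apply: tally_sub => j _ Hkj.
  rewrite Hkj /=; case: (U k j) => //=.
  by apply: contraTneq Hkj => ->; rewrite H_irr.
have := after_le; move: cov eqU cU dk degk sk.
move: (tally n (wrong k)) (stray k) (tally n (fun j => U k j && ~~ H k j)) => w s u.
move: (tally n (U k)) (tally n (fun j => U k j && H k j)) (tally n (H k)) (tally n T).
have := n_kap; nia.
Qed.

Let atypical k := T k && (n <= kap * hits_after k).

Let typicalP k : T k -> typical k || atypical k.
Proof. by rewrite /typical /atypical => ->; rewrite /= orbC leqNgt orNb. Qed.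

Let sum_atypical : kap * \sum_(k < n) \sum_(j < n) atypical k <= n * n.
Proof.
rewrite (eq_bigr (fun k : 'I_n => n * atypical k)) => [|k _]; last first.
  by rewrite sum_nat_const card_ord.
rewrite -big_distrr mulnCA leq_mul2l; apply/orP; right.
exact: ltnW few_hits.
Qed.

Let sum_typical (F : nat -> nat -> bool) (w : nat) :
  (forall k, k < n -> typical k -> kap * tally n (F k) <= w) ->
  kap * \sum_(k < n) \sum_(j < n) (typical k && F k j) <= n * w.
Proof.
move=> Fw; rewrite big_distrr /= -[X in X * w]card_ord -sum_nat_const.
apply: leq_sum => k _; case: (boolP (typical k)) => [tk|_] /=.
  exact: Fw (ltn_ord k) tk.
by rewrite sum_nat_const muln0 muln0.
Qed.

Let inconsistent := \sum_(k < n) \sum_(j < n)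
  [&& (j : nat) < k, T j, T k & up j != down k].

(** For [j < k] the adjacency of [j] and [k] should equal [up j] by the row of [k], and [down k] by
    the row of [j]. Where these differ, one of the two rows is wrong there or atypical. *)
Let inconsistent_le : kap * inconsistent <= 18 * (n * n).
Proof.
pose Wr := \sum_(k < n) \sum_(j < n) (typical k && wrong k j).
pose At := \sum_(k < n) \sum_(j < n) (atypical k : nat).
have hW : kap * Wr <= n * (8 * n).
  by apply: (@sum_typical (fun k j => wrong k j)) => k kn tk; apply: wrong_le.
have hA : kap * At <= n * n := sum_atypical.
suff : inconsistent <= (Wr + Wr) + (At + At).
  by move: hW hA; move: Wr At inconsistent => w a i; nia.
rewrite {2}/Wr {2}/At [X in _ <= (_ + X) + _]exchange_big [X in _ <= _ + (_ + X)]exchange_big.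
rewrite -!big_split; apply: leq_sum => k _ /=.
rewrite -!big_split; apply: leq_sum => j _ /=.
case: (boolP [&& _, _, _ & _]) => // /and4P[jk Tj Tk ud].
have [/orP[tk|ak] /orP[tj|aj]] := (typicalP Tk, typicalP Tj); last 3 first.
- by rewrite aj; lia.
- by rewrite ak; lia.
- by rewrite ak; lia.
rewrite tk tj /= /wrong /U jk (gtn_eqF jk) (ltn_eqF jk) /= (ltnNge k j) (ltnW jk) /=.
rewrite orbF [H k j]H_sym.
by case: (H j k) (up j) (down k) ud => [] [] [].
Qed.

Let p1 := tally n (fun j => T j && up j).
Let q1 := tally n (fun j => T j && ~~ up j).

(** Both sides count the pairs of consecutive positions in [T]. *)
Let p1_down : p1 = tally n (fun j => T j && down j).
Proof.
rewrite /p1; transitivity (tally n (fun i => (0 < i) && (T i && down i))).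
  rewrite -(tally_shift n (fun i => T i && down i)); apply: eq_bigr => i _.
  rewrite /up /down /=; have -> : T i.+1 = (i.+1 < n) && H i n.-1 by [].
  by case: (i.+1 < n) => /=; rewrite ?andbF // andbC.
by apply: eq_bigr => i _; rewrite /down; case: (0 < i) => //=; rewrite andbF.
Qed.

Let q1_down : q1 = tally n (fun j => T j && ~~ down j).
Proof.
have := tally_split n T up; have := tally_split n T down.
by rewrite -/p1 -/q1 -p1_down => -> /addnI.
Qed.

(** Each of the first [h] elements [j] of [T] disagrees with at least [2h] elements [k] of [T], of
    which at most [h] are not beyond [j]. *)
Let inconsistent_ge h : 2 * h <= p1 -> 2 * h <= q1 -> h * h <= inconsistent.
Proof.
move=> hp hq; pose cnt i := tally n (fun j => T j && (j < i)).
have cntS i : cnt i.+1 <= (cnt i).+1.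
  have h1 : tally n (fun j => j == i) <= 1.
    have [lt|ge] := ltnP i n; last first.
      by rewrite /tally big1 // => j _; rewrite (ltn_eqF (leq_trans (ltn_ord j) ge)).
    rewrite /tally (bigD1 (Ordinal lt)) //= eqxx big1 // => j.
    by rewrite -val_eqE /= => /negbTE ->.
  rewrite -[(cnt i).+1]addn1; apply: (leq_trans _ (leq_add (leqnn (cnt i)) h1)).
  apply: tally_sub => j _ /andP[-> ]; rewrite ltnS leq_eqVlt.
  by case/orP => ->; rewrite ?orbT.
have exi : exists i, h <= cnt i.
  exists n; apply: (@leq_trans p1); first by lia.
  by apply: tally_le => j jn /andP[-> _].
case: (ex_minnP exi) => i0 hi0 imin.
have ci0 : cnt i0 = h.
  apply/eqP; rewrite eqn_leq hi0 andbT; case: (i0) imin => [|i] imin.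
    by rewrite /cnt /tally big1 // => j _; rewrite ltn0 andbF.
  apply: leq_trans (cntS i) _; rewrite ltnNge; apply/negP => /imin.
  by rewrite ltnn.
rewrite -{1}ci0 /cnt /tally big_distrl /= /inconsistent exchange_big /=.
apply: leq_sum => j _; case: (boolP (T j && (j < i0))) => [/andP[Tj ji0]|_]; last by [].
rewrite mul1n.
have big : 2 * h <= tally n (fun k => T k && (up j != down k)).
  case: (up j).
    by rewrite q1_down in hq; apply: leq_trans hq _; apply: tally_le => k _; case: (down k).
  by rewrite p1_down in hp; apply: leq_trans hp _; apply: tally_le => k _; case: (down k).
have : tally n (fun k => T k && (up j != down k)) <=
    tally n (fun k => [&& j < k, T j, T k & up j != down k]) + cnt i0.
  apply: tally_sub => k _ /andP[Tk ud]; rewrite Tj Tk ud !andbT /=.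
  by have [//|kj] := ltnP j k; rewrite (leq_ltn_trans kj).
by move=> le; have := leq_trans big le; rewrite ci0 mul2n -addnn leq_add2r.
Qed.

(** Typical rows are controlled by [stray_le]; the atypical ones are so few that the trivial bound
    [n] suffices for each. *)
Let count_rows (F : nat -> nat -> bool) h : r * h <= n ->
  (forall k, k < n -> T k -> tally n (F k) <= 4 * h + stray k) ->
  r * \sum_(k < n) \sum_(j < n) (T k && F k j) <= 5 * (n * n).
Proof.
move=> rh Fh.
have h1 : kap * \sum_(k < n) \sum_(j < n) (typical k && F k j) <= n * (kap * (4 * h) + 3 * n).
  apply: sum_typical => k kn tk; have Tk : T k by case/andP: tk.
  have := Fh k kn Tk; have := stray_le kn tk.
  move: (tally n (F k)) (stray k) => x y; nia.
have h2 := sum_atypical.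
have h3 : \sum_(k < n) \sum_(j < n) (T k && F k j) <=
    \sum_(k < n) \sum_(j < n) (typical k && F k j) +
    \sum_(k < n) \sum_(j < n) (atypical k : nat).
  rewrite -big_split; apply: leq_sum => k _ /=.
  rewrite -big_split; apply: leq_sum => j _ /=.
  case: (boolP (T k)) => //= /typicalP /orP[] ->; first by rewrite leq_addr.
  by case: (F k j) => //; rewrite leq_addl.
rewrite -(leq_pmul2l kap_gt0).
move: h1 h2 h3; move: (\sum_(k < n) _) (\sum_(k < n) _) (\sum_(k < n) _) => z y x h1 h2 h3.
have h4 : r * (kap * z) <= r * (n * (kap * (4 * h) + 3 * n) + n * n).
  by rewrite leq_mul2l; apply/orP; right; nia.
have h5 : r * (kap * (4 * h) * n) <= 4 * kap * (n * n) by nia.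
have h6 : 4 * r <= kap by have := kap_r; have := r_gt0; nia.
have h7 : 4 * r * (n * n) <= kap * (n * n) by rewrite leq_mul2r h6 orbT.
have e : kap * (r * z) = r * (kap * z) by rewrite mulnCA.
rewrite e; apply: leq_trans h4 _; rewrite mulnDr.
have -> : r * (n * (kap * (4 * h) + 3 * n)) = r * (kap * (4 * h) * n) + 3 * r * (n * n).
  by ring.
have e2 : r * (n * n) * 4 = 4 * r * (n * n) by ring.
have e3 : 3 * r * (n * n) = 3 * (r * (n * n)) by ring.
have e4 : kap * (5 * (n * n)) = 5 * (kap * (n * n)) by ring.
have e5 : 4 * kap * (n * n) = 4 * (kap * (n * n)) by ring.
lia.
Qed.

(** As inconsistencies are rare, [up] is almost constant on [T]. If it is rarely true, the
    neighbours of positions in [T], lying next to [T], mostly avoid [T]; if it is rarely false, [T]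
    consists of relatively few intervals and these neighbours mostly stay in [T]. The factor 80
    turns [n <= 2 r h] into [18 n^2 < kap h^2]. *)
Lemma position_dichotomy :
  r * (\sum_(k < n) \sum_(j < n) (T k && (T j && H j k))) <= 5 * (n * n) \/
  r * (\sum_(k < n) \sum_(j < n) (T k && (~~ T j && H j k))) <= 5 * (n * n).
Proof.
pose h := n %/ r.
have rh : r * h <= n by rewrite mulnC leq_divM.
have nh : n <= 2 * (r * h).
  have : n < r * h.+1 by rewrite mulnC ltn_ceil.
  have : r <= r * h.
    rewrite leq_pmulr // divn_gt0 //; apply: leq_trans n_kap; apply: leq_trans kap_r.
    by have := r_gt0; nia.
  by lia.
have small : inconsistent < h * h.
  rewrite -(ltn_pmul2l kap_gt0); apply: leq_ltn_trans inconsistent_le _.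
  have h0 : 0 < h by have := n_gt1; nia.
  have : n * n <= 4 * (r * r) * (h * h) by nia.
  have : 80 * (r * r) * (h * h) <= kap * (h * h) by rewrite leq_mul2r kap_r orbT.
  have : 0 < (r * r) * (h * h) by rewrite !muln_gt0 r_gt0 h0.
  nia.
have row k (S A B : nat -> bool) : T k ->
    (forall j, j < k -> S j -> up j -> A j) -> (forall j, k < j -> S j -> down j -> B j) ->
    tally n (fun j => S j && H j k) <= tally n A + tally n B + stray k.
  move=> Tk hA hB; have h1 : tally n (fun j => (j < k) && (S j && H j k)) <=
      tally n A + tally n (fun j => [&& j.+1 < k, H j k & ~~ up j]).
    apply: tally_sub => j _ /and3P[jk Sj ->]; have := hA j jk Sj.
    case: (boolP (up j)) => [_ -> //|nup _]; rewrite andbT.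
    suff -> : j.+1 < k by rewrite orbT.
    rewrite ltn_neqAle jk andbT; apply: contraNneq nup => e.
    by rewrite /up e.
  have h2 : tally n (fun j => (k < j) && (S j && H j k)) <=
      tally n B + tally n (fun j => [&& k < j, H j k & ~~ down j]).
    apply: tally_sub => j _ /and3P[kj Sj ->]; have := hB j kj Sj; rewrite kj.
    by case: (down j) => [-> //|_]; rewrite orbT.
  have h3 : tally n (fun j => S j && H j k) <=
      tally n (fun j => (j < k) && (S j && H j k)) + tally n (fun j => (k < j) && (S j && H j k)).
    apply: tally_sub => j _ /andP[Sj Hjk]; rewrite Sj Hjk !andbT -neq_ltn.
    by apply: contraTneq Hjk => ->; rewrite H_irr.
  apply: leq_trans h3 _; rewrite /stray addnACA; exact: leq_add h1 h2.
have [pbig|psmall] := leqP (2 * h) p1; last first.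
  left; apply: (count_rows (F := fun k j => T j && H j k) rh) => k kn Tk.
  apply: leq_trans (row k T (fun j => T j && up j) (fun j => T j && down j) Tk _ _) _.
  - by move=> j _ -> ->.
  - by move=> j _ -> ->.
  by rewrite leq_add2r -p1_down -/p1; lia.
have [qbig|qsmall] := leqP (2 * h) q1.
  by have := inconsistent_ge pbig qbig; rewrite leqNgt small.
right; apply: (count_rows (F := fun k j => ~~ T j && H j k) rh) => k kn Tk.
apply: leq_trans (row k (fun j => ~~ T j)
  (fun j => (j.+1 < n) && (T j.+1 && ~~ down j.+1))
  (fun j => (0 < j) && (T j.-1 && ~~ up j.-1)) Tk _ _) _.
- move=> j jk nT uj; rewrite (leq_ltn_trans jk kn) /down /= nT andbT.
  exact: uj.
- move=> j kj nT /andP[j0 Tj]; rewrite j0 Tj /up prednK //.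
rewrite leq_add2r; apply: leq_trans (_ : q1 + q1 <= _); last by lia.
apply: leq_add; last exact: tally_shiftV_le.
by rewrite q1_down; apply: (tally_shift_le n (fun j => T j && ~~ down j)).
Qed.

End Dichotomy.

Section Translate.
Variables (V : finType) (n kap r : nat) (g : rel V) (p : seq V) (x0 : V).
Hypotheses (cV : #|V| = n) (g_sym : symmetric g) (g_irr : irreflexive g).
Hypothesis dirac : forall v, n <= 2 * #|[set w | g v w]|.
Hypotheses (up : uniq p) (pV : forall v, v \in p).
Local Notation x := (nth x0 p).

Lemma size_full (q : seq V) : uniq q -> (forall v, v \in q) -> size q = n.
Proof. by move=> uq qV; rewrite -cV -(card_uniqP uq); apply: eq_card => v; rewrite qV. Qed.

Lemma sum_full (q : seq V) (F : V -> nat) : uniq q -> (forall v, v \in q) ->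
  \sum_(i < n) F (nth x0 q i) = \sum_v F v.
Proof.
move=> uq qV; transitivity (\sum_(v <- q) F v).
  by rewrite (big_nth x0) big_mkord size_full.
by rewrite big_uniq //=; apply: eq_bigl => v; rewrite qV.
Qed.

Lemma tally_full (q : seq V) (P : pred V) : uniq q -> (forall v, v \in q) ->
  tally n (fun i => P (nth x0 q i)) = #|[set v | P v]|.
Proof.
move=> uq qV; rewrite /tally (sum_full (fun v => P v)) //.
by rewrite -sum1dep_card [RHS]big_mkcond /=; apply: eq_bigr => v _; case: (P v).
Qed.

Lemma mem_rotations Q (q : seq V) i : uniq q -> (forall v, v \in q) -> i < n ->
  (nth x0 q i \in rotations g Q q) =
  [&& 0 < i, g (nth x0 q i.-1) (nth x0 q n.-1) & Q (rotz q (nth x0 q i))].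
Proof.
move=> uq qV lin; have sq := size_full uq qV.
rewrite inE /prd index_uniq ?sq //.
rewrite (set_nth_default x0); last by rewrite sq; lia.
suff -> : last (nth x0 q i) q = nth x0 q n.-1 by [].
by rewrite (last_nth x0) sq; case: (n) lin.
Qed.

Lemma nth_rotz (q : seq V) k i : uniq q -> (forall v, v \in q) -> k < n -> i < n ->
  nth x0 (rotz q (nth x0 q k)) i =
  if i < k then nth x0 q i else nth x0 q (n.-1 + k - i).
Proof.
move=> uq qV kn lin; have sq := size_full uq qV.
rewrite /rotz index_uniq ?sq // nth_cat size_takel ?sq ?(ltnW kn) //.
case: ltnP => ik; first by rewrite nth_take.
rewrite nth_rev size_drop sq; last by lia.
by rewrite nth_drop; congr (nth _ _ _); lia.
Qed.

Lemma rotz_full (q : seq V) z : uniq q -> (forall v, v \in q) ->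
  uniq (rotz q z) /\ forall v, v \in rotz q z.
Proof.
move=> uq qV.
by split=> [|v]; rewrite ?(perm_uniq (perm_rotz _ _)) ?(perm_mem (perm_rotz _ _)).
Qed.

Lemma rotz_ends (q : seq V) k : uniq q -> (forall v, v \in q) -> 0 < k < n ->
  nth x0 (rotz q (nth x0 q k)) 0 = nth x0 q 0 /\
  nth x0 (rotz q (nth x0 q k)) n.-1 = nth x0 q k.
Proof.
move=> uq qV /andP[k0 kn]; split; first by rewrite nth_rotz ?k0 //; lia.
by rewrite nth_rotz //; [case: ifP => ?; congr (nth _ _ _); lia | lia].
Qed.

Lemma closable_rotz (q : seq V) k : uniq q -> (forall v, v \in q) -> 0 < k < n ->
  closable g (rotz q (nth x0 q k)) = g (nth x0 q 0) (nth x0 q k).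
Proof.
move=> uq qV kn; have [ur rV] := rotz_full (nth x0 q k) uq qV.
have := size_full ur rV; have [] := rotz_ends uq qV kn.
case: (rotz _ _) => [|a s] /= h0 h1 sr; first by move: kn; rewrite -sr ltn0 andbF.
by rewrite -h0 -h1 (last_nth x0) -sr.
Qed.

Let H i j := g (x i) (x j).

Lemma few_closeE : tally n (fun i => after n H i && H 0 i) =
  #|rotations g (closable g) p|.
Proof.
rewrite -[#|_|]cardsE -(tally_full _ up pV); apply: eq_bigr => i _.
rewrite mem_rotations // /after ltn_ord /=; case: (posnP i) => //= i0.
by rewrite closable_rotz ?i0 ?ltn_ord.
Qed.

(** After the rotation at [k] the positions from [k] on run backwards, [l] becoming [n - 1 + k - l].
    Both sums of [hits_after] are reindexed by the original position [l] of the second new end. *)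
Lemma hits_after_le k : 0 < k < n ->
  hits_after n H k <= #|rotations g (closable g) (rotz p (x k))|.
Proof.
move=> kn; have [ur rV] := rotz_full (x k) up pV; have [head_r last_r] := rotz_ends up pV kn.
have k0 : 0 < k by case/andP: kn.
have {}kn : k < n by case/andP: kn.
have mem i : 0 < i -> i < n -> nth x0 (rotz p (x k)) i \in rotations g (closable g) (rotz p (x k)) =
    g (nth x0 (rotz p (x k)) i.-1) (x k) && g (x 0) (nth x0 (rotz p (x k)) i).
  by move=> i0 lin; rewrite mem_rotations // i0 last_r /= closable_rotz ?i0 // head_r.
rewrite /hits_after -[X in _ <= X]cardsE.
rewrite -(tally_full _ up pV).
have -> : tally n (fun j => [&& j.+1 < k, H j k & H 0 j.+1]) =
    tally n (fun l => (0 < l) && [&& l < k, H l.-1 k & H 0 l]).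
  rewrite -(tally_shift n (fun l => [&& l < k, H l.-1 k & H 0 l])).
  apply: eq_bigr => j _ /=; case: (ltnP j.+1 k) => jk /=; last by rewrite andbF.
  by rewrite (ltn_trans jk kn).
have -> : tally n (fun j => [&& k < j, H j k & H 0 j.-1]) =
    tally n (fun l => (l.+1 < n) && [&& k <= l, H l.+1 k & H 0 l]).
  have e := tally_shift n (fun i => [&& k < i, H i k & H 0 i.-1]); rewrite /= in e.
  rewrite e; apply: eq_bigr => j _ /=; case: (posnP j) => // ->.
  by rewrite ltn0.
rewrite -big_split; apply: leq_sum => l _ /=.
have ln := ltn_ord l; have [lk|kl] := ltnP l k.
  rewrite /= andbF addn0; case: (posnP l) => //= l0.
  have := mem l l0 ln; rewrite !nth_rotz ?lk //; try lia.
  have -> : l.-1 < k by lia.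
  by move=> ->.
rewrite /= andbF add0n; case: (ltnP l.+1 n) => //= l1.
have := mem (n.-1 + k - l) ltac:(lia) ltac:(lia); rewrite !nth_rotz //; try lia.
have -> : (n.-1 + k - l < k) = false by lia.
have -> : ((n.-1 + k - l).-1 < k) = false by lia.
have -> : n.-1 + k - (n.-1 + k - l) = l by lia.
have -> : n.-1 + k - (n.-1 + k - l).-1 = l.+1 by lia.
by move=> ->.
Qed.

Lemma rotation_dichotomy : 0 < r -> 80 * (r * r) <= kap -> kap <= n ->
  ~~ often n g kap (closable g) p ->
  ~~ often n g kap (often n g kap (closable g)) p ->
  exists T : {set V}, [/\ n <= 2 * #|T|, kap * (2 * #|T|) <= (kap + 2) * n &
    r * #|box g T T| <= 5 * (n * n) \/ r * #|box g T (~: T)| <= 5 * (n * n)].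
Proof.
move=> r0 kr kn; rewrite /often -!ltnNge => few1 few2.
have H_sym i j : H i j = H j i by rewrite /H g_sym.
have H_irr i : H i i = false by rewrite /H g_irr.
have H_deg i : i < n -> n <= 2 * tally n (H i).
  by move=> _; rewrite /H (tally_full (g (x i))).
have h1 : kap * tally n (fun i => after n H i && H 0 i) < n by rewrite few_closeE.
have h2 : kap * tally n (fun k => after n H k && (n <= kap * hits_after n H k)) < n.
  apply: leq_ltn_trans few2; rewrite leq_mul2l; apply/orP; right.
  rewrite -[X in _ <= X]cardsE -(tally_full _ up pV); apply: leq_sum => k _.
  rewrite mem_rotations // /after ltn_ord /=; case: (posnP k) => //= k0.
  have small : hits_after n H k <= #|rotations g (closable g) (rotz p (x k))|.
    by rewrite hits_after_le // k0 ltn_ord.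
  rewrite /H; case: (g _ _) => //=; rewrite -/H.
  have [big|//] := leqP n (kap * hits_after n H k).
  have -> // : n <= kap * #|rotations g (closable g) (rotz p (x k))|.
  by rewrite (leq_trans big) // leq_mul2l small orbT.
pose T := [set v | after n H (index v p)].
have TE i : i < n -> (x i \in T) = after n H i.
  by move=> lin; rewrite inE index_uniq // (size_full up pV).
have cT : #|T| = tally n (after n H).
  rewrite -[#|T|]cardsE -(tally_full _ up pV); apply: eq_bigr => i _.
  by rewrite TE.
have cbox (Y : {set V}) : #|box g T Y| = \sum_(k < n) \sum_(j < n)
    (after n H k && ((x j \in Y) && H j k)).
  rewrite card_pairs -(sum_full (fun v => #|[set y | (v, y) \in box g T Y]|) up pV).
  apply: eq_bigr => k _; rewrite -(tally_full _ up pV); apply: eq_bigr => j _.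
  by rewrite inE /= TE // g_sym.
exists T; rewrite cT; split.
- exact: after_ge H_sym H_irr H_deg r0 kr kn h1 h2.
- exact: after_le H_deg r0 kr kn h1 h2.
rewrite !cbox.
case: (position_dichotomy H_sym H_irr H_deg r0 kr kn h1 h2) => h; [left|right];
  apply: leq_trans h; rewrite leq_mul2l; apply/orP; right;
  apply: leq_sum => k _; apply: leq_sum => j _; first by rewrite TE.
by rewrite in_setC TE.
Qed.

End Translate.

(** The families depend on [e] only, since Maker's potential is fixed before play; [m] is quantified
    after them. Cases with four families repeat one of them. *)
Definition forces (V : finType) (e : rel V) (d K : nat) : Prop :=
  exists ws : 'I_5 -> code V,
    (forall i l1 l2 l3 p, p \in ws i l1 l2 l3 -> e p.1 p.2) /\
    forall m : rel V, symmetric m -> (forall x y, m x y -> e x y) ->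
      (forall i, hits m d (K * #|V|) (ws i)) -> hamiltonian m.

Lemma forces_le (V : finType) (e : rel V) d d' K K' :
  d <= d' -> K <= K' -> forces e d K -> forces e d' K'.
Proof.
move=> dd KK [ws [wse ham]]; exists ws; split=> // m ms me h.
by apply: ham => // i; apply: hits_le (h i); rewrite ?leq_mul2r ?KK ?orbT.
Qed.

Definition two_cliques_like (V : finType) (e : rel V) (r : nat) (T : {set V}) : bool :=
  [&& #|V| <= 4 * #|T|, 4 * #|T| <= 3 * #|V| &
      r * #|box e T (~: T)| <= #|V| * #|V|].

(* At least [(1 - 1/r) n^2/4] edges cross [T]. *)
Definition bipartite_like (V : finType) (e : rel V) (r : nat) (T : {set V}) : bool :=
  r * (#|V| * #|V|) <= 4 * r * #|box e T (~: T)| + #|V| * #|V|.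

Lemma enum_admissible (V : finType) : 1 < #|V| ->
  admissible (fun _ : V => true) false (list_rel [::]) (enum V).
Proof.
move=> n1; split; first exact: enum_uniq.
  by move=> v; rewrite mem_enum.
have := enum_uniq V; have := n1; rewrite cardE.
case: (enum V) => // x q sq uq; rewrite /csteps all_rcons /=; apply/andP; split.
  rewrite /compatible eqbF_neg addbb /= andbT orbF; case: q sq uq => //= y q _.
  by case/andP => nx _; apply: contraNneq nx => <-; apply: mem_last.
apply/allP => -[u v] /= uv; rewrite /compatible addbb /= andbT.
have [p1 [p2 e]] := @mem_steps _ (x :: q) u v uv; rewrite e in uq.
move: uq; rewrite cat_uniq => /and3P[_ /hasPn /(_ v) nv _].
rewrite (_ : u != v) //; apply: contraNneq (nv _) => [->|]; last by rewrite inE eqxx.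
by rewrite mem_rcons inE eqxx.
Qed.

Section NonExtremal.
Variables (V : finType) (n r kap k0 : nat) (e : rel V).
Hypotheses (cV : #|V| = n) (e_sym : symmetric e) (e_irr : irreflexive e).
Hypothesis dirac : forall v, n <= 2 * #|[set w | e v w]|.
Hypotheses (r_gt0 : 0 < r) (k0E : k0 = 2) (kap_r : 80 * (20 * r * (20 * r)) <= kap).
Hypotheses (n_kap : kap <= n).
Hypothesis not_cliques : forall T, ~~ two_cliques_like e r T.
Hypothesis not_bip : forall T, ~~ bipartite_like e r T.

Let kap4 : 4 <= kap.
Proof. by apply: leq_trans kap_r; have := r_gt0; nia. Qed.

Let D := 128 * k0 * k0.
Let B := 32 * k0 * (32 * k0).
(** At least half of the end pairs share one of the properties [good1] and [good2], whence the
    factor 2; each stage of rotations costs a further factor [2 * kap]. *)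
Let k1 := 2 * B.
Let k2 := 2 * k1 * kap.
Let k3 := 2 * k2 * kap.
Let S0 := 6 * D + 16.
Let S1 := S0 + 4 * k1 * kap.
Let S2 := S1 + 4 * k2 * kap.
Let good1 := often n e kap (closable e).
Let good2 := often n e kap good1.

(** The dichotomy is applied with [20 * r], so that its bound [5 n^2 / (20 r)] is the deficit
    [n^2 / (4r)] allowed in [bipartite_like]: if [T] is that sparse inside, the Dirac degrees must
    cross. *)
Lemma orders_good (p : seq V) : uniq p -> (forall v, v \in p) -> good1 p || good2 p.
Proof.
move=> up pV; apply: contraT; rewrite negb_or => /andP[g1 g2].
have n0 : 0 < n by apply: leq_trans n_kap; apply: leq_trans kap_r; have := r_gt0; nia.
have [x0 _] : exists x0, x0 \in V by apply/card_gt0P; rewrite cV.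
have [|T [T1 T2 alt]] := @rotation_dichotomy _ n kap (20 * r) e p x0 cV e_sym e_irr
  dirac up pV _ kap_r n_kap g1 g2; first by rewrite muln_gt0.
have kap0 : 0 < kap by lia.
case: alt => small; last first.
  have := not_cliques T; rewrite /two_cliques_like cV; apply: contraNT => _.
  apply/and3P; split; [nia| |nia].
  have : 4 <= kap by apply: leq_trans kap_r; have := r_gt0; nia.
  by nia.
have := not_bip T; rewrite /bipartite_like cV; apply: contraNT => _.
have deg : n * #|T| <= 2 * (#|box e T T| + #|box e T (~: T)|).
  rewrite !card_pairs mulnC -sum_nat_const -big_split big_distrr /= big_mkcond /=.
  apply: leq_sum => x _; case: ifP => // xT; apply: leq_trans (dirac x) _.
  rewrite leq_mul2l /= -(cardsID T [set w | e x w]); apply: leq_add;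
    apply/subset_leq_card/subsetP => y; rewrite !inE /= xT.
    by case/andP => -> ->.
  by case/andP => -> ->.
move: (#|box e T T|) (#|box e T (~: T)|) (#|T|) small deg T1 => a b t small deg T1.
have h1 : n * n <= 4 * (a + b) by nia.
have h2 : r * (n * n) <= r * (4 * (a + b)) by rewrite leq_mul2l h1 orbT.
by nia.
Qed.

Definition ws_generic : seq (code V) := [:: code_expand e set0; code_cover e n D;
  code_stage n e (4 * k1 * kap) good1; code_stage n e (4 * k2 * kap) (closable e);
  code_close e].

Variables (m : rel V) (d L : nat).
Hypotheses (m_sym : symmetric m) (m_e : forall x y, m x y -> e x y).
Hypothesis dL : 34 * k0 + 2 * D * (6 * D + 1) + 4 * k1 * kap * (S0 + 1 + 4 * k1 * kap) +
  4 * k2 * kap * (S1 + 1 + 4 * k2 * kap) + k3 * (S2 + 1) <= d.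
Hypothesis LL : (S2 + 17) * n <= L.

(** One stage brings pairs from [good2] to [good1], another from [good1] to [closable e], both by
    rotations along edges of [m]. The quadratically many end pairs obtained are edges of [e], and
    meeting one contradicts the cut. *)
Lemma generic_hamiltonian :
  (forall i, i < 5 -> hits m d L (nth (code_close e) ws_generic i)) -> hamiltonian m.
Proof.
move=> hit; have h1 := hit 0 isT; have h2 := hit 1 isT; have h3 := hit 2 isT.
have h4 := hit 3 isT; have {hit} h5 := hit 4 isT; rewrite /= in h1 h2 h3 h4 h5.
have good12 := orders_good; clear not_bip not_cliques kap_r.
have n_gt2 : 2 < n by lia.
have m_irr : irreflexive m by move=> x; apply/negP => /m_e; rewrite e_irr.
have eK x y : e x y -> compatible (fun _ : V => true) false x y.
  by move=> exy; rewrite /compatible andbT; apply: contraTneq exy => ->; rewrite e_irr.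
have deg v : n <= k0 * #|[set y | e v y] :\: set0| by rewrite setD0 k0E.
have k00 : 0 < k0 by rewrite k0E.
have kap0 : 0 < kap by lia.
have B0 : 0 < B by rewrite /B k0E.
have k10 : 0 < k1 by rewrite /k1 muln_gt0.
have k20 : 0 < k2 by rewrite /k2 muln_gt0 muln_gt0 k10 kap0.
have f_sym := @list_rel_sym V [::].
have [||||||//|[p0 [l [cut sl ml big]]]] := @hamiltonian_or_end_pairs V n (fun _ => true) false
  m (list_rel [::]) cV n_gt2 m_sym m_irr f_sym _ e set0 set0 k0 d L k00 deg _ _ (enum V)
  h1 h2 _ _ (enum_admissible _).
- by [].
- by [].
- by rewrite setDv cards0.
- by move: dL; rewrite -/D; lia.
- by apply: leq_trans LL; rewrite leq_mul2r /S2 /S1 /S0 -/D; apply/orP; right; lia.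
- by rewrite cV; lia.
exfalso; have [up0 p0V] := (cut_uniq cut, cut_full cut).
pose E Q l := end_pairs Q (list_rel l) (list_rel [::]) p0.
have half : #|E predT l| <= #|E good1 l| + #|E good2 l|.
  apply: leq_trans (leq_card_setU _ _); apply/subset_leq_card/subsetP => st.
  rewrite in_setU !inE => /asboolP[q [rq _ lt]].
  have pp := reach_perm rq.
  have : good1 (st.1 :: q) || good2 (st.1 :: q).
    by apply: good12 => [|v]; rewrite ?(perm_uniq pp) ?(perm_mem pp).
  by case/orP => gq; apply/orP; [left|right]; apply/asboolP; exists q.
have [l1 [sl1 ml1 big1]] : exists l1, [/\ size l1 <= S1 * n,
    forall x, x \in l1 -> m x.1 x.2 && e x.1 x.2 & n * n <= k2 * #|E good1 l1| ].
  have [E1|E2] := leqP (n * n) (k1 * #|E good1 l|).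
    exists l; split=> //.
      by apply: leq_trans sl _; rewrite leq_mul2r /S1 leq_addr orbT.
    by apply: leq_trans E1 _; rewrite leq_mul2r /k2; apply/orP; right; nia.
  have E2' : n * n <= k1 * #|E good2 l|.
    have : n * n <= B * #|E predT l| := big.
    have := leq_mul (leqnn k1) half; rewrite mulnDr {1}/k1.
    by move: (#|E predT l|) (#|E good1 l|) (#|E good2 l|) E2 => a b c; lia.
  have := @stage V n e m d L p0 good1 kap k1 S0 cV up0 p0V kap0 k10 l ml sl E2' h3.
  case; last by move=> l1 [? ? ?]; exists l1.
    by move: dL; lia.
  by apply: leq_trans LL; rewrite leq_mul2r; apply/orP; right; rewrite /S2 /S1; lia.
have [l2 [sl2 ml2 big2]] : exists l2, [/\ size l2 <= S2 * n,
    forall x, x \in l2 -> m x.1 x.2 && e x.1 x.2 & n * n <= k3 * #|E (closable e) l2| ].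
  have := @stage V n e m d L p0 (closable e) kap k2 S1 cV up0 p0V kap0 k20 l1 ml1 sl1 big1 h4.
  case; last by move=> l2 [? ? ?]; exists l2.
    by move: dL; lia.
  by apply: leq_trans LL; rewrite leq_mul2r; apply/orP; right; rewrite /S2; lia.
have mK x : x \in l2 -> m x.1 x.2 && compatible (fun _ : V => true) false x.1 x.2.
  by move/ml2 => /andP[-> /eK].
have sub : E (closable e) l2 \subset code_close e p0 l2 [::].
  apply/subsetP => st; rewrite !inE => /asboolP[q [rq cq lt]].
  move: cq; rewrite /= lt => -> /=; apply/asboolP; by exists q.
have sp0 : size p0 = n by apply: size_full cV _ up0 p0V.
have := h5 p0 l2 [::]; rewrite sp0 cV addn0; case.
- by apply/andP; split; [lia|apply: leq_trans LL; rewrite mulnDl; move: (size l2) sl2 => s; lia].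
- move: (size l2) (#|E (closable e) l2|) (#|code_close e p0 l2 [::]|) sl2 big2 (subset_leq_card sub) => s a b sl2 big2 ab.
  apply: leq_trans (_ : (S2 + 1) * (n * n) <= _).
    by have := leq_mul (leqnn n) sl2; lia.
  apply: leq_trans (leq_mul (leqnn _) big2) _.
  have : k3 * (S2 + 1) * a <= d * b by apply: leq_mul => //; apply: leq_trans dL; exact: leq_addl.
  by rewrite mulnA [(S2 + 1) * k3]mulnC.
by move=> st; rewrite inE => /andP[_ /(code_close_open m_sym cut mK) /negP].
Qed.

End NonExtremal.

(** * Graphs close to two cliques *)

Section Cuts.
Variables (V : finType) (n : nat) (e : rel V).
Hypotheses (e_sym : symmetric e) (e_irr : irreflexive e).

Definition nb (v : V) : {set V} := [set w | e v w].

Lemma box_sum (X Y : {set V}) : #|box e X Y| = \sum_(x in X) #|nb x :&: Y|.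
Proof.
rewrite card_pairs [RHS]big_mkcond; apply: eq_bigr => x _; case: ifP => xX.
  by apply: eq_card => y; rewrite !inE /= xX /= andbC.
by rewrite eq_card0 // => y; rewrite !inE /= xX.
Qed.

Lemma box_sym (X Y : {set V}) : #|box e X Y| = #|box e Y X|.
Proof.
rewrite -(card_imset _ (f := fun p : V * V => (p.2, p.1))); last by move=> [a b] [c d] /= [-> ->].
apply: eq_card => -[x y]; apply/imsetP/idP => [[[u v]]|].
  by rewrite !inE /= => /and3P[uX vY euv] [-> ->]; rewrite uX vY e_sym.
by rewrite inE /= => /and3P[xY yX exy]; exists (y, x) => //; rewrite inE /= xY yX e_sym.
Qed.

Lemma nb_split (v : V) (A : {set V}) : #|nb v| = #|nb v :&: A| + #|nb v :&: ~: A|.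
Proof. by rewrite -(cardsID A (nb v)) setDE. Qed.

Lemma cut_move (A : {set V}) v : v \in A ->
  #|box e (A :\ v) (~: (A :\ v))| + #|nb v :&: ~: A| = #|box e A (~: A)| + #|nb v :&: A|.
Proof.
move=> vA; rewrite [#|box e A (~: A)|]box_sum (big_setD1 v) //= addnAC -addnA [RHS]addnC.
congr (_ + _); rewrite addnC box_sum.
have -> : #|nb v :&: A| = \sum_(x in A :\ v) (v \in nb x).
  rewrite -sum1_card big_mkcond [RHS]big_mkcond /=; apply: eq_bigr => x _.
  by rewrite !inE [e x v]e_sym; case: eqVneq => [->|_]; rewrite ?e_irr //=; case: (e v x); case: (x \in A).
rewrite -big_split /=; apply: eq_bigr => x; rewrite !inE => /andP[xv xA].
rewrite (cardsD1 v (nb x :&: ~: (A :\ v))) !inE eqxx /= andbT addnC; congr (_ + _); apply: eq_card => y.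
by rewrite !inE; case: eqVneq => [->|] //=; rewrite vA andbF.
Qed.

Lemma sum_deg (A : {set V}) (k : nat) : (forall v, n <= k * #|nb v|) ->
  n * #|A| <= k * (#|box e A A| + #|box e A (~: A)|).
Proof.
move=> deg; rewrite !box_sum -big_split big_distrr /= mulnC -sum_nat_const.
by apply: leq_sum => v _; rewrite -nb_split.
Qed.

Lemma box_le (A B : {set V}) : #|box e A B| <= #|A| * #|B|.
Proof.
rewrite -cardsX; apply/subset_leq_card/subsetP => -[x y].
by rewrite !inE /= => /and3P[-> ->].
Qed.

End Cuts.

Lemma uniq_steps_neq (T : eqType) (p : seq T) u v :
  uniq p -> (u, v) \in steps p -> u != v.
Proof.
move=> up uv; have [p1 [p2 e]] := mem_steps uv; rewrite e in up.
move: up; rewrite cat_uniq => /and3P[_ /hasPn /(_ v) nv _].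
apply: contraTneq (nv _) => [->|]; last by rewrite inE eqxx.
by rewrite mem_rcons inE eqxx.
Qed.

Lemma mem_steps_both (T : eqType) (p : seq T) u v :
  (u, v) \in steps p -> u \in p /\ v \in p.
Proof.
by case/mem_steps => p1 [p2 ->]; rewrite !mem_cat mem_rcons !inE !eqxx orbT.
Qed.

Section TwoCliques.
Variables (V : finType) (n r k0 : nat) (e : rel V) (A : {set V}).
Hypotheses (cV : #|V| = n) (e_sym : symmetric e) (e_irr : irreflexive e).
Hypothesis dirac : forall v, n <= 2 * #|nb e v|.
Hypotheses (k0E : k0 = 4).
Let B := 32 * k0 * (32 * k0).
Let D := 128 * k0 * k0.
Hypotheses (rB : 136 * B <= r) (nB : 64 * B <= n).
Hypothesis A_like : two_cliques_like e r A.
Hypothesis A_min : forall A', two_cliques_like e r A' ->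
  #|box e A (~: A)| <= #|box e A' (~: A')|.

Let B64 : 64 <= B. Proof. by rewrite /B k0E. Qed.

Lemma like_compl (X : {set V}) : two_cliques_like e r X -> two_cliques_like e r (~: X).
Proof.
rewrite /two_cliques_like => /and3P[h1 h2 h3]; have := cardsC X.
by rewrite setCK box_sym // h3 andbT; move: h1 h2; rewrite cV; lia.
Qed.

Lemma min_compl A' : two_cliques_like e r A' ->
  #|box e (~: A) (~: ~: A)| <= #|box e A' (~: A')|.
Proof. by rewrite setCK box_sym //; apply: A_min. Qed.

(** A vertex has at most [#|X|] neighbours inside [X], so a deficit of [X] below [n/2] is made up by
    crossing edges. The truncated difference bounds one direction only; the complement supplies the
    other. *)
Lemma half_le (X : {set V}) : two_cliques_like e r X -> r * (n - 2 * #|X|) <= 8 * n.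
Proof.
rewrite /two_cliques_like cV => /and3P[h1 h2 h3].
have := sum_deg X dirac; have := box_le e X X.
move: (#|X|) (#|box e X X|) (#|box e X (~: X)|) h1 h2 h3 => x a c h1 h2 h3 ax nx.
have h4 : x * (n - 2 * x) <= 2 * c by rewrite mulnBr; nia.
have h5 : n * (n - 2 * x) <= 8 * c.
  by apply: leq_trans (leq_mul h1 (leqnn _)) _; rewrite -mulnA; lia.
have n0 : 0 < n by lia.
rewrite -(leq_pmul2l n0) mulnCA.
by apply: leq_trans (leq_mul (leqnn r) h5) _; lia.
Qed.

(** Moving a vertex with more neighbours across than at home would lower the minimal cut; [half_le]
    keeps the sizes in the range over which the cut is minimal. *)
Lemma own_ge (X : {set V}) v : two_cliques_like e r X ->
  (forall A', two_cliques_like e r A' -> #|box e X (~: X)| <= #|box e A' (~: A')|) ->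
  v \in X -> n <= 4 * #|nb e v :&: X|.
Proof.
move=> likeX minX vX; have := dirac v; rewrite (nb_split e v X).
suff : #|nb e v :&: ~: X| <= #|nb e v :&: X| by lia.
have := cut_move e_sym e_irr vX; have hX := half_le likeX.
rewrite leqNgt => cm; apply/negP => own.
have lt : #|box e (X :\ v) (~: (X :\ v))| < #|box e X (~: X)| by lia.
have : two_cliques_like e r (X :\ v); last by move/minX; rewrite leqNgt lt.
move: likeX; rewrite /two_cliques_like cV => /and3P[h1 h2 h3].
have c1 := cardsD1 v X; rewrite vX in c1.
have r64 : 64 <= r by lia.
have h := leq_trans (leq_mul r64 (leqnn (n - 2 * #|X|))) hX.
have n64 : 64 <= n by lia.
apply/and3P; split; [lia|lia|].
exact: leq_trans (leq_mul (leqnn r) (ltnW lt)) h3.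
Qed.

Definition side (x : V) : bool := x \in A.
Definition inner : rel V := fun x y => e x y && (side x == side y).
Definition code_cross : code V := fun l1 _ _ =>
  [set p | [&& e p.1 p.2, side p.1 != side p.2, p.1 \notin l1 & p.2 \notin l1]].

Lemma inner_deg v : n <= k0 * #|[set y | inner v y] :\: set0|.
Proof.
have nbE (X : {set V}) : (forall y, (y \in X) = (side v == side y)) ->
    nb e v :&: X \subset [set y | inner v y] :\: set0.
  by move=> XE; apply/subsetP => y; rewrite !inE /inner XE => /andP[-> ->].
rewrite k0E; have [vA|vA] := boolP (v \in A).
  apply: leq_trans (own_ge A_like A_min vA) _; rewrite leq_mul2l /=.
  by apply/subset_leq_card/nbE => y; rewrite /side vA; case: (y \in A).
have vC : v \in ~: A by rewrite inE.
apply: leq_trans (own_ge (like_compl A_like) min_compl vC) _; rewrite leq_mul2l /=.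
by apply/subset_leq_card/nbE => y; rewrite /side inE (negbTE vA); case: (y \in A).
Qed.

Local Notation K := (compatible side false).

(** Sides of sizes [a] and [b] differing by [t] satisfy [2 (a^2 + b^2) = n^2 + t^2], while by the
    degree condition at least [n^2/2 - 2c] ordered pairs inside the sides are edges, [c] being the
    cut. The size of [r] makes [t^2] and [c] small multiples of [n^2 / B]. *)
Lemma missing_small : 4 * B * #|[set p | K p.1 p.2 && ~~ inner p.1 p.2]| <= n * n.
Proof.
set M := [set p | _].
have cM : #|M| + (#|box e A A| + #|box e (~: A) (~: A)|) <= #|A| * #|A| + #|~: A| * #|~: A|.
  rewrite -!cardsX -(cardsUI (setX A A)) (_ : _ :&: _ = set0); last first.
    by apply/setP => -[x y]; rewrite !inE /=; case: (x \in A); rewrite ?andbF.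
  rewrite cards0 addn0 -(cardsUI (box e A A)) (_ : box e A A :&: _ = set0); last first.
    by apply/setP => -[x y]; rewrite !inE /=; case: (x \in A); rewrite ?andbF.
  rewrite cards0 addn0 -cardsUI (_ : M :&: _ = set0) ?cards0 ?addn0; last first.
    apply/setP => -[x y]; rewrite !inE /= /inner /compatible /side.
    by case: (x \in A); case: (y \in A); case: (e x y); rewrite ?andbF.
  apply/subset_leq_card/subsetP => -[x y]; rewrite !inE /= /inner /compatible /side.
  by case: (x \in A); case: (y \in A); rewrite ?andbF.
have d1 := sum_deg A dirac; have d2 := sum_deg (~: A) dirac.
rewrite setCK [#|box e (~: A) A|]box_sym // in d2.
have := A_like; rewrite /two_cliques_like cV => /and3P[_ _ h3].
have cA := cardsC A; rewrite cV in cA.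
have hA := half_le A_like; have hC := half_le (like_compl A_like).
move: cM d1 d2 h3 cA hA hC.
move: (#|M|) (#|box e A A|) (#|box e (~: A) (~: A)|) (#|box e A (~: A)|) (#|A|) (#|~: A|).
move=> q u w c a b cM d1 d2 h3 ab hA hC.
have rn : 136 * B * c <= n * n.
  by apply: leq_trans h3; rewrite leq_mul2r rB orbT.
have core x y : x + y = n -> r * (n - 2 * x) <= 8 * n -> x <= y ->
    4 * B * (2 * (x * x + y * y)) <= 4 * B * (n * n) + n * n.
  move=> xyn hx xy; pose t := y - x; have ey : y = x + t by rewrite /t; lia.
  have en : n = 2 * x + t by lia.
  have t1 : 136 * B * t <= 8 * n.
    have et : n - 2 * x = t by lia.
    by rewrite et in hx; apply: leq_trans hx; rewrite leq_mul2r rB orbT.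
  have t2 : 136 * B * (t * t) <= 8 * (n * n).
    rewrite mulnA; apply: leq_trans (leq_mul t1 (_ : t <= n)) _; first by lia.
    by rewrite -mulnA.
  have -> : 2 * (x * x + y * y) = n * n + t * t by rewrite ey en; ring.
  by rewrite mulnDr leq_add2l; lia.
have two : 4 * B * (2 * (a * a + b * b)) <= 4 * B * (n * n) + n * n.
  have [ab'|ba'] := leqP a b; first exact: core hA ab'.
  by rewrite [a * a + b * b]addnC; apply: core hC (ltnW ba'); rewrite addnC.
have sum : 2 * q + n * n <= 2 * (a * a + b * b) + 4 * c.
  by have : n * a + n * b = n * n by [rewrite -mulnDr ab]; lia.
have : 4 * B * (2 * q + n * n) <= 4 * B * (2 * (a * a + b * b) + 4 * c).
  by rewrite leq_mul2l sum orbT.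
rewrite !mulnDr in two *; lia.
Qed.

Lemma cross_own (X : {set V}) v : 2 * #|X| <= n -> v \in X ->
  n + 2 <= 2 * #|nb e v :&: ~: X| + 2 * #|X|.
Proof.
move=> Xn vX; have := dirac v; rewrite (nb_split e v X).
suff : #|nb e v :&: X| < #|X| by lia.
rewrite (cardsD1 v X) vX ltnS; apply/subset_leq_card/subsetP => y.
by rewrite !inE => /andP[evy ->]; rewrite andbT; apply: contraTneq evy => ->; rewrite e_irr.
Qed.

(** A vertex of a side with at most [n/2] vertices has a neighbour across, and at least two if the
    side is strictly smaller than [n/2]; so one survives the removal of [u]. *)
Lemma cross_avoid (X : {set V}) u : 2 * #|X| <= n -> u \in X \/ 2 * #|X| < n ->
  #|X| <= #|[set p | [&& p.1 \in X, p.2 \notin X, e p.1 p.2, p.1 != u & p.2 != u]]|.+1.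
Proof.
move=> Xn alt; rewrite card_pairs.
rewrite (cardsD1 u X); apply: leq_trans (_ : (\sum_(x in X :\ u) 1).+1 <= _).
  by rewrite sum1_card; case: (u \in X).
rewrite ltnS [X in X <= _]big_mkcond; apply: leq_sum => x _; case: ifP => //.
rewrite !inE => /andP[xu xX]; have := cross_own Xn xX.
have -> : #|[set y | (x, y) \in [set p | [&& p.1 \in X, p.2 \notin X, e p.1 p.2, p.1 != u & p.2 != u]]]|
    = #|(nb e x :&: ~: X) :\ u|.
  by apply: eq_card => y; rewrite !inE /= xX xu; case: (e x y); rewrite ?andbF //= andbC.
rewrite (cardsD1 u (nb e x :&: ~: X)) !inE.
case: alt => [->|lt]; first by rewrite andbF; lia.
case: (_ && _); lia.
Qed.

(** [cross_avoid] applies to the side of [u] if that has at most half of the vertices, and otherwise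
    to the other side, which is then strictly smaller than half. *)
Lemma code_cross_large u : n <= 8 * #|code_cross [:: u] [::] [::]|.
Proof.
have wlogX (X : {set V}) : 2 * #|X| <= n -> n <= 4 * #|X| ->
    (forall x y, (side x != side y) = ((x \in X) != (y \in X))) ->
    u \in X \/ 2 * #|X| < n -> n <= 8 * #|code_cross [:: u] [::] [::]|.
  move=> Xn nX XE alt; have := cross_avoid Xn alt.
  set P := [set p | _]; have : #|P| <= #|code_cross [:: u] [::] [::]|.
    apply/subset_leq_card/subsetP => -[x y]; rewrite !inE /= XE.
    by case/and5P => -> /negbTE -> -> -> ->.
  by lia.
have := A_like; have := like_compl A_like; rewrite /two_cliques_like cV.
move=> /and3P[c1 _ _] /and3P[a1 _ _]; have cA := cardsC A; rewrite cV in cA.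
have EA x y : (side x != side y) = ((x \in A) != (y \in A)) by [].
have EC x y : (side x != side y) = ((x \in ~: A) != (y \in ~: A)).
  by rewrite !inE /side; case: (x \in A); case: (y \in A).
have [uA|uA] := boolP (u \in A).
  have [le|lt] := leqP (2 * #|A|) n; first by apply: wlogX EA _; auto.
  by apply: wlogX EC _; [lia| |right; lia].
have uC : u \in ~: A by rewrite inE.
have [le|lt] := leqP (2 * #|~: A|) n; first by apply: wlogX EC _; auto.
by apply: wlogX EA _; [lia| |right; lia].
Qed.

Variables (m : rel V) (d L : nat).
Hypotheses (m_sym : symmetric m) (m_e : forall x y, m x y -> e x y).
Hypothesis dL : 34 * k0 + 2 * D * (6 * D + 1) + 2 * B * (6 * D + 18) + 8 <= d.
Hypothesis LL : (6 * D + 18) * n <= L.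

(** Only linearly many crossing edges are guaranteed, so a word may name just boundedly many
    vertices to avoid. Single vertices suffice: a first edge [a b], one avoiding [a] and one
    avoiding [b] always contain two disjoint edges. *)
Lemma two_cross_edges : hits m d L code_cross ->
  exists a1 a2 b1 b2, [/\ [/\ side a1, side a2, ~~ side b1 & ~~ side b2],
    a1 != a2, b1 != b2, m a1 b1 & m a2 b2].
Proof.
move=> hit; have P u : exists a b, [/\ side a, ~~ side b, m a b, a != u & b != u].
  have := hit [:: u] [::] [::]; rewrite cV /= !addn0; case.
  - by apply: leq_trans LL; have := nB; have := B64; nia.
  - rewrite muln1; apply: leq_trans (code_cross_large u) _; rewrite leq_mul2r.
    by apply/orP; right; apply: leq_trans dL; apply: leq_addl.
  case=> x y; rewrite !inE /= => /and4P[exy sxy xu yu] mxy.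
  have [sx|sx] := boolP (side x); first by exists x, y; split=> //; case: (side y) sxy; rewrite ?sx.
  by exists y, x; split=> //; [case: (side y) sxy; rewrite ?(negbTE sx)|rewrite m_sym].
have [v0 _] : exists v0, v0 \in V by apply/card_gt0P; rewrite cV; have := nB; have := B64; lia.
have [a [b [sa sb mab _ _]]] := P v0.
have [a' [b' [sa' sb' mab' a'a _]]] := P a.
have [bb'|bb'] := eqVneq b b'; last first.
  by exists a, a', b, b'; split=> //; rewrite eq_sym.
have [a2 [b2 [sa2 sb2 mab2 _ b2b]]] := P b.
have [e2|e2] := eqVneq a a2.
  exists a', a, b, b2; split=> //; [by rewrite eq_sym|by rewrite bb'|by rewrite e2].
by exists a, a2, b, b2; split=> //; rewrite eq_sym.
Qed.

Definition ws_cliques : seq (code V) :=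
  [:: code_expand inner set0; code_cover inner n D; code_close inner; code_cross].

Lemma two_cliques_hamiltonian :
  (forall i, i < 5 -> hits m d L (nth code_cross ws_cliques i)) -> hamiltonian m.
Proof.
move=> hit; have h1 := hit 0 isT; have h2 := hit 1 isT; have h3 := hit 2 isT.
have {hit} h4 := hit 3 isT; rewrite /= in h1 h2 h3 h4.
have [a1 [a2 [b1 [b2 [[sa1 sa2 sb1 sb2] a12 b12 m1 m2]]]]] := two_cross_edges h4.
have n64 : 64 <= n by have := nB; have := B64; lia.
have m_irr : irreflexive m by move=> x; apply/negP => /m_e; rewrite e_irr.
pose lf := [:: (a1, b1); (a2, b2)].
have fE x y : list_rel lf x y -> ((x, y) \in lf) \/ ((y, x) \in lf) by move/orP.
pose Z := [set a1; a2; b1; b2].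
pose SA := enum (A :\ a1 :\ a2); pose SB := enum (~: A :\ b1 :\ b2).
have f_m x y : list_rel lf x y -> m x y.
  by case/fE; rewrite !inE => /orP[] /eqP[-> ->] //; rewrite m_sym.
have g_K x y : inner x y -> K x y.
  rewrite /inner /compatible => /andP[exy /eqP ->]; rewrite addbb andbT.
  by apply: contraTneq exy => ->; rewrite e_irr.
have fZ x y : list_rel lf x y -> x \in Z.
  by case/fE; rewrite !inE => /orP[] /eqP[e1 e2]; rewrite ?e1 ?e2 !eqxx ?orbT.
have Z4 : #|Z :\: set0| <= 4.
  rewrite setD0; apply: leq_trans (leq_card_setU _ _) _; rewrite cards1 addn1 ltnS.
  apply: leq_trans (leq_card_setU _ _) _; rewrite cards1 addn1 ltnS.
  by apply: leq_trans (leq_card_setU _ _) _; rewrite !cards1.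
have uA : uniq (a1 :: rcons SA a2).
  rewrite /= mem_rcons rcons_uniq inE (negbTE a12) /SA enum_uniq !mem_enum !inE !eqxx.
  by rewrite andbF.
have uB : uniq (b2 :: rcons SB b1).
  rewrite /= mem_rcons rcons_uniq inE eq_sym (negbTE b12) /SB enum_uniq !mem_enum !inE !eqxx.
  by rewrite andbF.
have inA v : (v \in a1 :: rcons SA a2) = side v.
  rewrite inE mem_rcons inE /SA mem_enum !inE /side.
  by case: eqVneq => [->|_]; rewrite ?[_ \in A]sa1 //; case: eqVneq => [->|_] //=; rewrite ?[_ \in A]sa2.
have inB v : (v \in b2 :: rcons SB b1) = ~~ side v.
  rewrite inE mem_rcons inE /SB mem_enum !inE /side.
  by case: eqVneq => [->|_]; rewrite ?[_ \in A](negbTE sb2) //;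
    case: eqVneq => [->|_] //=; rewrite ?[_ \in A](negbTE sb1).
have Kside p b : uniq p -> (forall v, v \in p -> side v = b) ->
    all (fun xy => K xy.1 xy.2 || list_rel lf xy.1 xy.2) (steps p).
  move=> up pb; apply/allP => -[u v] /= uv; apply/orP; left.
  have [up' vp] := mem_steps_both uv; rewrite /compatible !pb // addbb andbT.
  exact: uniq_steps_neq up uv.
(* The only crossing steps are the prescribed ones, from [a2] to [b2] and, closing the cycle, from
   [b1] to [a1]. *)
have adm : admissible side false (list_rel lf) ((a1 :: rcons SA a2) ++ (b2 :: rcons SB b1)).
  split.
  - rewrite cat_uniq uA uB andbT; apply/hasPn => v; rewrite inB => sv.
    by apply/negP; rewrite inA (negbTE sv).
  - by move=> v; rewrite mem_cat inA inB orbN.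
  rewrite cat_cons /csteps all_rcons; apply/andP; split.
    rewrite last_cat /= last_rcons /list_rel /= !inE !eqxx !orbT //.
  rewrite -cat_cons -[a1 :: rcons SA a2]rcons_cons steps_cat all_cat; apply/andP; split.
    by rewrite rcons_cons; apply: (Kside _ true) uA _ => v; rewrite inA.
  apply/andP; split; first by rewrite /list_rel /= !inE !eqxx !orbT.
  by apply: (Kside _ false) uB _ => v; rewrite inB => /negbTE.
apply: (near_complete_hamiltonian (kappa := side) (beta := false) (lf := lf) (Z := Z)
  (Zs := set0) (k0 := k0) (g := inner) cV _ m_sym m_irr f_m g_K _ inner_deg fZ Z4 h1 h2 h3
  _ LL _ _ missing_small adm).
- by lia.
- by rewrite k0E.
- by move: dL; rewrite -/D -/B; lia.
- by rewrite /=; lia.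
- by have := nB; rewrite -/B; lia.
Qed.

End TwoCliques.

(** * Graphs close to complete bipartite ones *)

Lemma linear_lt_expn (c : nat) : 0 < c ->
  exists n1, forall n, n1 <= n -> 8 * n < 2 ^ (n %/ c).
Proof.
move=> c0; exists (c * (64 * c)) => n nbig.
set q := n %/ c; have nq : n < c * q.+1 by rewrite mulnC ltn_ceil.
have qbig : 64 * c <= q by rewrite leq_divRL // mulnC.
have h1 : q./2.+1 * q./2.+1 <= 2 ^ q.
  apply: leq_trans (_ : 2 ^ q./2 * 2 ^ q./2 <= _); first by rewrite leq_mul // ltn_expl.
  by rewrite -expnD leq_exp2l // addnn; have := odd_double_half q; lia.
have h2 : q <= 2 * q./2 + 1 by have := odd_double_half q; lia.
apply: leq_trans h1; move: (q./2) h2 => s h2; nia.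
Qed.

(** * A random subset, by counting *)

Section RandomHalf.
Variables (V : finType) (n : nat).
Hypothesis cV : #|V| = n.
Implicit Types (f : {ffun V -> bool}) (N : {set V}).

Definition chosen f : {set V} := [set v | f v].

(** Independence of the coordinates, with expectations scaled by [2 ^ n]. *)
Lemma sum_prod_ffun (F : V -> bool -> nat) :
  \sum_(f : {ffun V -> bool}) \prod_v F v (f v) = \prod_v (F v true + F v false).
Proof.
rewrite -(bigA_distr_bigA F); apply: eq_bigr => v _.
by rewrite big_bool.
Qed.

Lemma prod_if (N : {set V}) (a b : nat) :
  \prod_v (if v \in N then a else b) = a ^ #|N| * b ^ (n - #|N|).
Proof.
rewrite (bigID (mem N)) /=; congr (_ * _).
  by rewrite (eq_bigr (fun _ => a)) => [|v ->] //; rewrite prod_nat_const.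
rewrite (eq_bigr (fun _ => b)) => [|v /negbTE ->] //.
by rewrite prod_nat_const -cV -(cardC (mem N)) addKn.
Qed.

Lemma sum_expn_chosen N : \sum_(f : {ffun V -> bool}) 2 ^ #|N :&: chosen f| = 3 ^ #|N| * 2 ^ (n - #|N|).
Proof.
rewrite -prod_if.
rewrite (eq_bigr (fun f => \prod_v (if (v \in N) && f v then 2 else 1))) => [|f _]; last first.
  rewrite -big_mkcond prod_nat_const; congr (_ ^ _); apply: eq_card => v.
  by rewrite !inE.
rewrite (sum_prod_ffun (fun v b => if (v \in N) && b then 2 else 1)).
by apply: eq_bigr => v _; rewrite andbT andbF; case: ifP.
Qed.

Lemma card_ffun_bool : #|{ffun V -> bool}| = 2 ^ n.
Proof. by rewrite card_ffun card_bool cV. Qed.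

Lemma card_chosen2 x y : x != y -> 4 * #|[set f : {ffun V -> bool} | f x && f y]| = 2 ^ n.
Proof.
move=> xy; pose F v (b : bool) : nat := if v \in [set x; y] then b : nat else 1.
have -> : #|[set f : {ffun V -> bool} | f x && f y]| = \sum_(f : {ffun V -> bool}) \prod_v F v (f v).
  rewrite -sum1dep_card big_mkcond; apply: eq_bigr => f _.
  rewrite (bigD1 x) //= (bigD1 y) 1?eq_sym //= /F !inE !eqxx orbT.
  rewrite big1 => [|v /andP[vx vy]]; last by rewrite !inE (negbTE vx) (negbTE vy).
  by rewrite muln1; case: (f x); case: (f y).
rewrite sum_prod_ffun (eq_bigr (fun v => if v \in [set x; y] then 1 else 2)) => [|v _]; last first.
  by rewrite /F; case: ifP.
rewrite prod_if exp1n mul1n cards2 xy -[4]/(2 ^ 2) -expnD; congr (_ ^ _).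
have : #|[set x; y]| <= n by rewrite -cV max_card.
by rewrite cards2 xy; lia.
Qed.

(** Markov's inequality for [2 ^ #|N :&: chosen f|], whose mean is [(3/2)^#|N|]: the bad fraction is
    at most [(3/4)^#|N| * 2^q], and for [#|N| >= 4q] this is at most
    [(81/256)^q * 2^q = (162/256)^q]. *)
Lemma card_few_outside N q : 4 * q <= #|N| ->
  #|[set f : {ffun V -> bool} | #|N :\: chosen f| <= q]| * 256 ^ q <= 162 ^ q * 2 ^ n.
Proof.
move=> qN; set Bad := [set f | _]; have Nn : #|N| <= n by rewrite -cV max_card.
have h1 : #|Bad| * 2 ^ (#|N| - q) <= 3 ^ #|N| * 2 ^ (n - #|N|).
  rewrite -sum_expn_chosen -sum_nat_const big_mkcond; apply: leq_sum => f _.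
  case: ifP => //; rewrite inE => fbad; rewrite leq_exp2l //.
  by have := cardsID (chosen f) N; lia.
have h2 : #|Bad| * 4 ^ #|N| <= 3 ^ #|N| * 2 ^ n * 2 ^ q.
  have -> : 4 ^ #|N| = 2 ^ (#|N| - q) * 2 ^ #|N| * 2 ^ q.
    by rewrite -!expnD -[4]/(2 ^ 2) -expnM; congr (_ ^ _); lia.
  have -> : 2 ^ n = 2 ^ (n - #|N|) * 2 ^ #|N| by rewrite -expnD; congr (_ ^ _); lia.
  by rewrite !mulnA leq_mul2r leq_mul2r h1 !orbT.
have [s es] : exists s, #|N| = 4 * q + s by exists (#|N| - 4 * q); lia.
have expE a : a ^ (4 * q + s) = (a ^ 4) ^ q * a ^ s by rewrite expnD expnM.
move: h2; rewrite es !expE -[4 ^ 4]/256 -[3 ^ 4]/81 => h2.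
have h3 : 3 ^ s <= 4 ^ s by case: (posnP s) => [->//|s0]; rewrite leq_exp2r.
have h4 : 0 < 4 ^ s by rewrite expn_gt0.
rewrite -(leq_pmul2r h4); apply: leq_trans (_ : 81 ^ q * 3 ^ s * 2 ^ n * 2 ^ q <= _).
  by rewrite -mulnA.
have -> : 162 ^ q = 81 ^ q * 2 ^ q by rewrite -expnMn.
move: (81 ^ q) (2 ^ q) (2 ^ n) (3 ^ s) (4 ^ s) h3 => a b c u w uw.
have -> : a * u * c * b = a * b * c * u by ring.
by rewrite leq_mul2l uw orbT.
Qed.

(** Here [256/162 >= 3/2] and [(3/2)^2 >= 2]. *)
Lemma exp_small q : 162 ^ q * 2 ^ (q %/ 2) <= 256 ^ q.
Proof.
have h1 : 162 ^ q * 3 ^ q <= 256 ^ q * 2 ^ q.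
  by rewrite -!expnMn; case: (posnP q) => [->//|q0]; rewrite leq_exp2r.
have h2 : 2 ^ q * 2 ^ (q %/ 2) <= 3 ^ q.
  have [h [b [eq hE]]] : exists h (b : bool), q = 2 * h + b /\ q %/ 2 = h.
    exists q./2, (odd q); rewrite divn2; split=> //.
    by have := odd_double_half q; lia.
  have expE a : a ^ (2 * h + b) = (a ^ 2) ^ h * a ^ b by rewrite expnD expnM.
  rewrite hE eq !expE -[2 ^ 2]/4 -[3 ^ 2]/9.
  have h8 : 4 ^ h * 2 ^ h <= 9 ^ h.
    by rewrite -expnMn; case: (posnP h) => [->//|h0]; rewrite leq_exp2r.
  have hb : 2 ^ b <= 3 ^ b by case: (b).
  have -> : 4 ^ h * 2 ^ b * 2 ^ h = 4 ^ h * 2 ^ h * 2 ^ b by ring.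
  exact: leq_mul h8 hb.
have h3 : 0 < 2 ^ q by rewrite expn_gt0.
rewrite -(leq_pmul2r h3); apply: leq_trans h1; rewrite -mulnA leq_mul2l.
by rewrite mulnC h2 orbT.
Qed.

Variables (e : rel V) (A S : {set V}) (kq : nat).
Hypotheses (e_irr : irreflexive e) (kq_gt0 : 0 < kq).
Hypothesis deg_S : forall v, v \in S -> n <= kq * #|nb e v :&: A|.
Hypothesis n_large : 8 * n < 2 ^ (n %/ (8 * kq)).

(* A uniformly random subset [P] works with positive probability. *)
Lemma split_half : exists P : {set V},
  (forall v, v \in S -> n <= 4 * kq * #|(nb e v :&: A) :\: P|) /\
  #|box e A A| <= 8 * #|box e (A :&: P) (A :&: P)|.
Proof.
pose q := n %/ (4 * kq).
have k4 : 0 < 4 * kq by rewrite muln_gt0.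
pose E := #|box e A A|.
pose Ef f := #|box e (A :&: chosen f) (A :&: chosen f)|.
pose Good := [set f : {ffun V -> bool} | E <= 8 * Ef f].
pose Bad v := [set f : {ffun V -> bool} | #|(nb e v :&: A) :\: chosen f| <= q].
have cbad v : v \in S -> #|Bad v| * 256 ^ q <= 162 ^ q * 2 ^ n.
  move=> vS; apply: card_few_outside; rewrite -(leq_pmul2l kq_gt0).
  apply: leq_trans (deg_S vS); rewrite mulnA [kq * 4]mulnC /q mulnC; exact: leq_divM.
pose U := \bigcup_(v in S) Bad v.
have cU : 8 * #|U| < 2 ^ n.
  have h1 : #|U| * 256 ^ q <= n * (162 ^ q * 2 ^ n).
    apply: leq_trans (_ : (\sum_(v in S) #|Bad v|) * 256 ^ q <= _).
      rewrite leq_mul2r /U; apply/orP; right.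
      elim/big_ind2: _ => [|X x Y y Xx Yy|v _]; rewrite ?cards0 //.
      exact: leq_trans (leq_card_setU _ _) (leq_add Xx Yy).
    rewrite big_distrl /=; apply: leq_trans (_ : \sum_(v in S) 162 ^ q * 2 ^ n <= _).
      by apply: leq_sum => v /cbad.
    by rewrite sum_nat_const leq_mul2r -cV max_card orbT.
  have h2 : 8 * n * 162 ^ q < 256 ^ q.
    have := exp_small q; have -> : q %/ 2 = n %/ (8 * kq).
      by rewrite /q -divnMA; congr (_ %/ _); lia.
    apply: leq_trans; rewrite mulnC ltn_pmul2l // expn_gt0 //.
  have c0 : 0 < 256 ^ q by rewrite expn_gt0.
  have d0 : 0 < 2 ^ n by rewrite expn_gt0.
  rewrite -(ltn_pmul2r c0); apply: leq_ltn_trans (_ : 8 * n * 162 ^ q * 2 ^ n < _).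
    by have := leq_mul (leqnn 8) h1; rewrite !mulnA.
  by rewrite [X in _ < X]mulnC ltn_pmul2r.
have sumE : 4 * \sum_(f : {ffun V -> bool}) Ef f = 2 ^ n * E.
  have EfE f : Ef f = \sum_(p in box e A A) (f p.1 && f p.2).
    rewrite /Ef -sum1_card big_mkcond [RHS]big_mkcond; apply: eq_bigr => -[x y] _.
    rewrite !inE /=.
    by case: (x \in A); case: (y \in A); case: (f x); case: (f y); case: (e x y).
  rewrite (eq_bigr _ (fun f _ => EfE f)) exchange_big big_distrr /= mulnC -sum_nat_const.
  apply: eq_bigr => -[x y]; rewrite inE /= => /and3P[_ _ exy].
  rewrite -(@card_chosen2 x y); last by apply: contraTneq exy => ->; rewrite e_irr.
  congr (4 * _); rewrite -sum1dep_card [RHS]big_mkcond; apply: eq_bigr => f _.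
  by case: (f x && f y).
(* The mean of [Ef f] is [E / 4] and no value exceeds [E], so at least an eighth of all subsets
   reach [E / 8]; the union [U] of the bad events is smaller. *)
have cGood : 2 ^ n <= 8 * #|Good|.
  have [E0|E0] := posnP E.
    have -> : #|Good| = 2 ^ n.
      by rewrite -card_ffun_bool -cardsT; congr #|pred_of_set _|; apply/setP => f; rewrite !inE E0.
    by rewrite leq_pmull.
  rewrite -(leq_pmul2r E0).
  have : 8 * \sum_(f : {ffun V -> bool}) Ef f <= #|Good| * (8 * E) + 2 ^ n * E.
    rewrite -card_ffun_bool -!sum_nat_const big_distrr /= [X in _ <= X + _]big_mkcond -big_split.
    apply: leq_sum => f _ /=; rewrite inE; case: ifP => [_|/negbT]; last by rewrite -ltnNge; apply: ltnW.
    have : Ef f <= E.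
      apply/subset_leq_card/subsetP => -[x y]; rewrite !inE /=.
      by case/and3P => /andP[-> _] /andP[-> _] ->.
    by lia.
  by move: sumE; move: (\sum_(f : {ffun V -> bool}) _) => s; lia.
have [f fG fU] : exists2 f, f \in Good & f \notin U.
  apply/subsetPn; apply: contraL cU => /subset_leq_card sub.
  by rewrite -leqNgt; apply: leq_trans cGood _; rewrite leq_mul2l sub orbT.
exists (chosen f); split; last by move: fG; rewrite inE.
move=> v vS; have : f \notin Bad v.
  by apply: contraNN fU => fb; apply/bigcupP; exists v.
rewrite inE -ltnNge => lt; apply: ltnW; apply: leq_trans (ltn_ceil n k4) _.
by rewrite mulnC leq_mul2l lt orbT.
Qed.

End RandomHalf.

Section Structure.
Variables (V : finType) (n r eta B : nat) (e : rel V).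
Hypotheses (cV : #|V| = n) (e_sym : symmetric e) (e_irr : irreflexive e).
Hypothesis dirac : forall v, n <= 2 * #|nb e v|.
Hypotheses (eta4 : 4 <= eta) (etaB : eta <= 8 * B) (rB : 8 * B * (8 * B) <= r).

(* A maximum cut, from whose larger side vertices with many neighbours on their
   own side are moved as long as this does not make it the smaller one. *)
Lemma bipartite_structure T : bipartite_like e r T ->
  exists (A : {set V}) (t : nat), [/\ [/\ #|A| = #|~: A| + t,
    t <= 1 \/ (forall v, v \in A -> eta * #|nb e v :&: A| <= n) &
    forall v, v \in A -> t <= 2 * #|nb e v :&: A|],
    forall v, v \in A -> n <= 4 * #|nb e v :&: ~: A|,
    forall v, v \notin A -> n <= 2 * eta * #|nb e v :&: A| &
    8 * B * (#|A| * #|~: A|) <= 8 * B * #|box e A (~: A)| + n * n].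
Proof.
move=> Tlike; pose cut X := #|box e X (~: X)|.
have cutC X : cut (~: X) = cut X by rewrite /cut setCK box_sym.
have [A0 maxA0 A0big] : exists2 A0, (forall X, cut X <= cut A0) & #|~: A0| <= #|A0|.
  case: (@arg_maxnP _ set0 xpredT cut isT) => A1 _ A1max.
  have {}A1max X : cut X <= cut A1 by apply: A1max.
  have [le|lt] := leqP #|~: A1| #|A1|; first by exists A1.
  by exists (~: A1) => [X|]; rewrite ?cutC // setCK ltnW.
have cut0 : r * (n * n) <= 4 * r * cut A0 + n * n.
  move: Tlike; rewrite /bipartite_like cV => h; apply: leq_trans h _.
  by rewrite leq_add2r leq_mul2l maxA0 orbT.
have cross v : n <= 4 * #|nb e v :&: (if v \in A0 then ~: A0 else A0)|.
  have own (X : {set V}) : (forall Y, cut Y <= cut X) -> v \in X -> n <= 4 * #|nb e v :&: ~: X|.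
    move=> maxX vX; have := cut_move e_sym e_irr vX; have := maxX (X :\ v).
    by have := dirac v; rewrite (nb_split e v X) /cut; lia.
  case: ifP => vA; first exact: own.
  have := own (~: A0); rewrite setCK; apply; last by rewrite inE vA.
  by move=> X; rewrite cutC.
have cA0 := cardsC A0; rewrite cV in cA0.
pose t0 := #|A0| - #|~: A0|.
(* A cut close to [n^2 / 4] but at most [#|A0| * #|~: A0| = (n^2 - t0^2) / 4] leaves no room for a
   large [t0]. *)
have ct0 : r * (t0 * t0) <= n * n.
  have le := box_le e A0 (~: A0).
  have e1 : 4 * (#|A0| * #|~: A0|) + t0 * t0 = n * n.
    have eA : #|A0| = #|~: A0| + t0 by rewrite /t0; lia.
    by rewrite -cA0 eA; ring.
  have : 4 * r * cut A0 <= r * (4 * (#|A0| * #|~: A0|)).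
    by rewrite mulnA [r * 4]mulnC leq_mul2l le orbT.
  by have := congr1 (muln r) e1; rewrite mulnDr; lia.
have t0n : 8 * B * t0 <= n.
  rewrite -leq_sqr -!mulnn; apply: leq_trans ct0.
  have -> : 8 * B * t0 * (8 * B * t0) = 8 * B * (8 * B) * (t0 * t0) by ring.
  by rewrite leq_mul2r rB orbT.
(* Moving at most [t0 / 2] vertices of [H] keeps the first side at least as large. Either an
   imbalance of at most 1 is reached, or all of [H] is moved. *)
pose H := [set v in A0 | n <= eta * #|nb e v :&: A0|].
have [W [WH cW Wfull]] : exists W : {set V}, [/\ W \subset H, 2 * #|W| <= t0 &
    t0 <= 2 * #|W| + 1 \/ W = H].
  have [le|lt] := leqP (2 * #|H|) t0; first by exists H; split=> //; right.
  exists [set x in take t0./2 (enum H)].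
  have -> : #|[set x in take t0./2 (enum H)]| = t0./2.
    rewrite cardsE (card_uniqP _) ?take_uniq ?enum_uniq // size_takel // -cardE.
    by have := odd_double_half t0; lia.
  have o := odd_double_half t0; split; [|lia|left; lia].
  by apply/subsetP => x; rewrite inE => /mem_take; rewrite mem_enum.
have WA : W \subset A0 by apply: subset_trans WH _; apply/subsetP => x; rewrite inE => /andP[].
have cAW : #|A0 :\: W| = #|A0| - #|W| by rewrite cardsDS.
have cAWC := cardsC (A0 :\: W); rewrite cV in cAWC.
have WA' := subset_leq_card WA.
exists (A0 :\: W), (t0 - 2 * #|W|); split.
- split; first by rewrite /t0; lia.
    case: Wfull => [le|eW]; [by left; lia|right=> v; rewrite inE => /andP[vW vA]].
    have : v \notin H by rewrite -eW.
    rewrite inE vA /= -ltnNge => lt; apply: leq_trans (ltnW lt); rewrite leq_mul2l.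
    by apply/orP; right; apply/subset_leq_card/setIS/subsetDl.
  (* At most [(n - t) / 2] of the at least [n / 2] neighbours of [v] lie across, as this is the size
     of the other side. *)
  move=> v vA; have := dirac v; rewrite (nb_split e v (A0 :\: W)).
  have : #|nb e v :&: ~: (A0 :\: W)| <= #|~: (A0 :\: W)| by rewrite subset_leq_card ?subsetIr.
  by rewrite /t0; lia.
- move=> v; rewrite inE => /andP[_ vA]; apply: leq_trans (cross v) _.
  rewrite vA leq_mul2l /=; apply/subset_leq_card/setIS.
  by rewrite setCS subsetDl.
- move=> v; rewrite inE negb_and negbK => vAW.
  (* Removing [W] costs [v] at most [#|W| <= n / (2 * eta)] neighbours, half of the [n / eta] that
     it had in [A0]. *)
  have loss : #|nb e v :&: A0| <= #|nb e v :&: (A0 :\: W)| + #|W|.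
    rewrite -(cardsID W (nb e v :&: A0)) addnC setIDA leq_add2l.
    by rewrite subset_leq_card ?subsetIr.
  have eW : 2 * (eta * #|W|) <= n.
    apply: leq_trans t0n; rewrite mulnCA; exact: leq_mul.
  have : 2 * n <= 2 * (eta * #|nb e v :&: A0|).
    rewrite leq_mul2l /=; have [vW|vW] := boolP (v \in W).
      by have := subsetP WH v vW; rewrite inE => /andP[].
    rewrite (negbTE vW) /= in vAW; have := cross v; rewrite (negbTE vAW) => h.
    by apply: leq_trans h _; rewrite leq_mul2r eta4 orbT.
  by have := leq_mul (leqnn eta) loss; rewrite mulnDr; lia.
- have loss : cut A0 <= #|box e (A0 :\: W) (~: (A0 :\: W))| + #|W| * n.
    rewrite -[in #|W| * n]cV -cardsT -cardsX; apply: leq_trans (leq_card_setU _ _).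
    apply/subset_leq_card/subsetP => -[x y]; rewrite !inE /= => /and3P[-> yA ->].
    by rewrite (negbTE yA) andbF /= !andbT; case: (x \in W).
  have h4 : 4 * (#|A0 :\: W| * #|~: (A0 :\: W)|) <= n * n.
    by rewrite -cAWC mulnn nat_AGM2.
  have hx : 4 * B * (n * n - 4 * cut A0) <= n * n.
    apply: leq_trans (_ : r * (n * n - 4 * cut A0) <= _).
      by rewrite leq_mul2r; apply/orP; right; nia.
    by rewrite mulnBr; lia.
  rewrite mulnBr in hx.
  have hW : 16 * B * (#|W| * n) <= n * n.
    have := leq_mul t0n (leqnn n); have := leq_mul (leqnn (8 * B * n)) cW; nia.
  have hc : 16 * B * cut A0 <= 16 * B * (#|box e (A0 :\: W) (~: (A0 :\: W))| + #|W| * n).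
    by rewrite leq_mul2l loss orbT.
  have hm := leq_mul (leqnn (2 * B)) h4.
  move: (#|A0 :\: W| * #|~: (A0 :\: W)|) (#|box e (A0 :\: W) (~: (A0 :\: W))|)
    (cut A0) (#|W| * n) hx hW hc hm => x y z w hx hW hc hm.
  by rewrite mulnDr in hc; lia.
Qed.

End Structure.

Section Weave.
Variables (T : eqType) (R : rel T) (side : pred T).

(** A block of [us] is a path within the larger side, in the application a single vertex or a
    matching edge; the vertices of [bs] separate the blocks. *)
Definition weave (us : seq (seq T)) (bs : seq T) : seq T :=
  flatten [seq rcons ub.1 ub.2 | ub <- zip us bs].

Lemma perm_weave us bs : size us = size bs -> perm_eq (weave us bs) (flatten us ++ bs).
Proof.
elim: us bs => [|u us IHus] [|b bs] //= [/IHus p]; apply/permP => a.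
by have := permP p a; rewrite /weave /= -cats1 !count_cat /=; lia.
Qed.

Lemma weave_path us bs x : size us = size bs ->
  (forall u, u \in us -> exists a q, [/\ u = a :: q, side a, path R a q & side (last a q)]) ->
  (forall b, b \in bs -> ~~ side b) ->
  (forall a b, side a -> ~~ side b -> R a b && R b a) ->
  ~~ side x -> path R x (weave us bs) && ~~ side (last x (weave us bs)).
Proof.
move=> sz hu hb hR; elim: us bs x sz hu hb => [|u us IHus] [|b bs] x //= [sz] hu hb nx.
have [a [q [eu sa pq sl]]] := hu u (mem_head _ _).
have nb : ~~ side b by apply: hb; rewrite mem_head.
have {IHus} := IHus bs b sz _ _ nb; rewrite /weave /= cat_path last_cat last_rcons => IH.
have -> : path R x (rcons u b).
  rewrite eu /= rcons_path pq /=; have /andP[_ ->] := hR a x sa nx.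
  by have /andP[-> _] := hR _ b sl nb.
apply: IH => [v vin|v vin]; first by apply: hu; rewrite inE vin orbT.
by apply: hb; rewrite inE vin orbT.
Qed.

End Weave.

Section Bipartite.
Variables (V : finType) (n eta k0 t : nat) (e : rel V) (A P : {set V}).
Hypotheses (cV : #|V| = n) (e_sym : symmetric e) (e_irr : irreflexive e).
Hypotheses (etaE : eta = 256) (k0E : k0 = 8 * eta).
Let B := 32 * k0 * (32 * k0).
Let D := 128 * k0 * k0.
Hypothesis nB : 4 * B <= n.
Hypothesis cA : #|A| = #|~: A| + t.
Hypothesis flat : t <= 1 \/ (forall v, v \in A -> eta * #|nb e v :&: A| <= n).
Hypothesis own_deg : forall v, v \in A -> t <= 2 * #|nb e v :&: A|.
Hypothesis cross_deg : forall v, v \in A -> n <= 4 * #|nb e v :&: ~: A|.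
Hypothesis pool_deg : forall v, v \notin A -> n <= k0 * #|(nb e v :&: A) :\: P|.
Hypothesis pool_edges : #|box e A A| <= 8 * #|box e (A :&: P) (A :&: P)|.
Hypothesis complete : 8 * B * (#|A| * #|~: A|) <= 8 * B * #|box e A (~: A)| + n * n.

Local Notation pool := (A :&: P).
Definition in_side (x : V) : bool := x \in A.
Definition outer : rel V := fun x y => e x y && (in_side x (+) in_side y).
Definition code_pool : code V := fun l1 _ _ =>
  [set p | [&& p.1 \in pool, p.2 \in pool, e p.1 p.2, p.1 \notin l1 & p.2 \notin l1]].
Local Notation K := (compatible in_side true).

Lemma outer_deg v : n <= k0 * #|[set y | outer v y] :\: pool|.
Proof.
have [vA|vA] := boolP (v \in A); last first.
  apply: leq_trans (pool_deg vA) _; rewrite leq_mul2l; apply/orP; right.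
  apply/subset_leq_card/subsetP => y; rewrite !inE /outer /in_side (negbTE vA).
  by case/andP => yP /andP[-> ->]; rewrite yP.
apply: leq_trans (cross_deg vA) _; apply: leq_mul; first by rewrite k0E etaE.
apply/subset_leq_card/subsetP => y; rewrite !inE /outer /in_side vA.
by case/andP => -> /negbTE ->.
Qed.

Lemma outer_missing : 4 * B * #|[set p | K p.1 p.2 && ~~ outer p.1 p.2]| <= n * n.
Proof.
set M := [set p | _].
have cM : #|M| + (#|box e A (~: A)| + #|box e (~: A) A|) <= #|A| * #|~: A| + #|~: A| * #|A|.
  rewrite -!cardsX -(cardsUI (setX A (~: A))) (_ : _ :&: _ = set0); last first.
    by apply/setP => -[x y]; rewrite !inE /=; case: (x \in A); rewrite ?andbF.
  rewrite cards0 addn0 -(cardsUI (box e A (~: A))) (_ : box e A (~: A) :&: _ = set0); last first.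
    by apply/setP => -[x y]; rewrite !inE /=; case: (x \in A); rewrite ?andbF.
  rewrite cards0 addn0 -cardsUI (_ : M :&: _ = set0) ?cards0 ?addn0; last first.
    apply/setP => -[x y]; rewrite !inE /= /outer /compatible /in_side.
    by case: (x \in A); case: (y \in A); case: (e x y); rewrite ?andbF.
  apply/subset_leq_card/subsetP => -[x y]; rewrite !inE /= /outer /compatible /in_side.
  by case: (x \in A); case: (y \in A); rewrite ?andbF.
rewrite [#|box e (~: A) A|]box_sym // [#|~: A| * _]mulnC in cM.
move: (#|M|) (#|box e A (~: A)|) (#|A| * #|~: A|) cM complete => q c x cM h.
have : 4 * B * (q + (c + c)) <= 4 * B * (x + x) by rewrite leq_mul2l cM orbT.
by rewrite !mulnDr; lia.
Qed.

Definition used (ls : seq (V * V)) : seq V := flatten [seq [:: p.1; p.2] | p <- ls].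

Lemma size_used ls : size (used ls) = 2 * size ls.
Proof. by elim: ls => //= p ls; rewrite /used /= => ->; lia. Qed.

Let n_half : n <= 2 * #|A|. Proof. by have := cardsC A; rewrite cV cA; lia. Qed.

Lemma pool_large : t * n <= 32 * #|box e pool pool|.
Proof.
have h1 : t * #|A| <= 2 * #|box e A A|.
  by rewrite box_sum big_distrr /= mulnC -sum_nat_const; apply: leq_sum => v /own_deg.
have : t * n <= t * (2 * #|A|) by rewrite leq_mul2l n_half orbT.
have := pool_edges; lia.
Qed.

(** The pool has at least [t n / 32] ordered edges. Fewer than [2 t] used vertices, with at most
    [n / eta] neighbours in [A] each, spoil at most [4 t n / eta = t n / 64] of them; this fixes
    [eta = 256]. For [t = 1] nothing is used yet. *)
Lemma code_pool_large (l : seq V) : (forall v, v \in l -> v \in A) ->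
  size l <= 2 * t.-1 -> 0 < t -> t * n <= 64 * #|code_pool l [::] [::]|.
Proof.
move=> lA sl t0; set Q := code_pool _ _ _; pose L := [set x in l].
have cover : #|box e pool pool| <= #|Q| + (#|box e L A| + #|box e A L|).
  apply: leq_trans (_ : #|Q :|: (box e L A :|: box e A L)| <= _).
    apply/subset_leq_card/subsetP => -[x y]; rewrite !inE /= => /and3P[/andP[xA xP] /andP[yA yP] exy].
    rewrite xA xP yA yP exy /= !andbT.
    by case: (x \in l) => //=; case: (y \in l).
  apply: leq_trans (leq_card_setU _ _) _; rewrite leq_add2l; exact: leq_card_setU.
rewrite [#|box e A L|]box_sym // in cover.
have cL : #|L| <= size l by rewrite cardsE card_size.
have big := pool_large.
have [t1|t2] := leqP t 1.
  have L0 : box e L A = set0.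
    have : #|L| = 0 by lia.
    move/eqP; rewrite cards_eq0 => /eqP ->; apply/setP => x; rewrite !inE //.
  by rewrite L0 cards0 !addn0 in cover; lia.
have flat' : forall v, v \in A -> eta * #|nb e v :&: A| <= n.
  by case: flat => //; lia.
have hL : eta * #|box e L A| <= #|L| * n.
  rewrite box_sum big_distrr /= -sum_nat_const; apply: leq_sum => v.
  by rewrite inE => /lA /flat'.
have : #|L| * n <= 2 * t.-1 * n by rewrite leq_mul2r (leq_trans cL sl) orbT.
have : 2 * t.-1 * n <= 2 * t * n by rewrite leq_mul2r leq_mul2l leq_pred !orbT.
rewrite etaE in hL; lia.
Qed.

Variables (m : rel V) (d L : nat).
Hypotheses (m_sym : symmetric m) (m_e : forall x y, m x y -> e x y).
Hypothesis dL : 34 * k0 + 2 * D * (6 * D + 1) + 2 * B * (6 * D + 18) + 128 <= d.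
Hypothesis LL : (6 * D + 18) * n <= L.

Let tn : 2 * t <= n + t.
Proof. by have := cardsC A; rewrite cV cA; lia. Qed.

Lemma pool_matching : hits m d L code_pool -> exists ls, [/\ size ls = t,
  uniq (used ls), forall v, v \in used ls -> v \in pool &
  forall p, p \in ls -> m p.1 p.2].
Proof.
move=> hit; have n0 : 0 < n by have := nB; rewrite /B k0E etaE; lia.
have [v0 _] : exists v, v \in V by apply/card_gt0P; rewrite cV.
have grow j : j <= t -> exists ls, [/\ size ls = j, uniq (used ls),
    forall v, v \in used ls -> v \in pool & forall p, p \in ls -> m p.1 p.2].
  elim: j => [_|j IHj jt]; first by exists [::].
  have [ls [sl ul lpool lm]] := IHj (ltnW jt).
  have lA v : v \in used ls -> v \in A by move/lpool; rewrite inE => /andP[].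
  have t0 : 0 < t by lia.
  have big := code_pool_large lA ltac:(rewrite size_used; lia) t0.
  (* The pair [(v0, v0)] only keeps the first word nonempty. *)
  have := hit (used ls) [:: (v0, v0)] [::]; rewrite size_used sl cV /= addn0; case.
  - by rewrite addn1 /=; apply: leq_trans LL; nia.
  - apply: leq_trans (_ : 2 * (t * n) <= _); first by nia.
    apply: leq_trans (leq_mul (leqnn 2) big) _; rewrite mulnA leq_mul2r.
    by apply/orP; right; lia.
  case=> x y; rewrite inE /= => /and5P[xp yp exy xl yl] mxy.
  exists ((x, y) :: ls); split; first by rewrite /= sl.
  - rewrite /used /= inE negb_or xl yl ul !andbT.
    by apply: contraTneq exy => ->; rewrite e_irr.
  - by move=> v; rewrite /used /= 2!in_cons => /or3P[/eqP ->|/eqP ->|/lpool].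
  - by move=> p; rewrite inE => /orP[/eqP ->|/lm].
have [ls h] := grow t (leqnn t); by exists ls.
Qed.

Definition ws_bipartite : seq (code V) :=
  [:: code_expand outer pool; code_cover outer n D; code_close outer; code_pool].

Lemma bipartite_hamiltonian :
  (forall i, i < 5 -> hits m d L (nth code_pool ws_bipartite i)) -> hamiltonian m.
Proof.
move=> hit; have h1 := hit 0 isT; have h2 := hit 1 isT; have h3 := hit 2 isT.
have {hit} h4 := hit 3 isT; rewrite /= in h1 h2 h3 h4.
have [ls [sl ul lpool lm]] := pool_matching h4.
have n4 : 4 <= n by apply: leq_trans nB; rewrite /B k0E etaE.
have m_irr : irreflexive m by move=> x; apply/negP => /m_e; rewrite e_irr.
have f_m x y : list_rel ls x y -> m x y.
  by case/orP => /lm //=; rewrite m_sym.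
have mem_used p : p \in ls -> p.1 \in used ls /\ p.2 \in used ls.
  by move=> pl; split; apply/flattenP; exists [:: p.1; p.2];
    rewrite ?(map_f (fun p : V * V => [:: p.1; p.2])) // !inE eqxx ?orbT.
have fZ x y : list_rel ls x y -> x \in pool.
  by case/orP => /mem_used[] /= /lpool ? /lpool ?.
have Z4 : #|pool :\: pool| <= 4 by rewrite setDv cards0.
have g_K x y : outer x y -> K x y.
  rewrite /outer /compatible => /andP[exy ->]; rewrite andbT.
  by apply: contraTneq exy => ->; rewrite e_irr.
pose rest := enum (A :\: [set x in used ls]).
(* The [t] matching edges and the [#|A| - 2t] other vertices of [A] are [#|A| - t = #|~: A|] blocks,
   one for each vertex of the complement. *)
pose us := [seq [:: p.1; p.2] | p <- ls] ++ [seq [:: a] | a <- rest].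
pose bs := enum (~: A).
have flat_us : flatten us = used ls ++ rest.
  by rewrite flatten_cat; congr (_ ++ _); elim: (rest) => //= a s ->.
have sub_used : [set x in used ls] \subset A.
  by apply/subsetP => x; rewrite inE => /lpool; rewrite inE => /andP[].
have szus : size us = size bs.
  rewrite size_cat !size_map sl /rest /bs -!cardE cardsDS //.
  have := subset_leq_card sub_used; rewrite cardsE (card_uniqP ul) size_used sl cA.
  by move: (#|~: A|) => c; lia.
have pw := perm_weave szus; rewrite flat_us in pw.
have uw : uniq (weave us bs).
  rewrite (perm_uniq pw) !cat_uniq ul !enum_uniq !andbT /=.
  apply/andP; split; apply/hasPn => v.
    by rewrite mem_enum !inE => /andP[].
  rewrite mem_enum inE => vA; rewrite mem_cat mem_enum !inE (negbTE vA) andbF orbF.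
  by apply: contraNN vA => /lpool; rewrite inE => /andP[].
have fw v : v \in weave us bs.
  rewrite (perm_mem pw) !mem_cat !mem_enum !inE.
  by case: (v \in used ls); case: (v \in A).
pose R : rel V := fun x y => K x y || list_rel ls x y.
have [b0 b0A] : exists b, b \in ~: A.
  have [v0 _] : exists v, v \in V by apply/card_gt0P; rewrite cV; lia.
  have [v0A|v0A] := boolP (v0 \in A); last by exists v0; rewrite inE.
  have := cross_deg v0A; rewrite -[#|_|]cardsE => h.
  have : 0 < #|nb e v0 :&: ~: A| by move: h; rewrite cardsE; lia.
  by case/card_gt0P => b; rewrite inE => /andP[_ ?]; exists b.
have RK a b : in_side a -> ~~ in_side b -> R a b && R b a.
  move=> sa sb; have ab : a != b by apply: contraNneq sb => <-.
  by rewrite /R /compatible sa (negbTE sb) /= [b == a]eq_sym ab.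
have units u : u \in us -> exists a q, [/\ u = a :: q, in_side a, path R a q & in_side (last a q)].
  rewrite mem_cat => /orP[/mapP[p pl ->]|/mapP[a arest ->]].
    have [/lpool p1 /lpool p2] := mem_used p pl; exists p.1, [:: p.2]; split=> //=.
    - by move: p1; rewrite inE => /andP[].
    - by rewrite /R /list_rel -surjective_pairing pl /= orbT.
    - by move: p2; rewrite inE => /andP[].
  by exists a, [::]; split=> //; move: arest; rewrite mem_enum inE => /andP[].
have bsA b : b \in bs -> ~~ in_side b by rewrite mem_enum inE.
have adm : admissible in_side true (list_rel ls) (weave us bs).
  split=> //; rewrite -(cycle_csteps R) (cycle_path b0).
  have nb0 : ~~ in_side b0 by rewrite inE in b0A.
  (* The first use shows that the weave ends outside [A]; the second starts from that end and so
     closes the cycle. *)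
  have /andP[_ nl] := weave_path szus units bsA RK nb0.
  by have /andP[] := weave_path szus units bsA RK nl.
apply: (near_complete_hamiltonian (kappa := in_side) (beta := true) (lf := ls) (Z := pool)
  (Zs := pool) (k0 := k0) (g := outer) cV _ m_sym m_irr f_m g_K _ outer_deg fZ Z4 h1 h2 h3
  _ LL _ nB outer_missing adm).
- by lia.
- by rewrite k0E etaE.
- by move: dL; rewrite -/D -/B; lia.
- by rewrite sl; have := tn; lia.
Qed.

End Bipartite.

Lemma code_expand_sub (V : finType) (g : rel V) Z l1 l2 l3 p :
  p \in code_expand g Z l1 l2 l3 -> g p.1 p.2.
Proof. by rewrite inE => /and4P[]. Qed.

Lemma code_cover_sub (V : finType) (g : rel V) n D l1 l2 l3 p :
  p \in code_cover g n D l1 l2 l3 -> g p.1 p.2.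
Proof. by rewrite inE => /andP[]. Qed.

Lemma code_close_sub (V : finType) (g : rel V) l1 l2 l3 p :
  p \in code_close g l1 l2 l3 -> g p.1 p.2.
Proof. by rewrite inE => /andP[]. Qed.

Lemma dirac_forces : exists d K n1 : nat, 0 < d /\
  forall (V : finType) (e : rel V), symmetric e -> irreflexive e -> n1 <= #|V| ->
  (forall v, #|V| <= 2 * #|nb e v|) -> forces e d K.
Proof.
(* The values [k1], [k2], [k3] belong to the degrees [n/2], [n/4] and [n/(8 eta)] usable in the
   three cases; in the last one, [n/(2 eta)] neighbours lose a factor 4 to the pool. The first
   summand of [r] serves [missing_small], the second bounds the imbalance in
   [bipartite_structure]. *)
have [k1 k1E] : exists k1, k1 = 2 by exists 2.
have [k2 k2E] : exists k2, k2 = 4 by exists 4.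
have [eta etaE] : exists eta, eta = 256 by exists 256.
have [k3 k3E] : exists k3, k3 = 8 * eta by exists (8 * eta).
pose B k := 32 * k * (32 * k); pose D k := 128 * k * k.
have [r rE] : exists r, r = 136 * B k2 + 8 * B k3 * (8 * B k3).
  by exists (136 * B k2 + 8 * B k3 * (8 * B k3)).
have [kap kapE] : exists kap, kap = 80 * (20 * r * (20 * r)).
  by exists (80 * (20 * r * (20 * r))).
have e8 : 0 < 8 * (2 * eta) by rewrite etaE.
have [n2 n2P] := linear_lt_expn e8.
pose q1 := 2 * B k1; pose q2 := 2 * q1 * kap; pose q3 := 2 * q2 * kap.
pose s0 := 6 * D k1 + 16; pose s1 := s0 + 4 * q1 * kap; pose s2 := s1 + 4 * q2 * kap.
have [d1 d1E] : exists d1, d1 = 34 * k1 + 2 * D k1 * (6 * D k1 + 1) +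
  4 * q1 * kap * (s0 + 1 + 4 * q1 * kap) + 4 * q2 * kap * (s1 + 1 + 4 * q2 * kap) +
  q3 * (s2 + 1) by eexists.
have [d2 d2E] : exists d2, d2 = 34 * k2 + 2 * D k2 * (6 * D k2 + 1) +
  2 * B k2 * (6 * D k2 + 18) + 8 by eexists.
have [d3 d3E] : exists d3, d3 = 34 * k3 + 2 * D k3 * (6 * D k3 + 1) +
  2 * B k3 * (6 * D k3 + 18) + 128 by eexists.
have [K1 K1E] : exists K1, K1 = s2 + 17 by eexists.
have [K2 K2E] : exists K2, K2 = 6 * D k2 + 18 by eexists.
have [K3 K3E] : exists K3, K3 = 6 * D k3 + 18 by eexists.
exists (d1 + d2 + d3), (K1 + K2 + K3), (kap + 64 * B k2 + 4 * B k3 + n2).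
split; first by rewrite d3E; lia.
move=> V e e_sym e_irr nbig dirac.
have [n cV] : exists n, #|V| = n by exists #|V|.
have dirac' v : n <= 2 * #|nb e v| by rewrite -cV.
rewrite cV in nbig.
have [/existsP[T Tlike]|no1] := boolP [exists T, two_cliques_like e r T].
  apply: (@forces_le _ _ d2 _ K2); [lia|lia|].
  have [A Alike Amin] : exists2 A, two_cliques_like e r A &
      forall A', two_cliques_like e r A' -> #|box e A (~: A)| <= #|box e A' (~: A')|.
    by case: (@arg_minnP _ T (two_cliques_like e r) (fun X => #|box e X (~: X)|) Tlike)
      => A; exists A.
  pose ws := ws_cliques n k2 e A.
  exists (fun i => nth (code_cross e A) ws i); split.
    have inner_e x y : inner e A x y -> e x y by case/andP.
    case=> -[|[|[|[|[|//]]]]] _ l1 l2 l3 p /=.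
    - by move/code_expand_sub/inner_e.
    - by move/code_cover_sub/inner_e.
    - by move/code_close_sub/inner_e.
    - by rewrite inE => /and4P[].
    - by rewrite inE => /and4P[].
  move=> m ms me hit.
  apply: (two_cliques_hamiltonian cV e_sym e_irr dirac' k2E _ _ Alike Amin ms me
    (d := d2) (L := K2 * n)).
  - by rewrite rE leq_addr.
  - by rewrite -/(B k2); lia.
  - by rewrite d2E.
  - by rewrite K2E.
  by move=> i i5; have := hit (Ordinal i5); rewrite cV.
have [/existsP[T Tlike]|no2] := boolP [exists T, bipartite_like e r T].
  apply: (@forces_le _ _ d3 _ K3); [lia|lia|].
  have etaB : eta <= 8 * B k3 by rewrite /B k3E; nia.
  have rB : 8 * B k3 * (8 * B k3) <= r by rewrite rE leq_addl.
  have eta4 : 4 <= eta by rewrite etaE.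
  have [A [t [[cA flat own] cross sparse miss]]] :=
    bipartite_structure cV e_sym e_irr dirac' eta4 etaB rB Tlike.
  have eta2 : 0 < 2 * eta by rewrite etaE.
  have degS v : v \in ~: A -> n <= 2 * eta * #|nb e v :&: A|.
    by rewrite inE => /sparse.
  have nl := n2P n ltac:(lia).
  have [P [Pdeg Pedges]] := split_half cV e_irr eta2 degS nl.
  have pool_deg v : v \notin A -> n <= k3 * #|(nb e v :&: A) :\: P|.
    by move=> vA; rewrite k3E -[8]/(4 * 2) -[4 * 2 * eta]mulnA; apply: Pdeg; rewrite inE.
  pose ws := ws_bipartite n k3 e A P.
  exists (fun i => nth (code_pool e A P) ws i); split.
    have outer_e x y : outer e A x y -> e x y by case/andP.
    case=> -[|[|[|[|[|//]]]]] _ l1 l2 l3 p /=.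
    - by move/code_expand_sub/outer_e.
    - by move/code_cover_sub/outer_e.
    - by move/code_close_sub/outer_e.
    - by rewrite inE => /and5P[].
    - by rewrite inE => /and5P[].
  move=> m ms me hit.
  apply: (bipartite_hamiltonian cV e_sym e_irr etaE k3E _ cA flat own cross pool_deg
    Pedges miss ms me (d := d3) (L := K3 * n)).
  - by rewrite -/(B k3); lia.
  - by rewrite d3E.
  - by rewrite K3E.
  by move=> i i5; have := hit (Ordinal i5); rewrite cV.
apply: (@forces_le _ _ d1 _ K1); [lia|lia|].
have r0 : 0 < r by rewrite rE /B k2E.
have kap_r : 80 * (20 * r * (20 * r)) <= kap by rewrite kapE.
have n_kap : kap <= n by lia.
have no1' T : ~~ two_cliques_like e r T by move: no1; rewrite negb_exists => /forallP.
have no2' T : ~~ bipartite_like e r T by move: no2; rewrite negb_exists => /forallP.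
exists (fun i => nth (code_close e) (ws_generic n kap k1 e) i); split.
  case=> -[|[|[|[|[|//]]]]] _ l1 l2 l3 p /=.
  - exact: code_expand_sub.
  - exact: code_cover_sub.
  - by rewrite inE => /andP[].
  - by rewrite inE => /andP[].
  - exact: code_close_sub.
move=> m ms me hit.
apply: (generic_hamiltonian cV e_sym e_irr dirac' r0 k1E kap_r n_kap no1' no2' ms me
  (d := d1) (L := K1 * n)).
- by rewrite d1E.
- by rewrite K1E.
by move=> i i5; have := hit (Ordinal i5); rewrite cV.
Qed.

(** * The Maker-Breaker game *)

Section Spelling.
Variable V : finType.

Definition letter := (V + (V * V) + (V * V))%type.
Definition letters1 (t : seq letter) : seq V :=
  pmap (fun x => if x is inl (inl v) then Some v else None) t.
Definition letters2 (t : seq letter) : seq (V * V) :=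
  pmap (fun x => if x is inl (inr v) then Some v else None) t.
Definition letters3 (t : seq letter) : seq (V * V) :=
  pmap (fun x => if x is inr v then Some v else None) t.
Definition spell (l1 : seq V) (l2 l3 : seq (V * V)) : seq letter :=
  [seq inl (inl v) | v <- l1] ++ [seq inl (inr v) | v <- l2] ++
  [seq inr v | v <- l3].

Lemma pmap_some (S T : Type) (f : S -> option T) (g : T -> S) s :
  (forall x, f (g x) = Some x) -> pmap f (map g s) = s.
Proof. by move=> fg; elim: s => //= x s ->; rewrite fg. Qed.

Lemma pmap_map_none (S T U : Type) (f : S -> option T) (g : U -> S) s :
  (forall x, f (g x) = None) -> pmap f (map g s) = [::].
Proof. by move=> fg; elim: s => //= x s ->; rewrite fg. Qed.

Lemma letters1_spell l1 l2 l3 : letters1 (spell l1 l2 l3) = l1.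
Proof.
rewrite /letters1 /spell !pmap_cat (pmap_some (g := fun v => inl (inl v))) //.
by rewrite !pmap_map_none // !cats0.
Qed.

Lemma letters2_spell l1 l2 l3 : letters2 (spell l1 l2 l3) = l2.
Proof.
rewrite /letters2 /spell !pmap_cat (pmap_some (g := fun v => inl (inr v))) //.
by rewrite !pmap_map_none // cats0.
Qed.

Lemma letters3_spell l1 l2 l3 : letters3 (spell l1 l2 l3) = l3.
Proof.
rewrite /letters3 /spell !pmap_cat (pmap_some (g := fun v => inr v)) //.
by rewrite !pmap_map_none.
Qed.

Lemma set2_eq (x y u v : V) : [set u; v] = [set x; y] ->
  (u, v) = (x, y) \/ (u, v) = (y, x).
Proof.
move=> /setP exy; have := exy u; have := exy v; have := exy x; have := exy y.
rewrite !inE !eqxx !orbT /= => /orP ey /orP ex /esym/orP ev /esym/orP eu.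
by case: eu ev ex ey => /eqP ? [] /eqP ? [] /eqP ? [] /eqP ?; subst; auto.
Qed.

Lemma card_unordered (Q : {set V * V}) :
  #|Q| <= 2 * #|[set [set p.1; p.2] | p in Q]|.
Proof.
rewrite -[X in X <= _]sum1_card (partition_big_imset (fun p => [set p.1; p.2])) /=.
rewrite mulnC -sum_nat_const; apply: leq_sum => _ /imsetP[[x y] _ ->] /=.
rewrite sum1_card; apply: leq_trans (_ : #|[set (x, y); (y, x)]| <= 2).
  apply/subset_leq_card/subsetP => -[u v]; rewrite !inE => /andP[_ /eqP /= /set2_eq].
  by case=> ->; rewrite eqxx ?orbT.
by rewrite cards2; case: eqP.
Qed.

End Spelling.

Import Order.TTheory GRing.Theory Num.Theory.
Local Open Scope ring_scope.

(** * Beck's potential strategy *)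

Section Beck.
Variables (R : realFieldType) (E : finType) (e0 : E) (board : {set E}).
Variables (b : nat) (maker_first : bool) (I : finType) (P : pred I).
Variable W : I -> {set E}.
Hypothesis b_gt0 : (0 < b)%N.

(** A rational base not exceeding the [2^(1/b)] of Beck's criterion, whose powers up to [b] obey a
    linear bound. *)
Definition beck_base : R := 1 + (2 * b)%:R^-1.
Local Notation x := beck_base.

Lemma beck_base_gt1 : 1 < x.
Proof. by rewrite ltrDl invr_gt0 ltr0n muln_gt0. Qed.

Let x_gt0 : 0 < x. Proof. exact: lt_trans ltr01 beck_base_gt1. Qed.

Lemma beck_base_expr (j : nat) : (j <= b)%N -> x ^+ j <= 1 + j%:R / b%:R.
Proof.
have b0 : (0 : R) < b%:R by rewrite ltr0n.
elim: j => [|j IHj] lejb; first by rewrite expr0 mul0r addr0.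
rewrite exprS (le_trans (ler_wpM2l (ltW x_gt0) (IHj (ltnW lejb)))) //.
rewrite /x natrM invfM -[j.+1]addn1 natrD.
have jb : j%:R / b%:R <= (1 : R) by rewrite ler_pdivrMr // mul1r ler_nat ltnW.
have : 0 < b%:R^-1 :> R by rewrite invr_gt0.
rewrite mulrDl; move: (b%:R^-1) (j%:R) jb => u v jb u0; nra.
Qed.

Definition wt (M B : {set E}) i : R :=
  if [disjoint W i & M] then x^-1 ^+ #|W i :\: B| else 0.
Definition phi M B : R := \sum_(i | P i) wt M B i.
Definition pot M B f : R := \sum_(i | P i && (f \in W i)) wt M B i.

Lemma wt_ge0 M B i : 0 <= wt M B i.
Proof. by rewrite /wt; case: ifP => // _; rewrite exprn_ge0 // invr_ge0 ltW. Qed.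

Lemma wt_setU1 M B f i :
  wt (f |: M) B i = if f \in W i then 0 else wt M B i.
Proof.
rewrite /wt -!setI_eq0 setIUr setU_eq0 setI_eq0 disjoint_sym disjoints1.
by case: (f \in W i).
Qed.

Lemma phi_setU1 M B f : phi (f |: M) B = phi M B - pot M B f.
Proof.
rewrite /phi /pot [\sum_(i | P i) wt M B i](bigID (fun i => f \in W i)) /=.
rewrite addrC addrK [LHS](bigID (fun i => f \in W i)) /=.
rewrite [X in X + _]big1 ?add0r => [|i /andP[_ fW]]; last by rewrite wt_setU1 fW.
by apply: eq_bigr => i /andP[_ /negbTE fW]; rewrite wt_setU1 fW.
Qed.

Lemma pot_setU1 M B f g : pot (f |: M) B g <= pot M B g.
Proof.
apply: ler_sum => i _; rewrite wt_setU1; case: ifP => // _; exact: wt_ge0.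
Qed.

Lemma pot_ge0 M B g : 0 <= pot M B g.
Proof. by apply: sumr_ge0 => i _; exact: wt_ge0. Qed.

(** Breaker's turn multiplies the weight of an unmet [W i] by [x^j] with [j <= b], and
    [x^j <= 1 + j/b] charges the increase linearly to the claimed elements. *)
Lemma phi_setU (M B A : {set E}) : (#|A| <= b)%N ->
  phi M (B :|: A) <= phi M B + b%:R^-1 * \sum_(f in A) pot M B f.
Proof.
move=> leAb.
have -> : \sum_(f in A) pot M B f = \sum_(i | P i) wt M B i *+ #|W i :&: A|.
  rewrite /pot (exchange_big_dep P) /=; last by move=> f i _ /andP[].
  apply: eq_bigr => i Pi; rewrite -sumr_const; apply: eq_bigl => f.
  by rewrite !inE Pi andbC.
rewrite mulr_sumr -big_split; apply: ler_sum => i _ /=.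
rewrite -[wt _ _ _ *+ _]mulr_natr mulrCA -[X in X + _]mulr1 -mulrDr [_^-1 * _]mulrC /wt.
case: ifP => _; last by rewrite !mul0r.
have -> : #|W i :\: B| = (#|W i :\: (B :|: A)| + #|(W i :\: B) :&: A|)%N.
  rewrite -(cardsID A (W i :\: B)) addnC; congr (#|pred_of_set _| + _)%N.
  by rewrite setDDl.
rewrite exprD -mulrA -[leLHS]mulr1 ler_wpM2l ?exprn_ge0 ?invr_ge0 ?(ltW x_gt0) //.
rewrite exprVn -ler_pdivrMl ?invr_gt0 ?exprn_gt0 // invrK mulr1.
apply: le_trans (beck_base_expr _) _.
  exact: leq_trans (subset_leq_card (subsetIr _ _)) leAb.
rewrite lerD2l ler_wpM2r ?invr_ge0 ?ler0n // ler_nat.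
by apply/subset_leq_card/setSI/subsetDl.
Qed.

Definition breaker_claimed (h : history E) : {set E} :=
  \bigcup_(k < size h | ~~ maker_turn maker_first k) nth set0 h k.

Local Notation mk := (maker_claimed maker_first).

Lemma bigcup_rcons (Q : pred nat) (h : history E) A :
  \bigcup_(k < size (rcons h A) | Q k) nth set0 (rcons h A) k =
  \bigcup_(k < size h | Q k) nth set0 h k :|: (if Q (size h) then A else set0).
Proof.
rewrite size_rcons big_mkcond big_ord_recr /= nth_rcons ltnn eqxx.
congr (_ :|: _); rewrite [RHS]big_mkcond; apply: eq_bigr => k _.
by rewrite nth_rcons ltn_ord.
Qed.

Lemma unclaimed_rcons (h : history E) A :
  unclaimed board (rcons h A) = unclaimed board h :\: A.
Proof. by rewrite /unclaimed -cats1 big_cat big_seq1 setDDl. Qed.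

Definition best (h : history E) : E :=
  odflt e0 [pick f in unclaimed board h |
    [forall g in unclaimed board h,
       pot (mk h) (breaker_claimed h) g <= pot (mk h) (breaker_claimed h) f]].

Lemma bestP (h : history E) : unclaimed board h != set0 ->
  best h \in unclaimed board h /\
  forall g, g \in unclaimed board h ->
    pot (mk h) (breaker_claimed h) g <= pot (mk h) (breaker_claimed h) (best h).
Proof.
move=> /set0Pn[f0 f0U]; rewrite /best; case: pickP => [f /andP[-> /forall_inP]//|].
case: (arg_maxP (pot (mk h) (breaker_claimed h)) f0U) => f fU fmax.
move=> /(_ f) /negP[]; rewrite [f \in _]fU /=.
by apply/forall_inP => g gU; apply: fmax.
Qed.

(** Before Breaker's turn a reserve covers the potential of any free element; at most [b] elements,
    each charged with a [b]-th of its potential, cannot use up more. *)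
Definition balanced (h : history E) : Prop :=
  phi (mk h) (breaker_claimed h) < 1 /\
  (~~ maker_turn maker_first (size h) -> forall f, f \in unclaimed board h ->
     phi (mk h) (breaker_claimed h) + pot (mk h) (breaker_claimed h) f < 1).

Lemma balanced_rcons h A : unclaimed board h != set0 ->
  legal_move board b maker_first h A ->
  (maker_turn maker_first (size h) -> A = [set best h]) ->
  balanced h -> balanced (rcons h A).
Proof.
move=> U0; rewrite /legal_move => /andP[AU /eqP cA] Abest [phi1 phi2].
rewrite /balanced /maker_claimed /breaker_claimed.
rewrite !bigcup_rcons (bigcup_rcons (fun k => ~~ maker_turn maker_first k)).
rewrite -!/(maker_claimed _ _) -!/(breaker_claimed _).
have -> : maker_turn maker_first (size (rcons h A)) =
          ~~ maker_turn maker_first (size h).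
  by rewrite /maker_turn size_rcons /= addNb.
case: ifP cA Abest phi2 => /= turn cA Abest phi2; last first.
  rewrite setU0; split=> //; move: {phi2}(phi2 isT) => phi2.
  have cAb : (#|A| <= b)%N by rewrite cA geq_minl.
  apply: le_lt_trans (phi_setU _ _ cAb) _.
  have [f fA] : exists f, f \in A.
    by apply/set0Pn; rewrite -card_gt0 cA leq_min b_gt0 card_gt0.
  have b0 : (0 : R) < b%:R by rewrite ltr0n.
  rewrite -ltrBrDl ltr_pdivrMl //.
  apply: (@lt_le_trans _ _ (\sum_(g in A) (1 - phi (mk h) (breaker_claimed h)))).
    rewrite (big_setD1 f) // [ltRHS](big_setD1 f) //=.
    rewrite ltr_leD ?ltrBrDl ?phi2 ?(subsetP AU) //.
    apply: ler_sum => g; rewrite inE => /andP[_ gA].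
    by rewrite ltW // ltrBrDl phi2 // (subsetP AU).
  rewrite sumr_const -[leLHS]mulr_natl ler_wpM2r ?ler_nat //.
  by rewrite subr_ge0 ltW.
(* Maker's move subtracts the largest potential and no potential grows, so [phi] before the move
   bounds [phi] plus any potential after it. *)
rewrite setU0 Abest // setUC phi_setU1; have [bU bmax] := bestP U0.
split=> [|_ f].
  by apply: le_lt_trans phi1; rewrite gerBl pot_ge0.
rewrite unclaimed_rcons inE => /andP[_ fU].
apply: le_lt_trans phi1; rewrite -addrA gerDl addrC subr_le0.
exact: le_trans (pot_setU1 _ _ _ _) (bmax _ fU).
Qed.

Lemma wt_initial M B i : M = set0 -> B = set0 -> wt M B i = x^-1 ^+ #|W i|.
Proof. by move=> -> ->; rewrite /wt disjoints_subset setC0 subsetT setD0. Qed.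

Theorem beck_strategy (wins : {set E} -> Prop) :
  (forall i, P i -> W i \subset board) ->
  \sum_(i | P i) x^-1 ^+ #|W i| < 2^-1 ->
  (forall M : {set E}, M \subset board ->
     (forall i, P i -> ~~ [disjoint W i & M]) -> wins M) ->
  maker_has_winning_strategy board b maker_first wins.
Proof.
move=> Wsub sumW winsP; exists best; split=> [h _ _ /bestP[]//|].
move=> h [hplay hU] hfol; apply: winsP.
  apply/bigcupsP => k _; have [_ /andP[sA _]] := hplay k (ltn_ord k).
  exact: subset_trans sA (subsetDl _ _).
(* If Breaker starts, the bound [1/2] on the initial sum provides the reserve, since a single
   potential is at most [phi]. *)
have bal0 : balanced [::].
  rewrite /balanced /maker_claimed /breaker_claimed !big_ord0.
  have phi0 : phi set0 set0 < 2^-1.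
    by apply: le_lt_trans sumW; apply: ler_sum => i _; rewrite wt_initial.
  split=> [|_ f _]; first lra.
  suff : pot set0 set0 f <= phi set0 set0 by lra.
  rewrite /phi (bigID (fun i => f \in W i)) /= lerDl.
  by apply: sumr_ge0 => i _; exact: wt_ge0.
have bal k : (k <= size h)%N -> balanced (take k h).
  elim: k => [|k IHk] lekh; first by rewrite take0.
  rewrite (take_nth set0) //; have [U0 legal] := hplay k lekh.
  apply: balanced_rcons => //; last by apply: IHk; apply: ltnW.
  by rewrite size_takel ?(ltnW lekh) // => turn; apply: hfol.
have [phi1 _] : balanced h by have := bal _ (leqnn _); rewrite take_size.
move=> i Pi; apply/negP => dis; move: phi1; apply/negP; rewrite -leNgt.
(* With everything claimed, a set that Maker missed belongs to Breaker and alone has weight 1. *)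
have Wi0 : W i :\: breaker_claimed h = set0.
  apply/setP => f; rewrite !inE; apply/negP => /andP[/bigcupP fB fW].
  have fboard := subsetP (Wsub i Pi) f fW.
  have : f \in \bigcup_(A <- h) A.
    by apply: contraT => nf; rewrite -(in_set0 f) -hU inE fboard nf.
  rewrite (big_nth set0) big_mkord => /bigcupP[k _ fk].
  have [turn|turn] := boolP (maker_turn maker_first k); last by case: fB; exists k.
  have : f \in mk h by apply/bigcupP; exists k.
  by move/(disjointFl dis); rewrite fW.
rewrite /phi (bigD1 i) //= {1}/wt dis Wi0 cards0 expr0 lerDl.
by apply: sumr_ge0 => j _; exact: wt_ge0.
Qed.

End Beck.

(** * Weights against the number of words *)

Section Budget.
Variable R : realType.

(** With [u = 1/(2b) <= 1]: [exp(u/2) <= 1/(1 - u/2) <= 1 + u]. *)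
Lemma expR_le_beck_base (b : nat) : (0 < b)%N ->
  expR ((4 * b)%:R^-1 : R) <= beck_base R b.
Proof.
move=> b0; rewrite /beck_base.
have b1 : (1 : R) <= b%:R by rewrite ler1n.
have -> : ((4 * b)%:R^-1 : R) = (2 * b)%:R^-1 / 2.
  by rewrite -invfM -natrM; congr (_%:R^-1); lia.
set u := (2 * b)%:R^-1; have u0 : 0 < u by rewrite invr_gt0 ltr0n muln_gt0.
have u1 : u <= 1 by rewrite invf_le1 ?ltr0n ?ler1n muln_gt0.
have := expR_ge1Dx (- (u / 2)); rewrite expRN => e1.
have e0 := expR_gt0 (u / 2).
have : expR (u / 2) * (1 - u / 2) <= 1.
  by rewrite -ler_pdivlMl // mulr1.
move: (expR _) e0 => e e0 h; nra.
Qed.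

(** The hypothesis on [b] says that [n / (4b)] is at least [10 d ln n], whence the [40 * d]. *)
Lemma beck_base_exp_ge (d n b : nat) : (0 < d)%N -> (1 < n)%N -> (0 < b)%N ->
  b%:R <= (40 * d)%:R^-1 * n%:R / ln (n%:R : R) ->
  n%:R ^+ (10 * d) <= beck_base R b ^+ n.
Proof.
move=> d0 n1 b0 hb.
have ln0 : 0 < ln (n%:R : R) by rewrite ln_gt0 // ltr1n.
have b0' : (0 : R) < b%:R by rewrite ltr0n.
apply: le_trans (_ : expR ((4 * b)%:R^-1 : R) ^+ n <= _); last first.
  by rewrite lerXn2r ?expR_le_beck_base // nnegrE ?expR_ge0 // ltW // (lt_trans ltr01) // beck_base_gt1.
rewrite -expRM_natl -[X in X ^+ _]lnK ?posrE ?ltr0n 1?ltnW //.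
rewrite -expRM_natl ler_expR.
move: hb; rewrite ler_pdivlMr // ler_pdivlMl ?ltr0n ?muln_gt0 // => hb.
rewrite ler_pdivlMr ?ltr0n ?muln_gt0 //; apply: le_trans hb.
by rewrite !natrM le_eqVlt; apply/orP; left; apply/eqP; ring.
Qed.

End Budget.

Lemma card_letter (V : finType) : (2 < #|V|)%N -> (#|{: letter V}| <= #|V| ^ 3)%N.
Proof. by rewrite !card_sum !card_prod => n3; rewrite expnS expnS expn1; nia. Qed.

(** There are at most [n^(3s)] words of length [s]. At least [n s / d] ordered pairs give at least
    [n s / (2d)] edges, so each set has weight at most [x^(-n s / (2d)) <= n^(-5s)]. Over [k]
    families and lengths up to [K n] the total is at most [k K n / n^2], below [1/2] once
    [n > 2 k K]. *)
Theorem static_game (R : realType) (k d K : nat) : (0 < d)%N ->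
  exists c : R, 0 < c /\ exists n0 : nat, forall n : nat, (n0 <= n)%N ->
  forall b : nat, (0 < b)%N -> b%:R <= c * n%:R / ln (n%:R : R) ->
  forall (V : finType) (e : rel V), #|V| = n ->
  forall maker_first : bool, forall ws : 'I_k -> code V,
  (forall i l1 l2 l3 p, p \in ws i l1 l2 l3 -> e p.1 p.2) ->
  (forall m : rel V, symmetric m ->
     (forall x y, m x y -> e x y || e y x) ->
     (forall i, hits m d (K * n) (ws i)) -> hamiltonian m) ->
  maker_wins_hamiltonicity e b maker_first.
Proof.
move=> d0; exists (40 * d)%:R^-1; split; first by rewrite invr_gt0 ltr0n muln_gt0.
exists (3 + 2 * k * K)%N => n nbig b b0 hb V e cV mf ws ws_e ham.
have n3 : (2 < n)%N by lia.
have n0 : (0 < n)%N by lia.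
set L := (K * n)%N.
pose T := {s : 'I_L.+1 & s.-tuple (letter V)}.
pose len (t : T) : nat := tag t.
pose w (i : 'I_k * T) : {set V * V} :=
  let t : seq (letter V) := tagged i.2 in
  ws i.1 (letters1 t) (letters2 t) (letters3 t).
pose P (i : 'I_k * T) := (0 < len i.2)%N && (n * len i.2 <= d * #|w i|)%N.
pose W (i : 'I_k * T) : {set {set V}} := [set [set p.1; p.2] | p in w i].
(* Here [set0] is the default value of Maker's choice, never taken while elements are free. *)
apply: (@beck_strategy R _ set0 (edges e) b mf _ P W b0).
- move=> i _; apply/subsetP => _ /imsetP[p pw ->]; apply/imsetP.
  by exists p => //; rewrite inE; apply: ws_e pw.
- have x0 : 0 < beck_base R b by apply: lt_trans ltr01 (beck_base_gt1 _ b0).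
  have n0R : (0 : R) < n%:R by rewrite ltr0n.
  have term i : P i -> (beck_base R b)^-1 ^+ #|W i| <= (n%:R ^- 5) ^+ len i.2.
    case/andP=> len0 wbig; rewrite !exprVn lef_pV2 ?posrE ?exprn_gt0 //.
    rewrite -(@ler_pXn2r _ (2 * d)) ?nnegrE ?exprn_ge0 ?muln_gt0 ?invr_ge0 ?(ltW x0) ?ler0n //.
    have -> : (n%:R ^+ 5) ^+ len i.2 ^+ (2 * d) = (n%:R ^+ (10 * d)) ^+ len i.2 :> R.
      by rewrite -!exprM; congr (_ ^+ _); lia.
    rewrite -[leRHS]exprM; apply: le_trans (_ : beck_base R b ^+ (n * len i.2) <= _).
      rewrite [leRHS]exprM lerXn2r ?nnegrE ?exprn_ge0 ?(ltW x0) ?ler0n //.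
      by apply: beck_base_exp_ge => //; lia.
    rewrite ler_eXn2l ?beck_base_gt1 //; apply: leq_trans wbig _.
    by rewrite mulnA mulnC leq_mul2r [(_ * 2)%N]mulnC card_unordered orbT.
  apply: le_lt_trans (_ : \sum_(i : 'I_k * T | (0 < len i.2)%N)
                           (n%:R ^- 5 : R) ^+ len i.2 < _).
    apply: (@le_trans _ _ (\sum_(i | P i) (n%:R ^- 5 : R) ^+ len i.2)).
      by apply: ler_sum => i; exact: term.
    rewrite [leLHS]big_mkcond [leRHS]big_mkcond; apply: ler_sum => i _.
    rewrite /P; case: (_ < _)%N => //=; case: ifP => // _.
    by rewrite exprn_ge0 // invr_ge0 exprn_ge0 // ltW.
  rewrite -(pair_big predT (fun t : T => 0 < len t)%N
             (fun _ t => (n%:R ^- 5 : R) ^+ len t)) /= sumr_const card_ord.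
  have -> : \sum_(t : T | (0 < len t)%N) (n%:R ^- 5 : R) ^+ len t =
      \sum_(s < L.+1) \sum_(t : s.-tuple (letter V))
         (if (0 < s)%N then (n%:R ^- 5 : R) ^+ s else 0).
    by rewrite sig_big_dep big_mkcond; apply: eq_bigr => t _.
  have small : \sum_(s < L.+1) \sum_(t : s.-tuple (letter V))
         (if (0 < s)%N then (n%:R ^- 5 : R) ^+ s else 0) <= (n%:R ^- 2) *+ L.
    rewrite big_ord_recl /= sumr_const mul0rn add0r.
    rewrite -[X in _ <= _ *+ X]card_ord -sumr_const; apply: ler_sum => s _.
    rewrite sumr_const card_tuple -[leLHS]mulr_natl natrX.
    have lV : (#|{: letter V}|%:R : R) <= n%:R ^+ 3.
      by rewrite -natrX ler_nat -cV card_letter // cV.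
    apply: le_trans (_ : (n%:R ^+ 3) ^+ s.+1 * (n%:R ^- 5) ^+ s.+1 <= _).
      by rewrite ler_wpM2r ?exprn_ge0 ?invr_ge0 ?exprn_ge0 ?ler0n // lerXn2r
        ?nnegrE ?exprn_ge0 ?ler0n.
    rewrite -exprMn (_ : n%:R ^+ 3 / n%:R ^+ 5 = n%:R ^- 2); last first.
      by field; rewrite lt0r_neq0.
    have : (n%:R ^- 2 : R) <= 1.
      by rewrite invf_le1 ?exprn_gt0 // exprn_ege1 // ler1n.
    by move=> le1; rewrite exprS ler_piMr ?exprn_ile1 ?invr_ge0 ?exprn_ge0 ?ler0n.
  apply: le_lt_trans (ler_wMn2r _ small) _.
  rewrite -mulrnA -[ltLHS]mulr_natl ltr_pdivrMr ?exprn_gt0 // ltr_pdivlMl //.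
  rewrite -natrX -natrM ltr_nat /L; nia.
- move=> M Msub hit.
  have [p [sp cyc pV]] : hamiltonian (fun x y => [set x; y] \in M).
    apply: ham => [x y|x y xyM|i l1 l2 l3 /andP[s0 sL] wbig]; first by rewrite setUC.
      have /imsetP[[u v] /=] := subsetP Msub _ xyM; rewrite inE => euv exy.
      by case: (set2_eq exy) => -[-> ->]; rewrite euv ?orbT.
    pose t := spell l1 l2 l3.
    have st : size t = (size l1 + size l2 + size l3)%N.
      by rewrite /t /spell !size_cat !size_map addnA.
    have stL : (size t < L.+1)%N by rewrite st ltnS.
    pose i' : 'I_k * T := (i, existT _ (Ordinal stL) (in_tuple t)).
    have := hit i'; rewrite /P /W /w /len /= letters1_spell letters2_spell letters3_spell.
    rewrite st s0 -cV => /(_ wbig) /pred0Pn[_ /= /andP[/imsetP[p pw ->] pM]].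
    by exists p.
  by exists p.
Qed.

Theorem theorem1p2 (R : realType) :
  exists c : R, 0 < c /\
  exists n0 : nat, forall n : nat, (n0 <= n)%N ->
  forall b : nat, (0 < b)%N -> b%:R <= c * n%:R / ln (n%:R : R) ->
  forall (V : finType) (e : rel V),
    symmetric e -> irreflexive e -> #|V| = n ->
    (forall v : V, n%:R / 2 <= (degree e v)%:R :> R) ->
  forall maker_first : bool, maker_wins_hamiltonicity e b maker_first.
Proof.
have [d [K [n1 [d0 force]]]] := dirac_forces.
have [c [c0 [n0 game]]] := static_game R 5 K d0.
exists c; split=> //; exists (n0 + n1)%N => n nbig b b0 hb V e e_sym e_irr cV deg mf.
have [||ws [wse ham]] := force V e e_sym e_irr.
- by rewrite cV; lia.
- move=> v; have := deg v; rewrite ler_pdivrMr // -natrM ler_nat cV mulnC.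
  by rewrite /degree /nb.
apply: (game n _ b b0 hb V e cV mf ws wse) => [|m ms me hit]; first by lia.
apply: ham => // [x y /me|i]; last by rewrite cV.
by rewrite [e y x]e_sym orbb.
Qed.
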